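(* Let $u_{n,\varepsilon}$ denote the solution of the $p$-eikonal equation on the random geometric graph, $$\mathcal{A}_{n,\varepsilon}u_{n,\varepsilon}(x)=f(x)\ \text{ if } x\in X\setminus\Gamma,\qquad u_{n,\varepsilon}(x)=0\ \text{ if }x\in\Gamma,$$ and let $g=\rho^{-1/p}f^{1/p}$. There exist $C,c>0$ such that for $\varepsilon$ sufficiently small and any $0<\lambda\le 1$ we have $$\mathbb{P}\left(\max_{x\in X}\big(d_g(x,\Gamma)-u_{n,\varepsilon}(x)\big)\le C(\sqrt{\varepsilon}+\lambda)\right)\ge 1-2n\exp(-cn\varepsilon^d\lambda^2).$$
   Context: Setting. $\Omega\subset\mathbb{R}^d$ is open, bounded and connected with $C^{1,1}$ boundary $\partial\Omega$; $R>0$ denotes the reach of $\partial\Omega$. $x_1,\dots,x_n$ are i.i.d. random variables on $\Omega$ with density $\rho$, where $\rho$ is Lipschitz continuous and $0<\rho_{min}\le\rho(x)\le\rho_{max}$ for all $x\in\Omega$. Put $X=\{x_1,\dots,x_n\}$. The set $\Gamma\subset X$ is a nonempty subset of the vertices with $\mathrm{dist}(\Gamma,\partial\Omega)\ge R$; no other assumption is placed on $\Gamma$. The function $f$ is Lipschitz continuous and positive, with $0<f_{min}\le f\le f_{max}$. $p\ge 1$. Kernel. $\eta:[0,\infty)\to[0,\infty)$ is smooth and nonincreasing, $\eta(0)>0$, $\eta(t)=0$ for $t>1$, and $\int_{B(0,1)}\eta(|z|)\,dz=1$. For $\varepsilon>0$, $\eta_\varepsilon(t)=\varepsilon^{-d}\eta(t/\varepsilon)$.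 The constant $\sigma_p$ is $\sigma_p=\int_{\mathbb{R}^d}\eta(|z|)(z_1)_+^p\,dz$, where $a_+=\max\{a,0\}$. Graph operator. For $u:X\to\mathbb{R}$ and $x\in X$, $$\mathcal{A}_{n,\varepsilon}u(x)=\frac{1}{n\sigma_p\varepsilon^p}\sum_{y\in X}\eta_\varepsilon(|x-y|)\,(u(x)-u(y))_+^p.$$ Geodesic distance. For a positive function $g$ on $\overline\Omega$, $$d_g(x,y)=\inf\Big\{\int_0^1 g(\gamma(t))|\gamma'(t)|\,dt:\ \gamma\in C^1([0,1];\overline\Omega),\ \gamma(0)=x,\ \gamma(1)=y\Big\},\qquad d_g(x,\Gamma)=\min_{y\in\Gamma}d_g(x,y).$$ The constants $C,c$ depend only on the geodesic diameter $\max_{x,y\in\overline\Omega}d_1(x,y)$ of $\Omega$, the $C^{1,1}$ bound on (equivalently the reach of) $\partial\Omega$, the kernel $\eta$, $d$, $\rho_{min},\rho_{max},\mathrm{Lip}(\rho)$, $f_{min},f_{max},\mathrm{Lip}(f)$ and $p$ (in particular not on $n,\varepsilon,\lambda$). *)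

(* Defs.v *)
(* R^d is ['rV[R]_d], for an abstract [R : realType]. *)
From HB Require Import structures.
From mathcomp Require Import all_boot all_order all_algebra.
From mathcomp Require Import all_classical all_reals all_analysis.
Set Implicit Arguments.
Unset Strict Implicit.
Unset Printing Implicit Defensive.
Import Order.TTheory GRing.Theory Num.Theory.
Import numFieldNormedType.Exports.
Local Open Scope classical_set_scope.
Local Open Scope ring_scope.

(* The Borel sigma-algebra of R^n, as the product sigma-algebra generated by
   the coordinates. *)
Definition measure_rV_display : measure_display -> measure_display.
Proof. exact. Qed.

Section measurable_rV.
Context d (T : measurableType d) (n : nat).

Let coords : 'I_n -> 'rV[T]_n -> T := fun i v => v ord0 i.

Let rV_set0 : g_sigma_preimage coords set0.
Proof. exact: sigma_algebra0. Qed.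

Let rV_setC A : g_sigma_preimage coords A -> g_sigma_preimage coords (~` A).
Proof. exact: sigma_algebraC. Qed.

Let rV_bigcup (F : (set 'rV[T]_n)^nat) :
  (forall i, g_sigma_preimage coords (F i)) ->
  g_sigma_preimage coords (\bigcup_i (F i)).
Proof. exact: sigma_algebra_bigcup. Qed.

HB.instance Definition _ := @isMeasurable.Build (measure_rV_display d)
  'rV[T]_n (g_sigma_preimage coords) rV_set0 rV_setC rV_bigcup.

End measurable_rV.

Lemma measurable_coord d (T : measurableType d) n (i : 'I_n) :
  measurable_fun [set: 'rV[T]_n] (fun v => v ord0 i).
Proof.
move=> _ Y mY; rewrite setTI; apply: sub_sigma_algebra => /=.
rewrite -bigcup_seq/=; exists i => /=; first by rewrite mem_index_enum.
by exists Y => //; rewrite setTI.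
Qed.

Lemma measurable_fun_rV d d' (S : measurableType d) (T : measurableType d') n
    (f : S -> 'rV[T]_n) :
  (forall i, measurable_fun [set: S] (fun s => f s ord0 i)) ->
  measurable_fun [set: S] f.
Proof.
move=> mf.
suff sub : g_sigma_preimage (fun i s => f s ord0 i) `<=` measurable.
  move=> _ Y mY; rewrite setTI; apply: sub.
  have -> : (fun i s => f s ord0 i) =
    (fun i : 'I_n => (fun v : 'rV[T]_n => v ord0 i) \o f) by [].
  by rewrite g_sigma_preimage_comp; exists Y => //; rewrite setTI.
apply: smallest_sub; first exact: sigma_algebra_measurable.
rewrite -bigcup_seq => A [i _] [B mB <-]; exact: mf.
Qed.

Section cons_rV.
Context {R : realType} (n : nat).

Definition cons_rV (p : measurableTypeR R * 'rV[R]_n) : 'rV[R]_n.+1 :=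
  \row_i (if unlift ord0 i is Some j then p.2 ord0 j else p.1).

Definition behead_rV (v : 'rV[R]_n.+1) : 'rV[R]_n :=
  \row_i v ord0 (lift ord0 i).

Lemma measurable_cons_rV : measurable_fun [set: measurableTypeR R * 'rV[R]_n] cons_rV.
Proof.
apply: measurable_fun_rV => i.
rewrite (_ : (fun _ => _) = fun p : measurableTypeR R * 'rV[R]_n =>
  if unlift ord0 i is Some j then p.2 ord0 j else p.1); last first.
  by apply/funext => p; rewrite mxE.
case: unliftP => [j _|_]; last exact: measurable_fst.
exact: (measurableT_comp (measurable_coord (T := R) j) measurable_snd).
Qed.

Lemma measurable_uncons_rV :
  measurable_fun [set: 'rV[R]_n.+1] (fun v => (v ord0 ord0, behead_rV v)).
Proof.
apply/measurable_fun_pairP; split; first exact: measurable_coord.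
apply: measurable_fun_rV => i /=.
rewrite (_ : (fun _ => _) = fun v : 'rV[R]_n.+1 => v ord0 (lift ord0 i)).
  exact: measurable_coord.
by apply/funext => v; rewrite /= mxE.
Qed.

Lemma cons_rVK (p : measurableTypeR R * 'rV[R]_n) :
  (cons_rV p ord0 ord0, behead_rV (cons_rV p)) = p.
Proof.
case: p => x v; congr pair; first by rewrite mxE unlift_none.
by apply/rowP => i; rewrite !mxE liftK.
Qed.

End cons_rV.

Section cons_measure.
Context {R : realType} (n : nat).
Variable m1 : {sigma_finite_measure set (measurableTypeR R) -> \bar R}.
Variable m : {sigma_finite_measure set 'rV[R]_n -> \bar R}.

Definition cons_measure : set 'rV[R]_n.+1 -> \bar R :=
  pushforward (m1 \x m)%E (@cons_rV R n).

Let cons_measure0 : cons_measure set0 = 0%E.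
Proof. by rewrite /cons_measure /pushforward preimage_set0 measure0. Qed.

Let cons_measure_ge0 A : (0 <= cons_measure A)%E.
Proof. rewrite /cons_measure /pushforward; exact: measure_ge0. Qed.

Let cons_measure_sigma_additive : semi_sigma_additive cons_measure.
Proof.
move=> F mF tF mUF; rewrite /cons_measure /pushforward preimage_bigcup.
apply: measure_semi_sigma_additive.
- by move=> k; rewrite -[X in measurable X]setTI; exact: measurable_cons_rV.
- apply/trivIsetP => i j _ _ ij; rewrite -preimage_setI.
  by move/trivIsetP : tF => /(_ _ _ I I ij) ->; rewrite preimage_set0.
- rewrite -preimage_bigcup -[X in measurable X]setTI.
  exact: measurable_cons_rV.
Qed.

HB.instance Definition _ := isMeasure.Build _ _ _ cons_measure
  cons_measure0 cons_measure_ge0 cons_measure_sigma_additive.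

Let cons_measure_sigma_finite : sigma_finite setT cons_measure.
Proof.
have /sigma_finiteP[F [FT ndF Foo]] := sigma_finiteT m1.
have /sigma_finiteP[G [GT ndG Goo]] := sigma_finiteT m.
pose uncons (v : 'rV[R]_n.+1) := (v ord0 ord0, behead_rV v).
exists (fun k => uncons @^-1` (F k `*` G k)).
  rewrite -preimage_bigcup; apply/esym/seteqP; split => // v _ /=.
  have [k _ Fk] : (\bigcup_k F k) (v ord0 ord0) by rewrite -FT.
  have [l _ Gl] : (\bigcup_k G k) (behead_rV v) by rewrite -GT.
  exists (maxn k l) => //; split => /=.
    by move: Fk; exact/subsetPset/ndF/leq_maxl.
  by move: Gl; exact/subsetPset/ndG/leq_maxr.
move=> k; have [mF Fk] := Foo k; have [mG Gk] := Goo k; split.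
  rewrite -[X in measurable X]setTI; apply: measurable_uncons_rV => //.
  exact: measurableX.
rewrite /cons_measure /pushforward (_ : _ @^-1` _ = F k `*` G k).
  by rewrite product_measure1E// lte_mul_pinfty// ge0_fin_numE.
by apply/seteqP; split => q; rewrite /preimage/uncons/mkset cons_rVK.
Qed.

HB.instance Definition _ := Measure_isSigmaFinite.Build _ _ _
  cons_measure cons_measure_sigma_finite.

End cons_measure.

(* Lebesgue measure on R^n, as the n-fold product of the one on R. *)
Fixpoint lebesgue_rV {R : realType} (n : nat) :
    {sigma_finite_measure set 'rV[R]_n -> \bar R} :=
  if n is n'.+1 then cons_measure (@lebesgue_measure R) (@lebesgue_rV R n')
  else @dirac _ _ (0 : 'rV[R]_0) R.

Lemma lebesgue_rV_box (R : realType) n (A : 'I_n -> set R) :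
  (forall i, measurable (A i)) ->
  lebesgue_rV n [set v : 'rV[R]_n | forall i, A i (v ord0 i)] =
  (\prod_(i < n) lebesgue_measure (A i))%E.
Proof.
elim: n A => [|n IH] A mA.
  rewrite big_ord0 /= diracE mem_set//=; by case.
rewrite big_ord_recl -IH; last by move=> i; exact: mA.
have mB : measurable [set v : 'rV[R]_n | forall i, A (lift ord0 i) (v ord0 i)].
  rewrite (_ : [set _ | _] = \bigcap_(i in [set: 'I_n])
    ((fun v : 'rV[R]_n => v ord0 i) @^-1` A (lift ord0 i))).
    apply: fin_bigcap_measurable => // i _.
    rewrite -[X in measurable X]setTI.
    exact: (measurable_coord (T := R) i) (mA _).
  by apply/seteqP; split => v /= h i; [move=> _|]; exact: h.
rewrite -[RHS](@product_measure1E _ _ (measurableTypeR R) _ R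
  (@lebesgue_measure R) (lebesgue_rV n) _ _ (mA ord0) mB).
rewrite [LHS]/= /cons_measure /pushforward; congr (_ _).
apply/seteqP; split => -[x v] /=.
  move=> h; split => [|i]; first by have := h ord0; rewrite mxE unlift_none.
  by have := h (lift ord0 i); rewrite mxE liftK.
by move=> [h0 h] i; rewrite mxE; case: unliftP => [j ->|->].
Qed.

Section geometry.
Context {R : realType} {d : nat}.
Local Notation E := 'rV[R]_d.
Implicit Types (x y : E) (A B Omega : set E) (g : E -> R) (gamma : R -> E).

(* The norm [`|x|] that the library puts on ['rV[R]_d] is the sup norm; it
   induces the same topology. *)
Definition enorm x : R := Num.sqrt (\sum_i x ord0 i ^+ 2).

Definition setdist A B : R := inf [set enorm (x - y) | x in A & y in B].

Definition boundary A : set E := closure A `\` interior A.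

(* Reach of A in the sense of Federer. *)
Definition reach A : \bar R := ereal_sup [set r%:E | r in
  [set r : R | 0 <= r /\ forall x, setdist [set x] A < r ->
     exists! y, A y /\ enorm (x - y) = setdist [set x] A]].

(* Lipschitz for the Euclidean norm, unlike the library's [k.-lipschitz_A]. *)
Definition elipschitz (L : R) A g :=
  forall x y, A x -> A y -> `|g x - g y| <= L * enorm (x - y).

(* C^1([0,1]): the derivative in ]0, 1[ extends continuously to [0, 1]. *)
Definition C1_path gamma :=
  [/\ {within `[0, 1], continuous gamma},
      forall t, t \in `]0, 1[ -> derivable gamma t 1,
      forall t, t \in `]0, 1[ -> {for t, continuous (derive1 gamma)},
      cvg (derive1 gamma t @[t --> 0^'+]) &
      cvg (derive1 gamma t @[t --> 1^'-])].

Definition path_length g gamma : \bar R :=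
  (\int[@lebesgue_measure R]_(t in `[0%R, 1%R])
     (g (gamma t) * enorm (derive1 gamma t))%:E)%E.

Definition geodist Omega g x y : \bar R :=
  ereal_inf [set path_length g gamma | gamma in
    [set gamma | [/\ C1_path gamma,
       forall t, t \in `[0, 1] -> closure Omega (gamma t),
       gamma 0 = x & gamma 1 = y]]].

Definition geodist_set Omega g x A : \bar R :=
  ereal_inf [set geodist Omega g x y | y in A].

Definition geodesic_diameter Omega : \bar R :=
  ereal_sup [set geodist Omega (fun=> 1) x y
            | x in closure Omega & y in closure Omega].

End geometry.

Definition C11 (R : realType) (d : nat) (h : 'rV[R]_d -> R) :=
  (forall x, differentiable h x) /\
  exists L : R, forall x y v,
    `|'D_v h x - 'D_v h y| <= L * enorm (x - y) * enorm v.

(* Near each boundary point, in suitable orthonormal coordinates, Omega is the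
   region strictly above the graph of a C^{1,1} function of the last d
   coordinates. *)
Definition C11_boundary (R : realType) (d : nat) (Omega : set 'rV[R]_d.+1) :=
  forall x0, boundary Omega x0 ->
  exists (r : R) (Q : 'M[R]_d.+1) (h : 'rV[R]_d -> R),
  [/\ 0 < r, Q *m Q^T = 1%:M, C11 h &
    forall x, enorm (x - x0) < r ->
      (Omega x <-> h (behead_rV (x *m Q)) < (x *m Q) ord0 ord0)].

Section graph.
Context {R : realType} {d : nat}.
Local Notation E := 'rV[R]_d.+1.

(* eta stands for a function on [0, +oo[; its values at negative arguments
   play no role. Smoothness on [0, +oo[ means that all the derivatives on
   ]0, +oo[ extend continuously to 0. *)
Definition radial_kernel (eta : R -> R) :=
  [/\ forall t, 0 <= t -> 0 <= eta t,
      forall s t, 0 <= s -> s <= t -> eta t <= eta s,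
      [/\ forall k t, 0 < t -> derivable (derive1n k eta) t 1,
          forall k, cvg (derive1n k eta t @[t --> 0^'+]) &
          eta t @[t --> 0^'+] --> eta 0],
      0 < eta 0 /\ (forall t, 1 < t -> eta t = 0) &
      (\int[lebesgue_rV d.+1]_(z in [set z : E | (enorm z < 1)%R])
         (eta (enorm z))%:E = 1)%E].

Definition sigma_const (p : R) (eta : R -> R) : R :=
  fine (\int[lebesgue_rV d.+1]_(z in [set: E])
    (eta (enorm z) * (Num.max (z ord0 ord0) 0) `^ p)%:E)%E.

Definition kernel_scaled (eta : R -> R) (eps t : R) : R :=
  eps ^- d.+1 * eta (t / eps).

Definition graph_op (p : R) (eta : R -> R) (n : nat) (eps : R) (X : set E)
    (u : E -> R) (x : E) : R :=
  (n%:R * sigma_const p eta * eps `^ p)^-1 *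
  \sum_(y \in X) kernel_scaled eta eps (enorm (x - y)) *
     (Num.max (u x - u y) 0) `^ p.

(* Only the values of u on X are constrained. *)
Definition p_eikonal_solution (p : R) (eta : R -> R) (n : nat) (eps : R)
    (X Gamma : set E) (f u : E -> R) :=
  (forall x, (X `\` Gamma) x -> graph_op p eta n eps X u x = f x) /\
  (forall x, Gamma x -> u x = 0).

End graph.

Section samples.
Context {R : realType} {d : nat} (dT : measure_display)
  (T : measurableType dT) (P : probability T R) (n : nat).

Definition has_density (Omega : set 'rV[R]_d) (rho : 'rV[R]_d -> R)
    (X : {RV P >-> 'rV[R]_d}) :=
  forall A : set 'rV[R]_d, measurable A ->
    distribution P X A =
    (\int[lebesgue_rV d]_(z in A `&` Omega) (rho z)%:E)%E.

Definition mutually_independent (x : 'I_n -> {RV P >-> 'rV[R]_d}) :=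
  forall (J : {set 'I_n}) (A : 'I_n -> set 'rV[R]_d),
    (forall i, measurable (A i)) ->
    P (\bigcap_(i in [set` J]) (x i @^-1` A i)) =
    (\prod_(i in J) P (x i @^-1` A i))%E.

End samples.

(* Main.v *)
(* Write s = sqrt eps. The geodesic distance to Gamma is at most D, the infimum of
   the g-lengths of polygonal paths in Omega, and D is at most its sup-convolution
   v(x) = sup_y (D(y) - |x - y|^2 / (2 s)). At a vertex x the supremum is reached in
   the limit at some y, v is semiconvex with slope q = (y - x) / s, and comparing D
   along short segments gives rho(x) |q|^p <= f(x) (1 + O(s)). When y is on the
   boundary, the segments are tilted inwards: since the reach of the boundary is r,
   balls of radius r / 2 touch it from outside, and this costs only a factor
   1 + O(|x - y| / r). Hence (v(x) - v(z))_+ is at most (q.(x - z) + eps s)_+ for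
   |x - z| <= eps, so that the graph operator at v is bounded by empirical averages
   that do not depend on v. A Chernoff bound and a union over grids of points x and
   slopes q show that, with large probability, these averages are at most
   sigma rho(x) |q|^p + C (lambda + s); the kernel moments in different directions
   agree because Lebesgue measure is invariant under reflections. The polynomial
   number of grid points is absorbed in the exponential, as the claim is empty
   unless 2 n exp(- c n eps^d lambda^2) < 1. So (1 + C (s + lambda))^-1 v is a strict
   subsolution, and the maximum of its difference with u is reached on Gamma, where
   v = O(s) because Gamma is at distance at least r from the boundary. *)
Require Import Defs.
From HB Require Import structures.
From mathcomp Require Import all_boot all_order all_algebra.
From mathcomp Require Import all_classical all_reals all_analysis.
From mathcomp Require Import measurable_realfun.
From mathcomp Require Import ring lra.
Set Implicit Arguments.
Unset Strict Implicit.
Unset Printing Implicit Defensive.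
Import Order.TTheory GRing.Theory Num.Theory.
Import numFieldNormedType.Exports.
Local Open Scope classical_set_scope.
Local Open Scope ring_scope.

(** * Euclidean geometry *)

Section euclidean_norm.
Context {R : realType} {d : nat}.
Local Notation E := 'rV[R]_d.
Implicit Types (x y z : E) (t : R).

(** The scale s = sqrt eps is a balance. Semiconvexity costs |x - z|^2 / (2 s) <= eps^2 / (2 s) in a
    difference over distance eps, a relative error of order eps / s; freezing rho and f at x and
    tilting segments at the boundary costs O(s). Both are O(sqrt eps) for this s. Only two
    properties of D matter: it lies above the geodesic distance, and it satisfies a triangle
    inequality along segments contained in Omega. An infimum over polygons has both, and nothing has
    to be known about minimal paths or about D up to the boundary. The function v depends on the
    sample through Gamma, which may be chosen after the sample is seen. The averages must therefore
    be bounded for all slopes q at once, at all vertices; what remains is deterministic. The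
    exponent n eps^d lambda^2 comes from a Chernoff bound whose variance term is proportional to the
    mean: the unnormalised summands are O(1) with mean O(eps^d), and the deviation is lambda eps^d.
    A bound of Hoeffding type would only give eps^(2 d). *)

Definition dot x y : R := \sum_i x ord0 i * y ord0 i.

Lemma dotC x y : dot x y = dot y x.
Proof. by apply: eq_bigr => i _; rewrite mulrC. Qed.

Lemma dotDl x y z : dot (x + y) z = dot x z + dot y z.
Proof. by rewrite -big_split; apply: eq_bigr => i _; rewrite mxE mulrDl. Qed.

Lemma dotZl t x y : dot (t *: x) y = t * dot x y.
Proof. by rewrite mulr_sumr; apply: eq_bigr => i _; rewrite mxE mulrA. Qed.

Lemma dotNl x y : dot (- x) y = - dot x y.
Proof. by rewrite -scaleN1r dotZl mulN1r. Qed.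

Lemma dotBl x y z : dot (x - y) z = dot x z - dot y z.
Proof. by rewrite dotDl dotNl. Qed.

Lemma dotDr x y z : dot x (y + z) = dot x y + dot x z.
Proof. by rewrite dotC dotDl !(dotC x). Qed.

Lemma dotZr t x y : dot x (t *: y) = t * dot x y.
Proof. by rewrite dotC dotZl dotC. Qed.

Lemma dotNr x y : dot x (- y) = - dot x y.
Proof. by rewrite dotC dotNl dotC. Qed.

Lemma dotBr x y z : dot x (y - z) = dot x y - dot x z.
Proof. by rewrite dotDr dotNr. Qed.

Lemma dot0l x : dot 0 x = 0.
Proof. by rewrite -(scale0r 0) dotZl mul0r. Qed.

Definition dotE := (dotDl, dotDr, dotNl, dotNr, dotZl, dotZr).

Lemma sqr_enorm x : enorm x ^+ 2 = dot x x.
Proof.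
rewrite /enorm sqr_sqrtr; last by apply: sumr_ge0 => i _; exact: sqr_ge0.
by apply: eq_bigr => i _; rewrite expr2.
Qed.

Lemma enorm_ge0 x : 0 <= enorm x.
Proof. exact: sqrtr_ge0. Qed.

Lemma coord_le_enorm x i : `|x ord0 i| <= enorm x.
Proof.
rewrite -sqrtr_sqr ler_wsqrtr// (bigD1 i)//= lerDl.
by apply: sumr_ge0 => j _; exact: sqr_ge0.
Qed.

Lemma enorm_eq0 x : enorm x = 0 -> x = 0.
Proof.
move=> x0; apply/rowP => i; rewrite mxE; apply/normr0_eq0/eqP.
by rewrite eq_le normr_ge0 andbT -x0 coord_le_enorm.
Qed.

Lemma enorm0 : enorm (0 : E) = 0.
Proof. by apply/eqP; rewrite -sqrf_eq0 sqr_enorm dot0l. Qed.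

Lemma enorm_gt0 x : x != 0 -> 0 < enorm x.
Proof.
by move=> x0; rewrite lt_neqAle enorm_ge0 andbT eq_sym; apply: contra x0 => /eqP/enorm_eq0/eqP.
Qed.

Lemma enormZ t x : enorm (t *: x) = `|t| * enorm x.
Proof.
apply/eqP; rewrite -(@eqrXn2 _ 2)// ?mulr_ge0 ?enorm_ge0//.
by rewrite exprMn !sqr_enorm !dotE mulrA -expr2 real_normK// num_real.
Qed.

Lemma enormN x : enorm (- x) = enorm x.
Proof. by rewrite -scaleN1r enormZ normrN1 mul1r. Qed.

Lemma enormB x y : enorm (x - y) = enorm (y - x).
Proof. by rewrite -enormN opprB. Qed.

Lemma dot_le_enorm x y : dot x y <= enorm x * enorm y.
Proof.
have [->|x0] := eqVneq x 0; first by rewrite dot0l enorm0 mul0r.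
have [->|y0] := eqVneq y 0; first by rewrite dotC dot0l enorm0 mulr0.
have px := enorm_gt0 x0; have py := enorm_gt0 y0.
have := sqr_ge0 (enorm (enorm y *: x - enorm x *: y)).
rewrite sqr_enorm !dotE -!sqr_enorm (dotC y x) => h.
have {}h : 0 <= (enorm x * enorm y) * (enorm x * enorm y - dot x y) by nra.
by rewrite -subr_ge0; rewrite pmulr_rge0// mulr_gt0 in h.
Qed.

Lemma enormD x y : enorm (x + y) <= enorm x + enorm y.
Proof.
rewrite -(@ler_pXn2r _ 2)// ?nnegrE ?addr_ge0 ?enorm_ge0//.
rewrite sqr_enorm !dotE -!sqr_enorm (dotC y).
have := dot_le_enorm x y; nra.
Qed.

Lemma sqr_enormDZ x y t :
  enorm (x + t *: y) ^+ 2 = enorm x ^+ 2 + 2 * t * dot x y + t ^+ 2 * enorm y ^+ 2.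
Proof. by rewrite !sqr_enorm !dotE (dotC y x); ring. Qed.

Lemma enorm_sub_triangle x y z : enorm (x - z) <= enorm (x - y) + enorm (y - z).
Proof. by rewrite (le_trans _ (enormD _ _))// addrA subrK. Qed.

Lemma enorm_le_sum x : enorm x <= \sum_i `|x ord0 i|.
Proof.
have h (s : seq 'I_d) : \sum_(i <- s) `|x ord0 i| ^+ 2 <= (\sum_(i <- s) `|x ord0 i|) ^+ 2.
  elim: s => [|i s IH]; first by rewrite !big_nil expr0n.
  rewrite !big_cons sqrrD -addrA lerD2l (le_trans IH)//.
  by rewrite lerDr mulrn_wge0// mulr_ge0// sumr_ge0.
rewrite -(@ler_pXn2r _ 2)// ?nnegrE ?enorm_ge0 ?sumr_ge0// sqr_enorm.
rewrite (le_trans _ (h _))// le_eqVlt; apply/orP; left; apply/eqP.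
by apply: eq_bigr => i _; rewrite real_normK ?num_real.
Qed.

Lemma norm_le_enorm x : `|x| <= enorm x.
Proof.
have [->|x0] := eqVneq x 0; first by rewrite normr0 enorm_ge0.
have /mx_norm_neq0[[i j]] : mx_norm x != 0.
  by apply: contra x0 => /eqP h; apply/eqP; exact: mx_norm_eq0.
by rewrite -[mx_norm x]/`|x| => -> /=; rewrite (ord1 i) coord_le_enorm.
Qed.

Lemma coord_le_norm x i : `|x ord0 i| <= `|x|.
Proof.
rewrite [leRHS]mx_normrE.
exact: (le_bigmax _ (fun k : 'I_1 * 'I_d => `|x k.1 k.2|) (ord0, i)).
Qed.

Lemma enorm_le_norm x : enorm x <= d%:R * `|x|.
Proof.
rewrite (le_trans (enorm_le_sum _))//.
rewrite (le_trans (ler_sum _ (fun i _ => coord_le_norm x i)))//.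
by rewrite sumr_const card_ord mulr_natl.
Qed.

(** The topology is that of the sup norm, which is within a factor [d] of the Euclidean one;
    dividing by [d + 1] covers [d = 0]. *)
Lemma nbhs_enormP x (P : set E) :
  nbhs x P <-> exists2 e : R, 0 < e & forall y, enorm (y - x) < e -> P y.
Proof.
split=> [/nbhs_normP[e /= e0 h]|[e e0 h]].
  exists e => // y yx; apply: h => /=.
  by rewrite -normrN opprB (le_lt_trans (norm_le_enorm _)).
have e1 : 0 < e / (d%:R + 1) by rewrite divr_gt0// ltr_wpDl.
apply/(@nbhs_normP _ _ x); exists (e / (d%:R + 1)) => //= y /= yx; apply: h.
rewrite enormB (le_lt_trans (enorm_le_norm _))//.
rewrite (le_lt_trans (ler_wpM2r _ (_ : _ <= d%:R + 1)))// ?lerDl//.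
by rewrite mulrC -ltr_pdivlMr// ltr_wpDl.
Qed.

Lemma enorm_lip x y : `|enorm x - enorm y| <= enorm (x - y).
Proof.
rewrite ler_norml; apply/andP; split.
  by have := enorm_sub_triangle y x 0; rewrite !subr0 enormB; lra.
by have := enorm_sub_triangle x y 0; rewrite !subr0; lra.
Qed.

Lemma elip_continuous (f : E -> R) (L : R) :
  (forall x y, `|f x - f y| <= L * enorm (x - y)) -> continuous f.
Proof.
move=> Lf x; apply/(@cvgrPdist_lt _ _ _ (nbhs x)) => e e0; apply/nbhs_enormP.
exists (e / (`|L| + 1)); first by rewrite divr_gt0// ltr_wpDl.
move=> y; rewrite ltr_pdivlMr ?ltr_wpDl// => h; rewrite (le_lt_trans (Lf _ _))//.
apply: le_lt_trans h; rewrite enormB mulrC ler_wpM2l ?enorm_ge0//.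
by rewrite (le_trans (ler_norm _))// lerDl.
Qed.

Lemma closure_enormP (A : set E) x :
  closure A x <-> forall e : R, 0 < e -> exists2 y, A y & enorm (y - x) < e.
Proof.
split=> [cA e e0|h B /nbhs_enormP[e e0 eB]].
  have /cA[y [Ay yx]] : nbhs x [set y | enorm (y - x) < e].
    by apply/nbhs_enormP; exists e.
  by exists y.
by have [y Ay /eB By] := h _ e0; exists y.
Qed.

End euclidean_norm.

(** * Outward normals of a domain whose boundary has positive reach *)

Section nearest_point.
Context {R : realType} {d : nat}.
Local Notation E := 'rV[R]_d.
Implicit Types (x y z a b : E) (A Omega : set E) (s t r : R).

Lemma enorm_conv_lt x y z s t : 0 <= t <= 1 ->
  enorm (x - z) < s -> enorm (y - z) < s -> enorm (x + t *: (y - x) - z) < s.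
Proof.
move=> /andP[t0 t1] xs ys.
have -> : x + t *: (y - x) - z = (1 - t) *: (x - z) + t *: (y - z).
  by apply/rowP => i; rewrite !mxE; ring.
apply: le_lt_trans (enormD _ _) _.
rewrite !enormZ !ger0_norm ?subr_ge0//.
have [->|tn0] := eqVneq t 0; first by rewrite subr0 mul1r mul0r addr0.
have : t * enorm (y - z) < t * s by rewrite ltr_pM2l// lt_neqAle eq_sym tn0.
have : (1 - t) * enorm (x - z) <= (1 - t) * s.
  by rewrite ler_wpM2l ?subr_ge0// ltW.
lra.
Qed.

(** The first exit time gives the point: times just before it are inside, and times outside
    accumulate at it, so that it is not interior. *)
Lemma segment_meets_boundary Omega x y : open Omega -> Omega x -> ~ Omega y ->
  exists2 t, 0 <= t <= 1 & boundary Omega (x + t *: (y - x)).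
Proof.
move=> oO Ox nOy.
pose c t := x + t *: (y - x).
pose A := [set t | 0 <= t <= 1 /\ ~ Omega (c t)].
have A1 : A 1 by split; [rewrite ler01 lexx | rewrite /c scale1r addrC subrK].
have A0 : A !=set0 by exists 1.
have lA : has_lbound A by exists 0 => t [/andP[]].
have h0 : 0 <= inf A by apply: lb_le_inf => // t [/andP[]].
have h1 : inf A <= 1 by exact: ge_inf.
pose l := enorm (y - x) + 1.
have l0 : 0 < l by rewrite /l; have := enorm_ge0 (y - x); lra.
have cc u v e : 0 < e -> `|u - v| < e / l -> enorm (c u - c v) < e.
  move=> e0 uv; rewrite /c opprD addrACA subrr add0r -scalerBl enormZ.
  move: uv; rewrite ltr_pdivlMr// => uv; apply: le_lt_trans uv.
  by rewrite ler_wpM2l// /l lerDl.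
exists (inf A); first by rewrite h0.
split.
  apply/closure_enormP => e e0.
  have [i0|i0] := eqVneq (inf A) 0.
    by exists x => //; rewrite i0 scale0r addr0 subrr enorm0.
  have ip : 0 < inf A by rewrite lt_neqAle eq_sym i0.
  have el : 0 < e / l by rewrite divr_gt0.
  pose s := Num.max 0 (inf A - e / l / 2).
  have sA : s < inf A by rewrite gt_max ip/= ltrBlDr ltrDl divr_gt0.
  have s0 : 0 <= s by rewrite le_max lexx.
  exists (c s); last first.
    apply: cc => //; rewrite ltr0_norm ?subr_lt0// opprB ltrBlDr.
    have : inf A - e / l / 2 <= s by rewrite le_max lexx orbT.
    lra.
  apply: contrapT => nOs.
  have : inf A <= s.
    by apply: ge_inf => //; split => //; rewrite s0/=; lra.
  lra.
rewrite -/(c _) => Oi.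
have /nbhs_enormP[e e0 he] : nbhs (c (inf A)) Omega.
  exact: Oi.
have [t At tA] : exists2 t, A t & t < inf A + e / l.
  by apply: inf_adherent => //; rewrite divr_gt0.
apply: (At.2); apply: he; apply: cc => //.
have : inf A <= t by exact: ge_inf.
by move=> it; rewrite ger0_norm; lra.
Qed.

Lemma ball_meets_boundary Omega z x y s : open Omega -> Omega x -> ~ Omega y ->
  enorm (x - z) < s -> enorm (y - z) < s ->
  exists2 b, boundary Omega b & enorm (b - z) < s.
Proof.
move=> oO Ox nOy xs ys.
have [t t01 bt] := segment_meets_boundary oO Ox nOy.
by exists (x + t *: (y - x)) => //; exact: enorm_conv_lt.
Qed.

(** Positive reach stated by comparing norms instead of through the infimum in [setdist]; the point
    [b] witnesses that [x] is in the tube of radius [s]. *)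
Definition unique_nearest A s := forall x b, A b -> enorm (x - b) < s ->
  exists y, [/\ A y, forall b', A b' -> enorm (x - y) <= enorm (x - b') &
    forall y', A y' -> enorm (x - y') <= enorm (x - y) -> y' = y].

Lemma setdist1_le A x b : A b -> setdist [set x] A <= enorm (x - b).
Proof.
move=> Ab; apply: ge_inf.
  by exists 0 => _ [u _ [v _ <-]]; exact: enorm_ge0.
by exists x => //; exists b.
Qed.

Lemma reach_unique_nearest A r s : reach A = r%:E -> s < r -> unique_nearest A s.
Proof.
move=> rA sr x b Ab xb.
have [_ [s' [s'0 hs'] <-]] : exists2 e, [set r'%:E | r' in
    [set r' : R | 0 <= r' /\ forall x, setdist [set x] A < r' ->
     exists! y, A y /\ enorm (x - y) = setdist [set x] A]] e & (s%:E < e)%E.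
  by apply/ereal_sup_gt; rewrite -/(reach A) rA lte_fin.
rewrite lte_fin => ss'.
have [|y [[Ay xy] yu]] := hs' x.
  exact: le_lt_trans (setdist1_le _ Ab) (lt_trans xb ss').
exists y; split => // [b' Ab'|y' Ay' y'y]; first by rewrite xy setdist1_le.
apply/esym/yu; split => //; apply/eqP.
by rewrite eq_le -{1}xy y'y setdist1_le.
Qed.

Definition edist A x : R := inf [set enorm (x - b) | b in A].

Lemma edist_le A x b : A b -> edist A x <= enorm (x - b).
Proof.
move=> Ab; apply: ge_inf; last by exists b.
by exists 0 => _ [u _ <-]; exact: enorm_ge0.
Qed.

Lemma le_edist A x s : A !=set0 -> (forall b, A b -> s <= enorm (x - b)) ->
  s <= edist A x.
Proof.
by move=> [b Ab] h; apply: lb_le_inf; [exists (enorm (x - b)), b|move=> _ [u /h ? <-]].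
Qed.

Lemma edist_continuous A : A !=set0 -> continuous (edist A).
Proof.
move=> A0; apply: (@elip_continuous _ _ _ 1) => x y; rewrite mul1r.
have h u v : edist A u - enorm (u - v) <= edist A v.
  apply: le_edist => // b Ab; have := edist_le u Ab.
  have := enorm_sub_triangle u v b; lra.
have := h x y; have := h y x; rewrite (enormB y x) ler_norml => h1 h2.
by apply/andP; split; lra.
Qed.

Lemma bounded_closed_ball x t : bounded_set [set z | enorm (z - x) <= t].
Proof.
exists (t + enorm x); split; first exact: num_real.
move=> m hm z /= zx; rewrite (le_trans (norm_le_enorm _))//.
have := enorm_sub_triangle z x 0; rewrite !subr0; lra.
Qed.

Lemma compact_closed_ball x t : compact [set z : E | enorm (z - x) <= t].
Proof.
apply: bounded_closed_compact; first exact: bounded_closed_ball.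
rewrite -[X in closed X]/((fun z => enorm (z - x)) @^-1` [set u | u <= t]).
apply: closed_comp; last exact: closed_le.
move=> z _; apply: (@elip_continuous _ _ _ 1) => u v.
by rewrite mul1r (le_trans (enorm_lip _ _))// opprB addrA subrK.
Qed.

(** Continuity of the nearest point, by compactness: on the part of [A] at distance at least [t]
    from [a], the distance to [x] attains a minimum, which exceeds [enorm (x - a)] by uniqueness. *)
Lemma nearest_stable A x a t : compact A -> A a ->
  (forall y, A y -> enorm (x - y) <= enorm (x - a) -> y = a) -> 0 < t ->
  exists2 e, 0 < e &
    forall b, A b -> enorm (x - b) <= enorm (x - a) + e -> enorm (b - a) < t.
Proof.
move=> cA Aa ua t0.
pose A' := A `&` [set b | t <= enorm (b - a)].
have cA' : compact A'.
  apply: compact_closedI => //.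
  rewrite -[X in closed X]/((fun z => enorm (z - a)) @^-1` [set u | t <= u]).
  apply: closed_comp; last exact: closed_ge.
  move=> z _; apply: (@elip_continuous _ _ _ 1) => u v.
  by rewrite mul1r (le_trans (enorm_lip _ _))// opprB addrA subrK.
have [A'0|/set0P/negP/negPn/eqP A'0] := pselect (A' !=set0); last first.
  exists 1 => // b Ab _; rewrite ltNge; apply/negP => tb.
  by have : A' b by []; rewrite A'0.
have cf : {within A', continuous (fun b => enorm (x - b))}.
  apply: continuous_subspaceT; apply: (@elip_continuous _ _ _ 1) => u v.
  rewrite mul1r (le_trans (enorm_lip _ _))//.
  by rewrite opprB addrC addrA subrK enormB.
have [c /set_mem[Ac tc] hc] := compact_EVT_min A'0 cA' cf.
have xc : enorm (x - a) < enorm (x - c).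
  rewrite ltNge; apply/negP => /(ua _ Ac) ca.
  by move: tc; rewrite /= ca subrr enorm0; lra.
exists ((enorm (x - c) - enorm (x - a)) / 2); first by rewrite divr_gt0// subr_gt0.
move=> b Ab xb; rewrite ltNge; apply/negP => tb.
have := hc b; rewrite inE => /(_ (conj Ab tb)); lra.
Qed.

(* Federer: push the centre of an exterior ball along its normal. The point of
   the closed ball around the current centre z0 that is farthest from A lies, by
   first order optimality, on the ray through z0 issued from its nearest point. *)
Lemma exterior_ball_step A a n s0 t s : compact A -> unique_nearest A s ->
  A a -> enorm n = 1 -> 0 < t -> t <= s0 -> s0 + t < s ->
  (forall b, A b -> s0 <= enorm (a + s0 *: n - b)) ->
  forall b, A b -> s0 + t <= enorm (a + (s0 + t) *: n - b).
Proof.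
move=> cA uA Aa n1 t0 ts0 s0s hs0.
set z0 := a + s0 *: n in hs0 *.
have A0 : A !=set0 by exists a.
have z0a : enorm (z0 - a) = s0.
  by rewrite /z0 addrC addKr enormZ n1 mulr1 ger0_norm//; lra.
have z0E : z0 = a + s0 *: n by [].
move: z0 hs0 z0a z0E => z0 hs0 z0a z0E.
have K0 : [set z : E | enorm (z - z0) <= t] !=set0.
  by exists z0; rewrite /= subrr enorm0 ltW.
have cf := continuous_subspaceT (@edist_continuous A A0) : {within [set z : E | enorm (z - z0) <= t], continuous (edist A)}.
have [z1 /set_mem /= z1K z1max] := compact_EVT_max K0 (@compact_closed_ball z0 t) cf.
pose s1 := edist A z1.
have s0s1 : s0 <= s1.
  apply: (le_trans (le_edist A0 hs0)); apply: z1max.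
  by rewrite inE /= subrr enorm0 ltW.
have z1a : enorm (z1 - a) <= s0 + t.
  have := enorm_sub_triangle z1 z0 a; lra.
have s1s : s1 <= s0 + t by apply: le_trans (edist_le _ Aa) z1a.
have [a1 [Aa1 a1min a1u]] := uA _ _ Aa (le_lt_trans z1a s0s).
have z1a1 : enorm (z1 - a1) = s1.
  by apply/eqP; rewrite eq_le edist_le// le_edist.
have s10 : 0 < s1 by lra.
pose n1' := s1^-1 *: (z1 - a1).
have n1'1 : enorm n1' = 1 by rewrite enormZ z1a1 gtr0_norm ?invr_gt0// mulVf// gt_eqF.
have z1E : z1 = a1 + s1 *: n1'.
  by rewrite scalerA divff ?gt_eqF// scale1r addrC subrK.
have n1'E : n1' = s1^-1 *: (z1 - a1) by [].
move: n1' n1'1 z1E n1'E => n1' n1'1 z1E n1'E.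
(* [z1] maximises the distance to [A] over the ball, and [z0 + t *: n1'] is another point of the
   ball. Moving from [z1] in the direction [w] must therefore not increase this distance. *)
pose w := z0 + t *: n1' - z1.
have wh h : 0 < h -> h <= 1 ->
    exists b, [/\ A b, enorm (z1 - b) <= s1 + h * enorm w & dot w (z1 - b) <= 0].
  move=> h0 h1; pose zh := z1 + h *: w.
  have zhK : enorm (zh - z0) <= t.
    have -> : zh - z0 = (1 - h) *: (z1 - z0) + h *: (t *: n1').
      by rewrite /zh /w; apply/rowP => i; rewrite !mxE; ring.
    rewrite (le_trans (enormD _ _))// !enormZ n1'1 !ger0_norm; [|lra..].
    have : (1 - h) * enorm (z1 - z0) <= (1 - h) * t by rewrite ler_wpM2l//; lra.
    lra.
  have zhs1 : edist A zh <= s1 by apply: z1max; rewrite inE.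
  have zha : enorm (zh - a) < s.
    have := enorm_sub_triangle zh z0 a; lra.
  have [b [Ab bmin _]] := uA _ _ Aa zha.
  have zhb : enorm (zh - b) <= s1 by apply: le_trans zhs1; exact: le_edist.
  exists b; split => //.
    apply: (le_trans (enorm_sub_triangle _ zh _)).
    by rewrite enormB /zh [X in enorm X]addrC addKr enormZ gtr0_norm//; lra.
  have b1 : s1 <= enorm (z1 - b) by exact: edist_le.
  have e1 : zh - b = (z1 - b) + h *: w by rewrite /zh addrAC.
  have : enorm (zh - b) ^+ 2 <= s1 ^+ 2.
    by rewrite ler_pXn2r// nnegrE ?enorm_ge0// ltW.
  have : s1 ^+ 2 <= enorm (z1 - b) ^+ 2.
    by rewrite ler_pXn2r// nnegrE ?enorm_ge0// ltW.
  rewrite e1 sqr_enormDZ (dotC _ w) => q1 q2.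
  have q3 : 0 <= (h * enorm w) ^+ 2 by exact: sqr_ge0.
  have q4 : h * dot w (z1 - b) <= 0 by nra.
  by move: q4; rewrite pmulr_rle0.
(* As [h] tends to 0, the points [b] of [wh] tend to [a1] by [nearest_stable]. *)
have wa1 : dot w (z1 - a1) <= 0.
  apply/ler_addgt0Pl => e e0; rewrite addr0.
  have e1 : 0 < e / (enorm w + 1) by rewrite divr_gt0// ltr_wpDl ?enorm_ge0.
  have [tau tau0 ht] := nearest_stable cA Aa1 a1u e1.
  pose h := Num.min 1 (tau / (enorm w + 1)).
  have h0 : 0 < h by rewrite lt_min ltr01 divr_gt0// ltr_wpDl ?enorm_ge0.
  have [|b [Ab zb wb]] := wh h h0; first by rewrite ge_min lexx.
  have hw : h * enorm w <= tau.
    have : h * (enorm w + 1) <= tau.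
      by rewrite -ler_pdivlMr ?ltr_wpDl ?enorm_ge0// ge_min lexx orbT.
    lra.
  have /ht : enorm (z1 - b) <= enorm (z1 - a1) + tau by lra.
  move=> /(_ Ab); rewrite ltr_pdivlMr ?ltr_wpDl ?enorm_ge0// => ba.
  have -> : z1 - a1 = (z1 - b) + (b - a1) by rewrite addrA subrK.
  rewrite dotDr; have := dot_le_enorm w (b - a1).
  have := enorm_ge0 (b - a1); nra.
(* Equality case of Cauchy-Schwarz: |z0 - z1| <= t and (z0 - z1).n1' <= - t force |z0 - z1 + t
   n1'|^2 <= 0. *)
have z1n : z1 = z0 + t *: n1'.
  have e1 : dot (z0 - z1) n1' + t <= 0.
    have : dot w n1' <= 0 by rewrite n1'E dotZr pmulr_rle0// invr_gt0.
    rewrite (_ : w = (z0 - z1) + t *: n1'); last by rewrite /w addrAC.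
    by rewrite dotDl dotZl -sqr_enorm n1'1 expr1n mulr1.
  apply/eqP; rewrite -subr_eq0; apply/eqP/enorm_eq0/eqP.
  rewrite -sqrf_eq0 eq_le sqr_ge0 andbT.
  rewrite (_ : z1 - _ = - ((z0 - z1) + t *: n1')); last first.
    by apply/rowP => i; rewrite !mxE; ring.
  rewrite enormN sqr_enormDZ n1'1.
  have : enorm (z0 - z1) ^+ 2 <= t ^+ 2.
    by rewrite ler_pXn2r ?nnegrE ?enorm_ge0 1?enormB// ltW.
  nra.
have z0a1 : z0 - a1 = (s1 - t) *: n1'.
  have -> : z0 = z1 - t *: n1' by rewrite z1n addrK.
  by rewrite {1}z1E; apply/rowP => i; rewrite !mxE; ring.
have nz0a1 : enorm (z0 - a1) = s1 - t.
  by rewrite z0a1 enormZ n1'1 mulr1 ger0_norm//; lra.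
(* Now [a] and [a1] are both nearest to [z0], hence equal, and the ray through [z1] is the original
   normal ray. *)
have s1E : s1 = s0 + t by have := hs0 _ Aa1; lra.
have z0as : enorm (z0 - a) < s by lra.
have [y [Ay _ yu]] := uA _ _ Aa z0as.
have ay : a = y by apply: yu => //; rewrite z0a; exact: hs0.
have a1y : a1 = y by apply: yu => //; rewrite nz0a1 s1E addrK; exact: hs0.
have nn : n = n1'.
  have : s0 *: n = s0 *: n1'.
    have -> : s0 *: n = z0 - a by rewrite z0E addrC addKr.
    by rewrite ay -a1y z0a1 s1E addrK.
  by move/scalerI; apply; rewrite gt_eqF//; lra.
have -> : a + (s0 + t) *: n = z1.
  by rewrite z1n -nn z0E scalerDl addrA.
by move=> b Ab; rewrite -s1E; exact: edist_le.
Qed.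

(** One step at most doubles the radius, since [t <= s0]; finitely many steps reach any radius below
    [s]. *)
Lemma exterior_ball_extend A a n s0 s1 s : compact A -> unique_nearest A s ->
  A a -> enorm n = 1 -> 0 < s0 -> s0 <= s1 -> s1 < s ->
  (forall b, A b -> s0 <= enorm (a + s0 *: n - b)) ->
  forall b, A b -> s1 <= enorm (a + s1 *: n - b).
Proof.
move=> cA uA Aa n1 s00 s01 s1s h0.
have [k sk] : exists k : nat, s1 <= 2 ^+ k * s0.
  have /archi_boundP : 0 <= s1 / s0 by rewrite divr_ge0//; lra.
  set k := Num.bound _ => hk; exists k; rewrite -ler_pdivrMr//.
  rewrite (le_trans (ltW hk))// -natrX ler_nat ltnW//; exact: ltn_expl.
elim: k s1 s01 s1s sk => [|k IH] s1 s01 s1s sk.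
  have -> // : s1 = s0 by move: sk; rewrite expr0; lra.
have [ss|ss] := leP (s1 / 2) s0.
  have [<-//|ne] := eqVneq s0 s1.
  have lts : s0 < s1 by rewrite lt_neqAle ne.
  have e1 : s1 = s0 + (s1 - s0) by ring.
  by rewrite e1; apply: (exterior_ball_step cA uA) => //; lra.
have e1 : s1 = s1 / 2 + s1 / 2 by field.
rewrite {1 2}e1; apply: (exterior_ball_step cA uA) => //; try lra.
by apply: IH; [lra|lra|move: sk; rewrite exprS; lra].
Qed.

End nearest_point.

(** * Local defining functions and exterior balls at the boundary *)

Section C11_geometry.
Context {R : realType} {d : nat}.
Local Notation E := 'rV[R]_d.+1.
Implicit Types (x y z : E) (Omega : set E).

Lemma enorm_orthogonal (Q : 'M[R]_d.+1) x : Q *m Q^T = 1%:M -> enorm (x *m Q) = enorm x.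
Proof.
have dotmx (u v : E) : dot u v = (u *m v^T) ord0 ord0.
  by rewrite mxE; apply: eq_bigr => i _; rewrite mxE.
move=> QQ; apply/eqP; rewrite -(@eqrXn2 _ 2)// ?enorm_ge0// !sqr_enorm !dotmx.
by rewrite trmx_mul mulmxA -(mulmxA x) QQ mulmx1.
Qed.

Lemma behead_rVD x y : behead_rV (x + y) = behead_rV x + behead_rV y.
Proof. by apply/rowP => i; rewrite !mxE. Qed.

Lemma behead_rVZ (t : R) x : behead_rV (t *: x) = t *: behead_rV x.
Proof. by apply/rowP => i; rewrite !mxE. Qed.

Lemma enorm_behead x : enorm (behead_rV x) <= enorm x.
Proof.
rewrite ler_wsqrtr// [leRHS]big_ord_recl.
under eq_bigr do rewrite mxE.
by rewrite lerDr sqr_ge0.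
Qed.

Lemma mulmx_linear_repr (l : E -> R) : (forall (a : R) x y, l (a *: x + y) = a * l x + l y) ->
  exists v, forall x, l x = dot x v.
Proof.
move=> ll; have l0 : l 0 = 0.
  by have := ll 1 0 0; rewrite scaler0 addr0 mul1r => /eqP; rewrite -subr_eq subrr => /eqP.
exists (\row_i l (delta_mx 0 i)) => x; rewrite {1}(row_sum_delta x).
have h (s : seq 'I_d.+1) : l (\sum_(i <- s) x 0 i *: delta_mx 0 i) =
    \sum_(i <- s) x 0 i * l (delta_mx 0 i).
  by elim: s => [|i s IH]; rewrite ?big_nil// !big_cons ll IH.
by rewrite h; apply: eq_bigr => i _; rewrite mxE.
Qed.

Lemma line_is_derive (h : 'rV[R]_d -> R) (b v : 'rV[R]_d) (s : R) :
  (forall x : 'rV[R]_d, differentiable h x) ->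
  is_derive s 1 (fun u : R => h (b + u *: v)) ('D_v h (b + s *: v)).
Proof.
move=> dh.
have e : (fun k : R => k^-1 *: (h (b + (k *: 1 + s) *: v) - h (b + s *: v))) =
         (fun k : R => k^-1 *: (h (k *: v + (b + s *: v)) - h (b + s *: v))).
  by apply/funext => k; rewrite scalerDl addrCA [k *: 1]mulr1.
have dd : derivable h (b + s *: v) v by exact: diff_derivable.
split; first by rewrite /derivable [X in X @ _]e.
by rewrite /derive [X in X @ _]e.
Qed.

Lemma line_mvt (h : 'rV[R]_d -> R) (b v : 'rV[R]_d) :
  (forall x : 'rV[R]_d, differentiable h x) ->
  exists2 t, 0 <= t <= 1 & h (b + v) - h b = 'D_v h (b + t *: v).
Proof.
move=> dh.
have [||t t01] := @MVT R (fun u : R => h (b + u *: v)) (fun u => 'D_v h (b + u *: v)) 0 1 ltr01.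
- by move=> t _; exact: line_is_derive.
- apply: derivable_within_continuous => t _.
  exact: (@ex_derive _ _ _ _ _ _ _ (line_is_derive _ _ _ _)).
rewrite scale1r scale0r addr0 subr0 mulr1 => e.
by exists t => //; move: t01; rewrite in_itv/= => /andP[/ltW-> /ltW->].
Qed.

(* [v] is the gradient of [phi] at [y], and the last item is Taylor's formula for a
   function with Lipschitz gradient. *)
Lemma C11_boundary_defining Omega y : C11_boundary Omega -> open Omega ->
  boundary Omega y ->
  exists (rho L : R) (phi : E -> R) (v : E),
  [/\ 0 < rho, 0 <= L /\ v != 0, phi y = 0,
    forall x, enorm (x - y) < rho -> (Omega x <-> phi x < 0) &
    forall x w, `|phi (x + w) - phi x - dot w v| <= L * (enorm (x - y) + enorm w) * enorm w].
Proof.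
move=> hC oO by_; have [r [Q [h [r0 QQ [dh [L0 Lh]] hO]]]] := hC _ by_.
pose phi x := h (behead_rV (x *m Q)) - (x *m Q) ord0 ord0.
pose Dphi x w := 'D_(behead_rV (w *m Q)) h (behead_rV (x *m Q)) - (w *m Q) ord0 ord0.
have [v hv] : exists v, forall w, Dphi y w = dot w v.
  apply: mulmx_linear_repr => a u w; rewrite /Dphi.
  rewrite mulmxDl -scalemxAl behead_rVD behead_rVZ !deriveE//.
  set q := behead_rV _.
  have -> p1 p2 : 'd h q (a *: p1 + p2) = a * 'd h q p1 + 'd h q p2 by rewrite linearP.
  by rewrite !mxE; ring.
have v0 : v != 0.
  (* [w] is the vertical direction of the chart, in which the derivative of [phi] is -1. *)
  apply/eqP => v0; pose w := (delta_mx 0 0 : E) *m Q^T.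
  have wQ : w *m Q = delta_mx 0 0 by rewrite -mulmxA (mulmx1C QQ) mulmx1.
  have := hv w; rewrite v0 dotC dot0l /Dphi wQ.
  have -> : behead_rV (delta_mx 0 0 : E) = 0.
    by apply/rowP => i; rewrite !mxE.
  rewrite deriveE// linear0 mxE/= sub0r => /eqP; rewrite oppr_eq0.
  by rewrite pnatr_eq0.
pose L : R := `|L0|.
have DL x w : `|Dphi x w - dot w v| <= L * enorm (x - y) * enorm w.
  rewrite -hv /Dphi opprB addrA subrK (le_trans (Lh _ _ _))//.
  have e1 : enorm (behead_rV (x *m Q) - behead_rV (y *m Q)) <= enorm (x - y).
    have -> : behead_rV (x *m Q) - behead_rV (y *m Q) = behead_rV ((x - y) *m Q).
      by rewrite mulmxBl; apply/rowP => i; rewrite !mxE.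
    by rewrite (le_trans (enorm_behead _))// enorm_orthogonal.
  have e2 : enorm (behead_rV (w *m Q)) <= enorm w.
    by rewrite (le_trans (enorm_behead _))// enorm_orthogonal.
  rewrite -2!mulrA (le_trans (ler_wpM2r _ (ler_norm L0))) ?mulr_ge0 ?enorm_ge0//.
  by rewrite ler_wpM2l ?normr_ge0// ler_pM ?enorm_ge0.
have Taylor x w : `|phi (x + w) - phi x - dot w v| <= L * (enorm (x - y) + enorm w) * enorm w.
  have [t t01 et] := line_mvt (behead_rV (x *m Q)) (behead_rV (w *m Q)) dh.
  have -> : phi (x + w) - phi x = Dphi (x + t *: w) w.
    rewrite /Dphi mulmxDl behead_rVD -scalemxAl behead_rVZ -et /phi.
    by rewrite mulmxDl behead_rVD !mxE; ring.
  rewrite (le_trans (DL _ _))// ler_wpM2r ?enorm_ge0// ler_wpM2l ?normr_ge0//.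
  rewrite addrAC (le_trans (enormD _ _))// lerD2l enormZ.
  by move/andP : t01 => [t0 t1]; rewrite ger0_norm// ler_piMl ?enorm_ge0.
have hO' x : enorm (x - y) < r -> (Omega x <-> phi x < 0).
  by move=> /hO ->; rewrite /phi subr_lt0.
exists r, L, phi, v; split => //; first by split=> //; exact: normr_ge0.
have [cy niy] := by_.
apply/eqP; rewrite eq_le; apply/andP; split; last first.
  rewrite leNgt; apply/negP => py; apply: niy.
  have : Omega y by apply/hO' => //; rewrite subrr enorm0.
  by rewrite ((@interior_id _ Omega).1 oO).
rewrite leNgt; apply/negP => py.
(* If [phi y] were positive, Taylor's formula would keep [phi] positive within distance [phi y / K]
   of [y], where there are points of Omega. *)
pose K := enorm v + L + 1.
have K0 : 0 < K by rewrite /K; have := enorm_ge0 v; have : 0 <= L := normr_ge0 _; lra.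
pose e := Num.min 1 (Num.min r (phi y / K)).
have e0 : 0 < e by rewrite !lt_min ltr01 r0 divr_gt0.
have [x Ox xy] := (closure_enormP _ _).1 cy e e0.
have [x1 xr xK] : [/\ enorm (x - y) < 1, enorm (x - y) < r & enorm (x - y) * K < phi y].
  move: xy; rewrite !lt_min => /and3P[? ?]; rewrite ltr_pdivlMr//.
have := Taylor y (x - y); rewrite (_ : y + (x - y) = x) ?subrr ?enorm0 ?add0r; last by rewrite addrC subrK.
have := (hO' _ xr).1 Ox; have := dot_le_enorm (- (x - y)) v.
rewrite dotNl enormN ler_norml => h1 h2 /andP[h3 _].
have := enorm_ge0 (x - y); have := enorm_ge0 v; have : 0 <= L := normr_ge0 _.
set q := enorm (x - y) in h1 h3 x1 xr xK *; set k := enorm v in h1 K0 xK *.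
move=> L0' k0 q0.
have : L * q * q <= L * q by rewrite ler_piMr// ?mulr_ge0// ltW.
by move: xK; rewrite /K -/k; nra.
Qed.

Lemma closure_bounded Omega : bounded_set Omega -> bounded_set (closure Omega).
Proof.
move=> [M [Mr hM]]; exists (M + 1); split; first exact: num_real.
move=> m Mm x cx /=; rewrite leNgt; apply/negP => mx.
have e0 : 0 < `|x| - m by rewrite subr_gt0.
have [y /(hM (M + 1) _) yM yx] := (closure_enormP _ _).1 cx _ e0.
have {}yM : `|y| <= M + 1 := yM (ltac:(lra)).
have : `|x| <= `|y| + `|y - x| by rewrite -{1}(subKr y x) ler_normB.
have := norm_le_enorm (y - x); lra.
Qed.

Lemma compact_boundary Omega : bounded_set Omega -> compact (boundary Omega).
Proof.
move=> bO; apply: bounded_closed_compact.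
  have [M [Mr hM]] := closure_bounded bO.
  by exists M; split => // m Mm x [cx _]; exact: hM Mm _ cx.
rewrite /boundary setDE; apply: closedI; first exact: closed_closure.
exact/open_closedC/open_interior.
Qed.

(* [n] is the outward normal at [y]: the inequality says that the ball of radius
   [r / 2] centred at [y + (r / 2) n] misses Omega. *)
Lemma boundary_normal Omega (r : R) y : open Omega -> bounded_set Omega ->
  C11_boundary Omega -> 0 < r -> reach (boundary Omega) = r%:E ->
  boundary Omega y ->
  exists n, [/\ enorm n = 1,
    forall x, Omega x -> r * dot (x - y) n <= enorm (x - y) ^+ 2 &
    forall e, dot e n < 0 -> exists t0 tau : R, [/\ 0 < t0, 0 < tau &
      forall z t, Omega z -> enorm (z - y) < tau -> 0 <= t -> t <= t0 ->
        Omega (z + t *: e)]].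
Proof.
move=> oO bO hC r0 rO by_.
have [rho [L [phi [v [rho0 [L0 v0] phiy hO Taylor]]]]] := C11_boundary_defining hC oO by_.
have V0 := enorm_gt0 v0.
pose n := (enorm v)^-1 *: v.
have n1 : enorm n = 1 by rewrite enormZ gtr0_norm ?invr_gt0// mulVf// gt_eqF.
have vE : v = enorm v *: n by rewrite scalerA divff ?gt_eqF// scale1r.
have nOy : ~ Omega y.
  by move=> /hO; rewrite subrr enorm0 => /(_ rho0); rewrite phiy ltxx.
have {}Taylor x w : `|phi (x + w) - phi x - enorm v * dot w n| <=
    L * (enorm (x - y) + enorm w) * enorm w.
  by rewrite -dotZr -vE.
clear vE; move: n n1 Taylor => n n1 Taylor; set V := enorm v in V0 Taylor.
exists n; split => //.
(* Radius of a first, small exterior ball: [r / 4] leaves room to extend it to [r / 2], [rho / 4]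
   keeps the relevant points in the chart, and the last term lets the slope [V] dominate the
   quadratic remainder. *)
- pose s0 := Num.min (r / 4) (Num.min (rho / 4) (V / (2 * L + 1) / 2)).
  have LL : 0 < 2 * L + 1 by lra.
  have s00 : 0 < s0 by rewrite !lt_min !divr_gt0.
  have [s0r s0rho s0L] : [/\ s0 <= r / 4, s0 <= rho / 4 & 2 * s0 * (2 * L + 1) <= V].
    split; rewrite ?ge_min ?lexx ?orbT//.
    have : s0 <= V / (2 * L + 1) / 2 by rewrite !ge_min lexx !orbT.
    by rewrite ler_pdivlMr// ler_pdivlMr//; lra.
  have s0L' : s0 * L <= V / 4 by nra.
  have nOz0 : ~ Omega (y + s0 *: n).
    have e1 : enorm (s0 *: n) = s0 by rewrite enormZ n1 mulr1 gtr0_norm.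
    move=> /hO; rewrite addrC addKr e1 => /(_ (ltac:(lra))).
    have := Taylor y (s0 *: n); rewrite subrr enorm0 add0r e1 dotZl -sqr_enorm n1.
    rewrite expr1n mulr1 phiy subr0 addrC ler_norml => /andP[h _] h2.
    have : L * s0 * s0 <= V / 4 * s0 by rewrite ler_pM2r// mulrC.
    by have : 0 < V * s0 := mulr_gt0 V0 s00; move: h h2; lra.
  have ball0 b : Omega b -> s0 <= enorm (y + s0 *: n - b).
    move=> Ob; have [b2|b2] := leP (2 * s0) (enorm (b - y)).
      have := enorm_sub_triangle b (y + s0 *: n) y.
      rewrite [X in _ + enorm X]addrC addKr enormZ n1 mulr1 gtr0_norm//.
      by rewrite (enormB b (y + _)); lra.
    have brho : enorm (b - y) < rho by lra.
    have := (hO _ brho).1 Ob.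
    have := Taylor y (b - y); rewrite (_ : y + (b - y) = b) ?subrr ?enorm0 ?add0r ?phiy ?subr0; last by rewrite addrC subrK.
    rewrite ler_norml => /andP[h _] hb.
    have {h} h : V * dot (b - y) n <= L * enorm (b - y) ^+ 2 by rewrite expr2 mulrA; lra.
    rewrite -(@ler_pXn2r _ 2)// ?nnegrE ?enorm_ge0 ?(ltW s00)//.
    rewrite enormB (_ : b - _ = (b - y) + (- s0) *: n); last first.
      by apply/rowP => i; rewrite !mxE; ring.
    rewrite sqr_enormDZ n1.
    have : 2 * s0 * (V * dot (b - y) n) <= 2 * s0 * (L * enorm (b - y) ^+ 2).
      by rewrite ler_wpM2l//; lra.
    have : 2 * (s0 * L) * enorm (b - y) ^+ 2 <= 2 * (V / 4) * enorm (b - y) ^+ 2.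
      by rewrite ler_wpM2r ?sqr_ge0//; lra.
    have q0 := sqr_ge0 (enorm (b - y)) => h1 h2.
    have : V * (2 * s0 * dot (b - y) n) <= V * enorm (b - y) ^+ 2 by nra.
    by rewrite ler_pM2l//; nra.
  have ballb b : boundary Omega b -> s0 <= enorm (y + s0 *: n - b).
    move=> [cb _]; rewrite leNgt; apply/negP => hb.
    have e0 : 0 < s0 - enorm (y + s0 *: n - b) by rewrite subr_gt0.
    have [u /ball0 Ou ub] := (closure_enormP _ _).1 cb _ e0.
    by have := enorm_sub_triangle (y + s0 *: n) b u; rewrite (enormB b u); lra.
  have ball1 := exterior_ball_extend (compact_boundary bO)
    (reach_unique_nearest rO (ltac:(lra) : r / 4 * 3 < r)) by_ n1 s00
    (ltac:(lra) : s0 <= r / 2) (ltac:(lra)) ballb.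
  (* Were the inequality false, [x] would lie in the open ball of radius [r / 2] together with
     [y + s0 *: n], which is not in Omega; the segment between them would meet the boundary inside
     this ball. *)
  move=> x Ox; rewrite leNgt; apply/negP => hx.
  have xr : enorm (x - (y + (r / 2) *: n)) < r / 2.
    rewrite -(@ltr_pXn2r _ 2)// ?nnegrE ?enorm_ge0 ?divr_ge0 ?(ltW r0)//.
    rewrite (_ : x - _ = (x - y) + (- (r / 2)) *: n); last first.
      by apply/rowP => i; rewrite !mxE; ring.
    by rewrite sqr_enormDZ n1; lra.
  have zr : enorm (y + s0 *: n - (y + (r / 2) *: n)) < r / 2.
    rewrite opprD addrACA subrr add0r -scalerBl enormZ n1 mulr1.
    by rewrite ltr0_norm; lra.
  have [b bb] := ball_meets_boundary oO Ox nOz0 xr zr.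
  by have := ball1 b bb; rewrite enormB; lra.
(* Along [e] the function [phi] decreases at rate [V * k]; [m] is small enough for the remainder in
   Taylor's formula not to undo this. *)
- move=> e en; pose k := - dot e n; have k0 : 0 < k by rewrite oppr_gt0.
  have ee := enorm_ge0 e.
  pose K := 2 * L * (enorm e + 1).
  have K0 : 0 <= K by rewrite !mulr_ge0// addr_ge0.
  pose m := Num.min (rho / 2) (V * k / (K + 1)).
  have m0 : 0 < m by rewrite lt_min !divr_gt0 ?mulr_gt0//; lra.
  have [mrho mK] : m <= rho / 2 /\ m * (K + 1) <= V * k.
    split; rewrite ?ge_min ?lexx// -ler_pdivlMr; last lra.
    by rewrite ge_min lexx orbT.
  have e1 : 0 < enorm e + 1 by lra.
  exists (m / (enorm e + 1)), m; split => //; first by rewrite divr_gt0.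
  move=> z t Oz zy t0; rewrite ler_pdivlMr// => tm.
  have te : t * enorm e <= m by lra.
  have ete : enorm (t *: e) = t * enorm e by rewrite enormZ ger0_norm.
  have zrho : enorm (z - y) < rho by lra.
  have phiz := (hO _ zrho).1 Oz.
  apply/hO.
    by have := enormD (z - y) (t *: e); rewrite ete addrAC; lra.
  have := Taylor z (t *: e); rewrite ete dotZl ler_norml => /andP[_].
  have : L * (enorm (z - y) + t * enorm e) * (t * enorm e) <=
         L * (2 * m) * (t * enorm e).
    by rewrite ler_wpM2r ?mulr_ge0// ler_wpM2l//; lra.
  have : t * (m * K) <= t * (V * k) by rewrite ler_wpM2l//; nra.
  have : 0 <= L * (2 * m) * t by rewrite !mulr_ge0// ltW.
  by rewrite /K /k; lra.
Qed.

End C11_geometry.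

(** * Chain distance and its sup-convolution *)

Section integral_monotone.
Local Open Scope ereal_scope.
Context d (T : measurableType d) (R : realType) (mu : {measure set T -> \bar R}).

(** The integral of a nonnegative function is a supremum over the simple functions below it. This
    serves for path lengths, where the weight along the path may be any nonnegative function. *)
Lemma ge0_le_integral_nomeas (D : set T) (f g : T -> \bar R) :
  (forall x, D x -> 0 <= f x) -> (forall x, D x -> f x <= g x) ->
  \int[mu]_(x in D) f x <= \int[mu]_(x in D) g x.
Proof.
move=> f0 fg; rewrite !ge0_integralE//; last first.
  by move=> x Dx; exact: le_trans (f0 _ Dx) (fg _ Dx).
apply: le_ereal_sup => _ [h hf <-]; exists h => // x.
apply: (le_trans (hf x)); rewrite /patch; case: ifPn => // /set_mem; exact: fg.
Qed.

End integral_monotone.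

(** * C^{1,1} curves *)

Section C11_curve.
Context {R : realType}.
Implicit Types (V : normedModType R).

(** A quantitative Taylor estimate, stable under sums and affine changes of time, so that gluing
    curves is algebra. It holds on all of R, which makes the endpoint conditions of [C1_path]
    automatic. *)
Definition C11_curve V (gam dgam : R -> V) := exists K : R,
  (forall t h, `|gam (t + h) - gam t - h *: dgam t| <= K * h ^+ 2) /\
  (forall s t, `|dgam s - dgam t| <= K * `|s - t|).

Lemma C11_curve_is_derive V (gam dgam : R -> V) (t : R) : C11_curve gam dgam ->
  is_derive t 1 gam (dgam t).
Proof.
move=> [K [h1 _]].
have cv : (fun h : R => h^-1 *: (gam (h *: 1 + t) - gam t)) @ 0^' --> dgam t.
  apply/cvgrPdist_le => e e0; near=> h.
  have hn0 : h != 0 by near: h; exact: nbhs_dnbhs_neq.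
  have := h1 t h; rewrite [t + h]addrC -[X in gam (X + t)](mulr1 h) => hK.

  rewrite distrC (_ : _ - dgam t = h^-1 *: (gam (h *: 1 + t) - gam t - h *: dgam t)).
    2: by rewrite [RHS]scalerBr scalerA mulVf// scale1r.
  rewrite normrZ normfV ler_pdivrMl ?normr_gt0//.
  apply: (le_trans hK); rewrite -real_normK ?num_real// expr2 mulrCA ler_wpM2l//.
  have he : `|h| <= e / (`|K| + 1).
    by near: h; apply: dnbhs0_le; rewrite divr_gt0// ltr_wpDl.
  rewrite ler_pdivlMr ?ltr_wpDl// in he.
  apply: le_trans he; rewrite mulrC ler_wpM2l// (le_trans (ler_norm _))//.
  by rewrite lerDl.
by split; [apply/cvg_ex; exists (dgam t) | exact/cvg_lim].
Unshelve. all: by end_near. Qed.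

Lemma lip_continuous V (f : R -> V) (K : R) :
  (forall s t, `|f s - f t| <= K * `|s - t|) -> continuous f.
Proof.
move=> Kf s; apply/cvgrPdist_lt => e e0; near=> t.
rewrite (le_lt_trans (Kf _ _))//.
have st : `|s - t| < e / (`|K| + 1).
  by near: t; apply: cvgr_dist_lt => //; rewrite divr_gt0// ltr_wpDl.
rewrite ltr_pdivlMr ?ltr_wpDl// in st.
apply: le_lt_trans st; rewrite mulrC ler_wpM2l// (le_trans (ler_norm _))//.
by rewrite lerDl.
Unshelve. all: by end_near. Qed.

Lemma C11_curve_continuous V (gam dgam : R -> V) : C11_curve gam dgam ->
  continuous gam.
Proof.
move=> cg t; apply: differentiable_continuous; apply/derivable1_diffP.
exact: (@ex_derive _ _ _ _ _ _ _ (C11_curve_is_derive t cg)).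
Qed.

Lemma C11_curve_derive_continuous V (gam dgam : R -> V) : C11_curve gam dgam ->
  continuous dgam.
Proof. by move=> [K [_ h]]; exact: lip_continuous h. Qed.

Lemma C11_curve_derive1 V (gam dgam : R -> V) : C11_curve gam dgam ->
  derive1 gam = dgam.
Proof.
move=> cg; apply/funext => t; rewrite derive1E.
exact: (@derive_val _ _ _ _ _ _ _ (C11_curve_is_derive t cg)).
Qed.

Lemma C11_curve_cst V (v : V) : C11_curve (fun=> v) (fun=> 0).
Proof.
by exists 0; split => *; rewrite ?scaler0 ?subr0 ?subrr normr0 mul0r.
Qed.

Lemma C11_curveD V (f df g dg : R -> V) : C11_curve f df -> C11_curve g dg ->
  C11_curve (fun t => f t + g t) (fun t => df t + dg t).
Proof.
move=> [K [f1 f2]] [L [g1 g2]]; exists (K + L); split => [t h|s t].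
  rewrite scalerDr mulrDl (_ : _ - _ - _ =
    (f (t + h) - f t - h *: df t) + (g (t + h) - g t - h *: dg t)).
    by rewrite (le_trans (ler_normD _ _))// lerD.
  by rewrite !opprD [RHS]addrACA; congr (_ + _); exact: addrACA.
rewrite opprD addrACA mulrDl (le_trans (ler_normD _ _))// lerD//.
Qed.

Lemma C11_curve_affine V (f df : R -> V) (k c : R) : C11_curve f df ->
  C11_curve (fun t => f (k * t + c)) (fun t => k *: df (k * t + c)).
Proof.
move=> [K [f1 f2]]; exists (K * k ^+ 2); split => [t h|s t].
  have := f1 (k * t + c) (k * h).
  rewrite exprMn mulrA scalerA [h * k]mulrC; congr (`|f _ - _ - _| <= _); ring.
rewrite -scalerBr normrZ -(real_normK (num_real k)) expr2 mulrCA -mulrA.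
apply: ler_wpM2l => //; rewrite (le_trans (f2 _ _))//.
by rewrite opprD addrACA subrr addr0 -mulrBr normrM mulrA.
Qed.

Lemma C11_curveZ V (f df : R -> R) (v : V) : C11_curve f df ->
  C11_curve (fun t => f t *: v) (fun t => df t *: v).
Proof.
move=> [K [f1 f2]]; exists (K * `|v|); split => [t h|s t].
  by rewrite scalerA -!scalerBl normrZ mulrAC ler_wpM2r.
by rewrite -scalerBl normrZ mulrAC ler_wpM2r.
Qed.

Definition sqr_pos (t : R) := Num.max t 0 ^+ 2.

Lemma C11_curve_sqr_pos : C11_curve sqr_pos (fun t => 2 * Num.max t 0).
Proof.
have m (t : R) : (0 <= t /\ Num.max t 0 = t) \/ (t <= 0 /\ Num.max t 0 = 0).
  by rewrite /Num.max; case: ltP; [right; split => //; exact: ltW|left].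
exists 2; split => [t h|s t].
  have -> : h *: (2 * Num.max t 0) = h * (2 * Num.max t 0) by [].
  rewrite /sqr_pos ler_norml.
  by case: (m t) => -[t0 ->]; case: (m (t + h)) => -[th0 ->]; apply/andP; split; nra.
rewrite -mulrBr normrM ger0_norm// ler_pM2l// ler_norml.
have s1 := ler_norm (s - t); have s2 := lerNnormlW (lexx `|s - t|).
by case: (m t) => -[t0 ->]; case: (m s) => -[s0 ->]; apply/andP; split; lra.
Qed.

(* A C^{1,1} interpolation between 0 (for t <= 0) and 1 (for t >= 1). *)
Definition smoothstep (t : R) : R :=
  2 * sqr_pos t - 4 * sqr_pos (t - 2^-1) + 2 * sqr_pos (t - 1).

Definition dsmoothstep (t : R) : R :=
  4 * Num.max t 0 - 8 * Num.max (t - 2^-1) 0 + 4 * Num.max (t - 1) 0.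

Lemma C11_curve_smoothstep : C11_curve smoothstep dsmoothstep.
Proof.
have c0 := C11_curve_sqr_pos.
have c (k a : R) := C11_curveZ k (C11_curve_affine 1 a c0).
have h := C11_curveD (C11_curveD (c 2 0) (c (-4) (- 2^-1))) (c 2 (-1)).
congr C11_curve: h; apply/funext => t.
  by rewrite /smoothstep mul1r addr0 /GRing.scale/=; ring.
by rewrite /dsmoothstep mul1r addr0 /GRing.scale/=; ring.
Qed.

End C11_curve.

Section chain_distance.
Context {R : realType} {d : nat}.
Local Notation E := 'rV[R]_d.
Variables (Omega Gamma : set E) (g : E -> R).
Implicit Types (x y : E) (c M : R).

(* Polygonal paths in Omega from x to Gamma; c bounds the g-length. *)
Inductive chain : E -> R -> Prop :=
| chain_base x : Gamma x -> chain x 0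
| chain_step x y M c : chain y c ->
    (forall t, 0 <= t <= 1 -> Omega (x + t *: (y - x)) /\ g (x + t *: (y - x)) <= M) ->
    chain x (M * enorm (y - x) + c).

Lemma smoothstep_le0 (t : R) : t <= 0 -> smoothstep t = 0 /\ dsmoothstep t = 0.
Proof.
move=> t0; rewrite /smoothstep /dsmoothstep /sqr_pos !max_r; lra.
Qed.

Lemma smoothstep_ge1 (t : R) : 1 <= t -> smoothstep t = 1 /\ dsmoothstep t = 0.
Proof.
move=> t0; rewrite /smoothstep /dsmoothstep /sqr_pos !max_l; lra.
Qed.

Lemma smoothstep_itv (t : R) : 0 <= t <= 1 -> 0 <= smoothstep t <= 1 /\ 0 <= dsmoothstep t.
Proof.
move=> /andP[t0 t1]; rewrite /smoothstep /dsmoothstep /sqr_pos.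
rewrite (max_l t0) (max_r (ltac:(lra) : t - 1 <= 0)).
have [h|h] := leP t 2^-1.
  by rewrite max_r; [split; [apply/andP; split|]; nra|lra].
by rewrite max_l; [split; [apply/andP; split|]; nra|lra].
Qed.

(** Each edge is run in unit time with a speed that vanishes at both ends, so that the curve is
    C^{1,1} through the corners. [N] is a C^{1,1} majorant of the length run so far: its derivative
    dominates the length integrand and, unlike it, can be integrated by the fundamental theorem of
    calculus. *)
Lemma chain_curve x c : Gamma `<=` Omega -> (forall y, Omega y -> 0 <= g y) ->
  chain x c ->
  exists (k : nat) (gam dgam : R -> E) (N dN : R -> R),
  [/\ C11_curve gam dgam, C11_curve N dN,
      forall t, t <= 0 -> [/\ gam t = x, dgam t = 0, N t = 0 & dN t = 0],
      Gamma (gam k%:R) /\ N k%:R = c &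
      forall t, 0 <= t <= k%:R ->
        Omega (gam t) /\ g (gam t) * enorm (dgam t) <= dN t].
Proof.
move=> GO g0; elim=> [{}x Gx|{}x y M {}c _ [k [gam [dgam [N [dN [cg cN h0 [Gk Nk] hk]]]]]] hs].
  exists 0%N, (fun=> x), (fun=> 0), (fun=> 0), (fun=> 0); split => //.
  - exact: C11_curve_cst.
  - exact: C11_curve_cst.
  - by move=> t _; split; [exact: GO|rewrite enorm0 mulr0].
have shift (V : normedModType R) (f df : R -> V) : C11_curve f df ->
    C11_curve (fun t => f (t - 1)) (fun t => df (t - 1)).
  move=> /(C11_curve_affine 1 (-1)) h.
  by congr C11_curve: h; apply/funext => t; rewrite ?scale1r mul1r.
exists k.+1.
(* Concatenation is a sum: the delayed tail rests at its start [y] while the first edge is run, and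
   [smoothstep] rests at 1 afterwards. *)
exists (fun t => x + smoothstep t *: (y - x) + (gam (t - 1) - y)).
exists (fun t => dsmoothstep t *: (y - x) + dgam (t - 1)).
exists (fun t => M * enorm (y - x) * smoothstep t + N (t - 1)).
exists (fun t => M * enorm (y - x) * dsmoothstep t + dN (t - 1)).
split.
- have h1 := C11_curveZ (y - x) (@C11_curve_smoothstep R).
  have h2 := C11_curveD (C11_curveD (C11_curve_cst x) h1)
               (C11_curveD (shift _ _ _ cg) (C11_curve_cst (- y))).
  by congr C11_curve: h2; apply/funext => t; rewrite add0r addr0.
- have h1 := C11_curveZ (M * enorm (y - x)) (@C11_curve_smoothstep R).
  have h2 := C11_curveD h1 (shift _ _ _ cN).
  by congr C11_curve: h2; apply/funext => t; rewrite [_ *: _]mulrC.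
- move=> t t0; have [-> ->] := smoothstep_le0 t0.
  have [|-> -> -> ->] := h0 (t - 1); first by lra.
  by rewrite !scale0r !mulr0 !addr0 subrr addr0.
- have k1 : k.+1%:R - 1 = k%:R :> R by rewrite -natr1 addrK.
  have [|-> _] := @smoothstep_ge1 k.+1%:R; first by rewrite ler1n.
  by rewrite k1 scale1r mulr1 [x + _]addrC subrK [y + _]addrC subrK Nk.
move=> t /andP[t0 tk]; have [t1|t1] := leP t 1.
  have [|-> -> _ ->] := h0 (t - 1); first by lra.
  have t01 : 0 <= t <= 1 by rewrite t0.
  have [S01 dS0] := smoothstep_itv t01.
  rewrite subrr !addr0; have [Ox gM] := hs _ S01; split => //.
  rewrite enormZ (ger0_norm dS0) mulrA mulrAC ler_wpM2r// ler_wpM2r ?enorm_ge0//.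
have [-> ->] := smoothstep_ge1 (ltW t1).
rewrite scale1r [x + _]addrC subrK [y + _]addrC subrK scale0r mulr0 !add0r.
apply: hk; move: tk; rewrite -natr1; lra.
Qed.

Lemma chain_geodist x c : Gamma `<=` Omega -> (forall y, Omega y -> 0 <= g y) ->
  chain x c -> (geodist_set Omega g x Gamma <= c%:E)%E.
Proof.
move=> GO g0 /(chain_curve GO g0)[k [gam [dgam [N [dN [cg cN h0 [Gk Nk] hk]]]]]].
have ck (V : normedModType R) (f df : R -> V) : C11_curve f df ->
    C11_curve (fun t => f (k%:R * t)) (fun t => k%:R *: df (k%:R * t)).
  move=> /(C11_curve_affine k%:R 0) h.
  by congr C11_curve: h; apply/funext => t; rewrite addr0.
have {}cg := ck _ _ _ cg; have {}cN := ck _ _ _ cN.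
set gam1 := fun t => gam (k%:R * t) in cg.
have kt t : t \in `[0, 1] -> 0 <= k%:R * t <= k%:R.
  by rewrite in_itv/= => /andP[t0 t1]; rewrite mulr_ge0//= ler_piMr.
have Nx : (path_length g gam1 <= c%:E)%E.
  have FTC : (\int[@lebesgue_measure R]_(t in `[0%R, 1%R])
      (k%:R *: dN (k%:R * t))%:E = (N (k%:R * 1))%:E - (N (k%:R * 0))%:E)%E.
    apply: (@continuous_FTC2 _ _ (fun t => N (k%:R * t))) => //.
    - exact/continuous_subspaceT/(C11_curve_derive_continuous cN).
    - have cN' := C11_curve_continuous cN.
      split; [|exact/cvg_at_right_filter/cN'|exact/cvg_at_left_filter/cN'].
      move=> t _; exact: (@ex_derive _ _ _ _ _ _ _ (C11_curve_is_derive t cN)).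
    - by move=> t _; rewrite (C11_curve_derive1 cN).
  have [_ _ N0 _] := h0 0 (lexx 0).
  rewrite mulr1 mulr0 Nk N0 sube0 in FTC; rewrite -FTC.
  apply: ge0_le_integral_nomeas => t /= /kt/hk[Ot gN].
    by rewrite lee_fin mulr_ge0 ?enorm_ge0// g0.
  rewrite lee_fin (C11_curve_derive1 cg) enormZ ger0_norm// mulrCA.
  by rewrite [_ *: _]/(_ * _) ler_wpM2l.
apply: le_trans Nx; apply: (@le_trans _ _ (geodist Omega g x (gam k%:R))).
  by apply: ereal_inf_lbound; exists (gam k%:R).
apply: ereal_inf_lbound; exists gam1 => //; split.
- have cd := C11_curve_derive_continuous cg.
  split.
  + exact/continuous_subspaceT/(C11_curve_continuous cg).
  + move=> t _; exact: (@ex_derive _ _ _ _ _ _ _ (C11_curve_is_derive t cg)).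
  + by move=> t _; rewrite (C11_curve_derive1 cg); exact: cd.
  + rewrite (C11_curve_derive1 cg); apply/cvg_ex; eexists; apply/cvg_at_right_filter; exact: cd.
  + rewrite (C11_curve_derive1 cg); apply/cvg_ex; eexists; apply/cvg_at_left_filter; exact: cd.
- by move=> t /kt/hk[Ot _]; exact: subset_closure.
- by rewrite /gam1 mulr0; have [-> _ _ _] := h0 0 (lexx 0).
- by rewrite /gam1 mulr1.
Qed.

Lemma chain_ge0 x c : (forall y, Omega y -> 0 <= g y) -> chain x c -> 0 <= c.
Proof.
move=> g0; elim=> // {}x y M {}c _ c0 hs.
have [|Ox gM] := hs 0; first by rewrite lexx ler01.
by rewrite addr_ge0// mulr_ge0 ?enorm_ge0// (le_trans (g0 _ Ox)).
Qed.

(** The cap [K] makes the function bounded and keeps the set nonempty at points that no chain joins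
    to Gamma. It is harmless as soon as [K] is above the geodesic distance. *)
Definition chain_dist (K : R) x : R := inf ([set c | chain x c] `|` [set K]).

Let has_lb K x : (forall y, Omega y -> 0 <= g y) -> 0 <= K ->
  has_lbound ([set c | chain x c] `|` [set K]).
Proof. by move=> g0 K0; exists 0 => c [/(chain_ge0 g0)|->]. Qed.

Lemma chain_dist_ge0 K x : (forall y, Omega y -> 0 <= g y) -> 0 <= K ->
  0 <= chain_dist K x.
Proof.
move=> g0 K0; apply: lb_le_inf; first by exists K; right.
by move=> c [/(chain_ge0 g0)|->].
Qed.

Lemma chain_dist_le K x : (forall y, Omega y -> 0 <= g y) -> 0 <= K ->
  chain_dist K x <= K.
Proof. by move=> g0 K0; apply: ge_inf; [exact: has_lb | right]. Qed.

Lemma chain_dist0 K x : (forall y, Omega y -> 0 <= g y) -> 0 <= K ->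
  Gamma x -> chain_dist K x <= 0.
Proof.
by move=> g0 K0 Gx; apply: ge_inf; [exact: has_lb | left; exact: chain_base].
Qed.

Lemma chain_dist_step K x y M : (forall y, Omega y -> 0 <= g y) -> 0 <= K ->
  (forall t, 0 <= t <= 1 -> Omega (x + t *: (y - x)) /\ g (x + t *: (y - x)) <= M) ->
  chain_dist K x <= M * enorm (y - x) + chain_dist K y.
Proof.
move=> g0 K0 hs; rewrite -lerBlDl; apply: lb_le_inf; first by exists K; right.
have M0 : 0 <= M.
  have [|Ox gM] := hs 0; first by rewrite lexx ler01.
  exact: le_trans (g0 _ Ox) gM.
move=> c [hc|->]; rewrite lerBlDl.
  by apply: ge_inf; [exact: has_lb | left; exact: chain_step].
by rewrite (le_trans (chain_dist_le _ g0 K0))// lerDr mulr_ge0 ?enorm_ge0.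
Qed.

Lemma geodist_chain_dist K x : Gamma `<=` Omega -> (forall y, Omega y -> 0 <= g y) ->
  (geodist_set Omega g x Gamma <= K%:E)%E ->
  (geodist_set Omega g x Gamma <= (chain_dist K x)%:E)%E.
Proof.
move=> GO g0 hK; rewrite /chain_dist -ereal_inf_EFin; last 2 first.
- have [K0|K0] := leP 0 K; first exact: has_lb.
  by exists K => c [/(chain_ge0 g0)|->]//; apply: le_trans; exact: ltW.
- by exists K; right.
apply: le_ereal_inf_tmp => _ [c [hc|->] <-]//.
exact: chain_geodist.
Qed.

End chain_distance.

(** * Semiconvexity and slopes of the sup-convolution *)

Section sup_convolution.
Context {R : realType} {d : nat}.
Local Notation E := 'rV[R]_d.
Variables (Omega : set E) (g D : E -> R) (K r delta : R).
Implicit Types (x y z w : E).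
Hypotheses (oO : open Omega) (bO : compact (closure Omega)) (r0 : 0 < r).
Hypotheses (D0 : forall x, Omega x -> 0 <= D x) (DK : forall x, Omega x -> D x <= K).
Hypothesis Dstep : forall x y M,
  (forall t, 0 <= t <= 1 -> Omega (x + t *: (y - x)) /\ g (x + t *: (y - x)) <= M) ->
  D x <= M * enorm (y - x) + D y.
Hypothesis normal : forall y, boundary Omega y ->
  exists n, [/\ enorm n = 1,
    forall x, Omega x -> r * dot (x - y) n <= enorm (x - y) ^+ 2 &
    forall e, dot e n < 0 -> exists t0 tau : R, [/\ 0 < t0, 0 < tau &
      forall z t, Omega z -> enorm (z - y) < tau -> 0 <= t -> t <= t0 ->
        Omega (z + t *: e)]].
Hypothesis delta0 : 0 < delta.

Definition penalized x y : R := D y - enorm (x - y) ^+ 2 / (2 * delta).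

Definition sup_conv x : R := sup [set penalized x y | y in Omega].

Lemma penalized_le x y : Omega y -> penalized x y <= K.
Proof.
move=> Oy; rewrite lerBlDr (le_trans (DK Oy))// lerDl divr_ge0 ?sqr_ge0//.
by rewrite mulr_ge0// ltW.
Qed.

Lemma le_sup_conv x y : Omega y -> penalized x y <= sup_conv x.
Proof.
move=> Oy; apply: sup_upper_bound; last by exists y.
by split; [exists (penalized x y), y | exists K => _ [z Oz <-]; exact: penalized_le].
Qed.

Lemma sup_conv_ge x : Omega x -> D x <= sup_conv x.
Proof.
move=> /(le_sup_conv x); apply: le_trans.
by rewrite /penalized subrr enorm0 expr0n mul0r subr0.
Qed.

Lemma sup_conv_le x s : Omega !=set0 -> (forall y, Omega y -> penalized x y <= s) ->
  sup_conv x <= s.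
Proof.
by move=> [y Oy] h; apply: sup_le_ub; [exists (penalized x y), y | move=> _ [z /h ? <-]].
Qed.

(** The supremum over the open set Omega need not be attained; [y] is a cluster point, in the
    compact closure, of a maximising sequence. *)
Lemma maximizing_cluster x : Omega !=set0 -> exists2 y, closure Omega y &
  forall e tau : R, 0 < e -> 0 < tau ->
    exists y', [/\ Omega y', enorm (y' - y) < tau & sup_conv x - e < penalized x y'].
Proof.
move=> [u Ou].
have hs : has_sup [set penalized x y | y in Omega].
  by split; [exists (penalized x u), u | exists K => _ [z Oz <-]; exact: penalized_le].
have /choice[y_ hy] (k : nat) : exists y', Omega y' /\
    sup_conv x - k.+1%:R^-1 < penalized x y'.
  have [|_ [y Oy <-] hy] := @sup_adherent _ _ k.+1%:R^-1 _ hs; first by rewrite invr_gt0.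
  by exists y.
have FO : (y_ @ \oo) (closure Omega).
  by exists 0%N => // k _; exact/subset_closure/(hy k).1.
have [y [cy cly]] := bO _ FO; exists y => // e tau e0 tau0.
have [||] := cly [set z | Omega z /\ sup_conv x - e < penalized x z]
    [set z | enorm (z - y) < tau].
- have [N _ hN] := near_infty_natSinv_lt (PosNum e0).
  exists N => // k /hN/= ke; split; first exact: (hy k).1.
  by apply: lt_trans (hy k).2; rewrite ltrD2l ltrN2.
- by apply/nbhs_enormP; exists tau.
move=> y' [[Oy' hy'] /= yy'].
by exists y'.
Qed.

(** A near-maximiser [y'] is compared with [y' + t *: w]: [D] drops by at most [M * t * enorm w],
    while the penalty changes by a multiple of [dot (x - y') w] up to O(t^2). First [y'] tends to
    [y] at fixed [t] ([key]), then [t] tends to 0. *)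
Lemma inward_slope x y w M tau : Omega !=set0 -> 0 < tau ->
  (forall e tau : R, 0 < e -> 0 < tau ->
    exists y', [/\ Omega y', enorm (y' - y) < tau & sup_conv x - e < penalized x y']) ->
  (exists t0 tau : R, [/\ 0 < t0, 0 < tau & forall z t, Omega z ->
     enorm (z - y) < tau -> 0 <= t -> t <= t0 -> Omega (z + t *: w)]) ->
  (forall z, Omega z -> enorm (z - y) < tau -> g z <= M) ->
  dot (x - y) w <= delta * M * enorm w.
Proof.
move=> O0 tau0 hy [t0 [tau1 [t00 tau10 hw]]] gM.
have w0 := enorm_ge0 w; have w1 : 0 < enorm w + 1 by lra.
pose t1 := Num.min t0 (tau / 2 / (enorm w + 1)).
have t10 : 0 < t1 by rewrite lt_min t00 !divr_gt0.
have key t e : 0 < t -> t <= t1 -> 0 < e ->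
    2 * t * dot (x - y) w - t ^+ 2 * enorm w ^+ 2 <= 2 * delta * M * (t * enorm w) + e.
  move=> tp tt1 e0.
  have tt0 : t <= t0 by apply: (le_trans tt1); rewrite ge_min lexx.
  have tw : t * enorm w <= tau / 2.
    have : t * (enorm w + 1) <= tau / 2.
      by rewrite -ler_pdivlMr// (le_trans tt1)// ge_min lexx orbT.
    lra.
  pose tau2 := Num.min (Num.min tau1 (tau / 2)) (e / 4 / (t * enorm w + 1)).
  have tw0 : 0 <= t * enorm w by rewrite mulr_ge0// ltW.
  have tw1 : 0 < t * enorm w + 1 by lra.
  have tau20 : 0 < tau2 by rewrite !lt_min tau10 !divr_gt0.
  have e'0 : 0 < e / (4 * delta) by rewrite divr_gt0// mulr_gt0.
  have [y' [Oy' yy' hy']] := hy _ _ e'0 tau20.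
  have {yy'} [y1 y2 y3] : [/\ enorm (y' - y) < tau1, enorm (y' - y) < tau / 2 &
      enorm (y' - y) * (t * enorm w) < e / 4].
    move: yy'; rewrite !lt_min -andbA => /and3P[? ?].
    rewrite ltr_pdivlMr// => h; split => //; apply: le_lt_trans h.
    by have := enorm_ge0 (y' - y); lra.
  have seg s : 0 <= s -> s <= t -> Omega (y' + s *: w) /\ g (y' + s *: w) <= M.
    move=> s0 st; have Os : Omega (y' + s *: w) by apply: hw => //; exact: le_trans st tt0.
    split => //; apply: gM => //; rewrite addrAC.
    apply: le_lt_trans (enormD _ _) _; rewrite enormZ ger0_norm//.
    have : s * enorm w <= t * enorm w by rewrite ler_wpM2r.
    lra.
  have Dt : D y' <= M * (t * enorm w) + D (y' + t *: w).
    have := @Dstep y' (y' + t *: w) M; rewrite [_ - y']addrC addKr enormZ gtr0_norm//.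
    apply=> s /andP[s0 s1]; rewrite scalerA; apply: seg; first by rewrite mulr_ge0// ltW.
    by rewrite ler_piMl// ltW.
  have Ot : Omega (y' + t *: w) by have [] := seg t (ltW tp) (lexx t).
  have := le_lt_trans (le_sup_conv x Ot) (ltac:(move: hy'; rewrite ltrBlDr; exact) : sup_conv x < _).
  rewrite /penalized.
  rewrite (_ : x - (y' + t *: w) = (x - y') + (- t) *: w); last first.
    by rewrite opprD addrA scaleNr.
  rewrite sqr_enormDZ sqrrN => h1.
  have {h1} h2 : 2 * t * dot (x - y') w - t ^+ 2 * enorm w ^+ 2 <=
      2 * delta * (M * (t * enorm w)) + e / 2.
    have d2 : 0 < 2 * delta by rewrite mulr_gt0.
    set a := enorm (x - y') ^+ 2 in h1; set b := dot (x - y') w in h1 *.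
    set ww := enorm w ^+ 2 in h1 *.
    have {h1 Dt} : (2 * t * b - t ^+ 2 * ww) / (2 * delta) <= M * (t * enorm w) + e / (4 * delta).
      have -> : (2 * t * b - t ^+ 2 * ww) / (2 * delta) =
        a / (2 * delta) - (a + 2 * - t * b + t ^+ 2 * ww) / (2 * delta) by ring.
      lra.
    rewrite ler_pdivrMr// => h; apply: (le_trans h).
    by rewrite le_eqVlt; apply/orP; left; apply/eqP; field; rewrite gt_eqF.
  have -> : x - y = (x - y') + (y' - y) by rewrite addrA subrK.
  rewrite dotDl.
  have h3 := dot_le_enorm (y' - y) w.
  have : t * dot (y' - y) w <= t * (enorm (y' - y) * enorm w) by rewrite ler_pM2l.
  lra.
have key2 t : 0 < t -> t <= t1 ->
    2 * dot (x - y) w - t * enorm w ^+ 2 <= 2 * (delta * M * enorm w).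
  move=> tp tt; rewrite -(ler_pM2l tp).
  apply/ler_addgt0Pr => e e0; have := key _ _ tp tt e0; lra.
apply/ler_addgt0Pr => e e0.
pose t := Num.min t1 (e / (enorm w ^+ 2 + 1)).
have ww1 : 0 < enorm w ^+ 2 + 1 by rewrite ltr_wpDl ?sqr_ge0.
have tp : 0 < t by rewrite lt_min t10 divr_gt0.
have := key2 t tp (ltac:(by rewrite ge_min lexx)).
have : t * (enorm w ^+ 2 + 1) <= e by rewrite -ler_pdivlMr// ge_min lexx orbT.
lra.
Qed.

(* The slope of the sup-convolution is controlled by g up to a relative error of
   order |x - y| / r: for y on the boundary, the segment from y to x is tilted
   inwards along the normal before D is compared along it. *)
Lemma sup_conv_semiconvex x : Omega x -> exists y, [/\ closure Omega y,
   forall z, sup_conv x - sup_conv z <=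
     dot (delta^-1 *: (y - x)) (x - z) + enorm (x - z) ^+ 2 / (2 * delta),
   enorm (x - y) ^+ 2 <= 2 * delta * K &
   forall M tau, 0 < tau -> 0 <= M ->
     (forall z, Omega z -> enorm (z - y) < tau -> g z <= M) ->
     enorm (x - y) * (1 - 2 * enorm (x - y) / r) <=
     delta * M * (1 + 2 * enorm (x - y) / r)].
Proof.
move=> Ox; have O0 : Omega !=set0 by exists x.
have [y cy hy] := maximizing_cluster x O0.
have d2 : 0 < 2 * delta by rewrite mulr_gt0.
(* Formally [sup_conv z >= D y - |z - y|^2 / (2 delta)], with [D y] replaced by its value from the
   maximality at [x]; the limit is taken along near-maximisers. *)
have ps z : sup_conv x - enorm (z - y) ^+ 2 / (2 * delta) + enorm (x - y) ^+ 2 / (2 * delta) <= sup_conv z.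
  apply/ler_addgt0Pr => e e0.
  pose A := enorm (x - z) + 1.
  have A0 : 0 < A by rewrite ltr_wpDl ?enorm_ge0.
  have e2 : 0 < e / 2 by rewrite divr_gt0.
  have e3 : 0 < e / 2 * delta / A by rewrite divr_gt0// mulr_gt0.
  have [y' [Oy' yy' hy']] := hy _ _ e2 e3.
  have := le_sup_conv z Oy'.
  have h4 : enorm (z - y') ^+ 2 - enorm (z - y) ^+ 2 + enorm (x - y) ^+ 2 - enorm (x - y') ^+ 2
      <= 2 * delta * (e / 2).
    have -> : enorm (z - y') ^+ 2 - enorm (z - y) ^+ 2 + enorm (x - y) ^+ 2 - enorm (x - y') ^+ 2
      = 2 * dot (x - z) (y' - y).
      have -> : z - y' = (z - y) + (- 1) *: (y' - y).
        by apply/rowP => i; rewrite !mxE; ring.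
      have -> : x - y' = (x - y) + (- 1) *: (y' - y).
        by apply/rowP => i; rewrite !mxE; ring.
      have -> : x - z = (x - y) - (z - y) by apply/rowP => i; rewrite !mxE; ring.
      by rewrite !sqr_enormDZ dotBl; ring.
    rewrite -mulrA ler_pM2l// (le_trans (dot_le_enorm _ _))//.
    move: yy'; rewrite ltr_pdivlMr// /A; have := enorm_ge0 (y' - y); lra.
  have : (enorm (z - y') ^+ 2 - enorm (z - y) ^+ 2 + enorm (x - y) ^+ 2 - enorm (x - y') ^+ 2) / (2 * delta)
      <= e / 2 by rewrite ler_pdivrMr// mulrC.
  by move: hy'; rewrite /penalized !mulrDl !mulNr; lra.
exists y; split => //.
- move=> z; have := ps z.
  have -> : z - y = (x - y) + (- 1) *: (x - z).
    by apply/rowP => i; rewrite !mxE; ring.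
  have -> : y - x = - (x - y) by rewrite opprB.
  rewrite sqr_enormDZ dotZl dotNl => h.
  have -> : delta^-1 * - dot (x - y) (x - z) + enorm (x - z) ^+ 2 / (2 * delta) =
     (enorm (x - y) ^+ 2 + 2 * -1 * dot (x - y) (x - z) + (-1) ^+ 2 * enorm (x - z) ^+ 2) / (2 * delta)
     - enorm (x - y) ^+ 2 / (2 * delta).
    by field; rewrite gt_eqF.
  lra.
- have h1 : sup_conv x <= sup_conv x - enorm (x - y) ^+ 2 / (2 * delta) + K.
    apply/ler_addgt0Pr => e e0.
    pose A := enorm (x - y) + 1.
    have A0 : 0 < A by rewrite ltr_wpDl ?enorm_ge0.
    have e2 : 0 < e / 2 by rewrite divr_gt0.
    have e3 : 0 < e / 2 * delta / A by rewrite divr_gt0// mulr_gt0.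
    have [y' [Oy' yy' hy']] := hy _ _ e2 e3.
    have hD := DK Oy'.
    have : (enorm (x - y) ^+ 2 - enorm (x - y') ^+ 2) / (2 * delta) <= e / 2.
      rewrite ler_pdivrMr//.
      have -> : x - y' = (x - y) + (- 1) *: (y' - y).
        by apply/rowP => i; rewrite !mxE; ring.
      rewrite sqr_enormDZ; have := dot_le_enorm (x - y) (y' - y).
      move: yy'; rewrite ltr_pdivlMr// /A; have := enorm_ge0 (y' - y).
      have := sqr_ge0 (enorm (y' - y)); lra.
    rewrite mulrBl => h7; move: hy'; rewrite /penalized => h8.
    have := sup_conv_ge Ox; have := D0 Ox; lra.
  have : enorm (x - y) ^+ 2 / (2 * delta) <= K by lra.
  by rewrite ler_pdivrMr// mulrC.
move=> M tau tau0 M0 gM; have l0 := enorm_ge0 (x - y).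
have [->|lp] := eqVneq (enorm (x - y)) 0.
  by rewrite !mulr0 !mul0r addr0 mulr1 mulr_ge0// ltW.
have {}lp : 0 < enorm (x - y) by rewrite lt_neqAle eq_sym lp.
set l := enorm (x - y) in l0 lp *.
have lr : 0 <= 2 * l / r by rewrite divr_ge0 ?mulr_ge0// ltW.
have dM : 0 <= delta * M by rewrite mulr_ge0// ltW.
have [Oy|nOy] := pselect (Omega y).
  have : dot (x - y) (x - y) <= delta * M * enorm (x - y).
    apply: (inward_slope O0 tau0 hy _ gM).
    have /nbhs_enormP[e e0 he] : nbhs y Omega by exact: open_nbhs_nbhs.
    exists (e / 2 / (l + 1)), (e / 2); split; rewrite ?divr_gt0// ?ltr_wpDl//.
    move=> z t Oz zy t0; rewrite ler_pdivlMr ?ltr_wpDl// => tl.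
    apply: he; rewrite addrAC; apply: le_lt_trans (enormD _ _) _.
    by rewrite enormZ ger0_norm// -/l; lra.
  rewrite -sqr_enorm -/l expr2 ler_pM2r// => h.
  have : 0 <= delta * M * (2 * l / r) by rewrite mulr_ge0.
  have : 0 <= l * (2 * l / r) by rewrite mulr_ge0.
  lra.
have [n [n1 hn hin]] : exists n, [/\ enorm n = 1,
    forall x, Omega x -> r * dot (x - y) n <= enorm (x - y) ^+ 2 &
    forall e, dot e n < 0 -> exists t0 tau : R, [/\ 0 < t0, 0 < tau &
      forall z t, Omega z -> enorm (z - y) < tau -> 0 <= t -> t <= t0 ->
        Omega (z + t *: e)]].
  by apply: normal; split => //; rewrite ((@interior_id _ Omega).1 oO).
(* The exterior ball gives (x - y).n <= l^2 / r; subtracting twice this bound along [n] makes [w]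
   point strictly inwards. *)
pose s := 2 * l ^+ 2 / r.
have s0 : 0 <= s by rewrite divr_ge0 ?mulr_ge0 ?sqr_ge0// ltW.
pose w := (x - y) - s *: n.
have nl : dot (x - y) n <= l by have := dot_le_enorm (x - y) n; rewrite n1 mulr1.
have wn : dot w n < 0.
  rewrite /w dotBl dotZl -sqr_enorm n1 expr1n mulr1 -(ltr_pM2l r0) mulr0 mulrBr.
  have -> : r * s = 2 * l ^+ 2 by rewrite /s; field; rewrite gt_eqF.
  have := hn _ Ox; rewrite -/l.
  have : 0 < l ^+ 2 by rewrite exprn_gt0.
  lra.
have := inward_slope O0 tau0 hy (hin _ wn) gM.
have h5 : enorm w <= l * (1 + 2 * l / r).
  apply: (le_trans (enormD _ _)); rewrite enormN enormZ n1 mulr1 ger0_norm// -/l.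
  by rewrite le_eqVlt; apply/orP; left; apply/eqP; rewrite /s; field; rewrite gt_eqF.
have h6 : l * (l * (1 - 2 * l / r)) <= dot (x - y) w.
  rewrite /w dotBr dotZr -sqr_enorm -/l.
  have : s * dot (x - y) n <= s * l by rewrite ler_wpM2l.
  have -> : l * (l * (1 - 2 * l / r)) = l ^+ 2 - s * l.
    by rewrite /s; field; rewrite gt_eqF.
  lra.
move=> h7; rewrite -(ler_pM2l lp) (le_trans h6)// (le_trans h7)//.
by rewrite mulrCA ler_wpM2l.
Qed.

End sup_convolution.

(** * Lebesgue measure *)

Section lebesgue_measure_shift.
Context {R : realType}.

Lemma lebesgue_measure_shift (a : R) (A : set R) : measurable A ->
  lebesgue_measure ((fun x : R => x + a) @^-1` A) = lebesgue_measure A.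
Proof.
move=> mA.
have ms : measurable_fun [set: measurableTypeR R] (fun x : measurableTypeR R => x + a : measurableTypeR R).
  by apply: measurable_funD.
pose m' := measure_function_pushforward__canonical__measure_function_Measure
  (@lebesgue_measure R) ms.
rewrite -[LHS]/(m' A); apply/esym/lebesgue_measure_unique => //= _ [[u v]] _ <-.
rewrite /pushforward/= (_ : _ @^-1` _ = `]u - a, v - a]%classic); last first.
  by apply/seteqP; split => x /=; rewrite !in_itv/= lerBrDr ltrBlDr.
rewrite !lebesgue_measure_itv/= !lte_fin ltrD2r; case: ifP => // _.
by rewrite -!EFinB; congr EFin; ring.
Qed.

End lebesgue_measure_shift.

Section lebesgue_rV_theory.
Context {R : realType}.
Local Open Scope ereal_scope.

Lemma measurable_shift_rV n (c : 'rV[R]_n) :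
  measurable_fun [set: 'rV[R]_n] (fun v => v + c)%R.
Proof.
apply: measurable_fun_rV => i.
rewrite (_ : (fun _ => _) = (fun v : 'rV[R]_n => v ord0 i + c ord0 i)%R); last first.
  by apply/funext => v; rewrite mxE.
by apply: measurable_funD => //; exact: (measurable_coord (T := R)).
Qed.

Lemma lebesgue_rV_shift n (c : 'rV[R]_n) (A : set 'rV[R]_n) : measurable A ->
  lebesgue_rV n ((fun v => v + c)%R @^-1` A) = lebesgue_rV n A.
Proof.
elim: n c A => [|n IH] c A mA.
  rewrite (_ : _ @^-1` A = A)//; apply/seteqP.
  by split => v /=; rewrite (_ : (v + c)%R = v)//; apply/rowP => -[].
pose sh (q : measurableTypeR R * 'rV[R]_n) : measurableTypeR R * 'rV[R]_n :=
  ((q.1 + c ord0 ord0)%R : measurableTypeR R, (q.2 + behead_rV c)%R).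
have msh : measurable_fun setT sh.
  apply/measurable_fun_pairP; split.
    by apply: measurable_funD => //; exact: measurable_fst.
  exact: (measurableT_comp (measurable_shift_rV _) measurable_snd).
pose m' := measure_function_pushforward__canonical__measure_function_Measure
  (@lebesgue_measure R \x lebesgue_rV n)%E msh.
have mcA : measurable (@cons_rV R n @^-1` A).
  by rewrite -[X in measurable X]setTI; exact: measurable_cons_rV.
rewrite [RHS]/= [RHS]/cons_measure /pushforward.
rewrite (@product_measure_unique _ _ (measurableTypeR R) _ R (@lebesgue_measure R) (lebesgue_rV n)
  m')//.
  rewrite [LHS]/= [LHS]/cons_measure /pushforward; congr (_ _).
  apply/seteqP; split => -[x v] /=; rewrite (_ : (cons_rV (x, v) + c)%R = cons_rV (sh (x, v)))//.
  1, 2: by apply/rowP => i; rewrite !mxE; case: unliftP => [j ->|->]//=; rewrite !mxE.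
move=> X Y mX mY; rewrite /= /pushforward (_ : sh @^-1` (X `*` Y) =
   ((fun x : R => x + c ord0 ord0)%R @^-1` X) `*` ((fun v => v + behead_rV c)%R @^-1` Y)); last first.
  by apply/seteqP; split.
rewrite product_measure1E//; last 2 first.
- by rewrite -[X in measurable X]setTI; apply: measurable_funD.
- by rewrite -[X in measurable X]setTI; exact: measurable_shift_rV.
by rewrite IH//; congr (_ * _); exact: lebesgue_measure_shift.
Qed.

Lemma measurable_comp_setT d1 d2 (S : measurableType d1) (T : measurableType d2)
    (f : S -> T) (A : set T) : measurable_fun setT f -> measurable A ->
  measurable (f @^-1` A).
Proof. by move=> mf mA; rewrite -[X in measurable X]setTI; exact: mf. Qed.

Section uniqueness.
Variables (n : nat) (T : 'rV[R]_n -> 'rV[R]_n).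
Hypotheses (mT : measurable_fun setT T)
  (hT : forall c, exists c', forall x, (T x + c = T (x + c'))%R).
Local Notation mu := (lebesgue_rV n).
Local Notation E := 'rV[R]_n.

(** By [hT], the translation by [c] pulls back under [T] to one by [c'], so that the image of the
    measure under [T] is again translation invariant. *)
Let muT_shift (c : E) (A : set E) : measurable A ->
  mu (T @^-1` ((fun v => v + c)%R @^-1` A)) = mu (T @^-1` A).
Proof.
move=> mA; have [c' hc] := hT c.
rewrite -[RHS](lebesgue_rV_shift c'); last exact: measurable_comp_setT.
by congr (mu _); apply/seteqP; split => x /=; rewrite hc.
Qed.

(* Two ways of computing the measure of [{(x, y) | T x in A, T x + y in B}] by
   Fubini, as in the uniqueness of the Haar measure. *)
Lemma lebesgue_rV_haar (A B : set E) : measurable A -> measurable B ->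
  mu (T @^-1` A) * mu B = mu (-%R @^-1` A) * mu (T @^-1` B).
Proof.
move=> mA mB.
have mN : measurable_fun setT (fun v : E => - v)%R.
  apply: measurable_fun_rV => i.
  rewrite (_ : (fun _ => _) = (fun v : 'rV[R]_n => - v ord0 i)%R); last first.
    by apply/funext => v; rewrite mxE.
  by apply: measurableT_comp => //; exact: (measurable_coord (T := R)).
have mD : measurable_fun setT (fun q : E * E => T q.1 + q.2)%R.
  apply: measurable_fun_rV => i.
  rewrite (_ : (fun _ => _) = (fun q : E * E => T q.1 ord0 i + q.2 ord0 i)%R); last first.
    by apply/funext => v; rewrite mxE.
  apply: measurable_funD.
    apply: (measurableT_comp (measurable_coord (T := R) i)).
    exact: measurableT_comp.
  exact: (measurableT_comp (measurable_coord (T := R) i)).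
have mB' : measurable_fun setT (fun q : E * E => T q.1 - q.2)%R.
  apply: measurable_fun_rV => i.
  rewrite (_ : (fun _ => _) = (fun q : E * E => T q.1 ord0 i - q.2 ord0 i)%R); last first.
    by apply/funext => v; rewrite !mxE.
  apply: measurable_funB.
    apply: (measurableT_comp (measurable_coord (T := R) i)).
    exact: measurableT_comp.
  exact: (measurableT_comp (measurable_coord (T := R) i)).
have mT1 : measurable_fun setT (fun q : E * E => T q.1) by exact: measurableT_comp.
pose X1 := [set q : E * E | A (T q.1) /\ B (T q.1 + q.2)%R].
pose X2 := [set q : E * E | A (T q.1 - q.2)%R /\ B (T q.1)].
have mX1 : measurable X1 by apply: measurableI; apply: measurable_comp_setT.
have mX2 : measurable X2 by apply: measurableI; apply: measurable_comp_setT.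
have F1 := indic_fubini_tonelli mu mu mX1.
have F2 := indic_fubini_tonelli mu mu mX2.
rewrite !indic_fubini_tonelli_FE// !indic_fubini_tonelli_GE// in F1 F2.
have e1 : \int[mu]_x (mu \o xsection X1) x = mu B * mu (T @^-1` A).
  transitivity (\int[mu]_(x in T @^-1` A) mu B); last first.
    by rewrite integral_cst//; exact: measurable_comp_setT.
  rewrite [in RHS]integral_mkcond; apply: eq_integral => x _ /=; rewrite patchE.
  case: ifPn => [/set_mem /= Ax|nA].
    rewrite -[RHS](lebesgue_rV_shift (T x))//; congr (mu _); rewrite xsectionE.
    by apply/seteqP; split => y /=; rewrite addrC => // -[].
  rewrite (_ : xsection _ _ = set0) ?measure0//; apply/seteqP; split => // y.
  by rewrite xsectionE /= => -[Ax _]; move: nA; rewrite notin_setE.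
have e2 : \int[mu]_x (mu \o xsection X2) x = mu (-%R @^-1` A) * mu (T @^-1` B).
  transitivity (\int[mu]_(x in T @^-1` B) mu (-%R @^-1` A)); last first.
    by rewrite integral_cst//; exact: measurable_comp_setT.
  rewrite [in RHS]integral_mkcond; apply: eq_integral => x _ /=; rewrite patchE.
  case: ifPn => [/set_mem /= Bx|nB].
    rewrite -[RHS](lebesgue_rV_shift (- T x)); last exact: measurable_comp_setT.
    congr (mu _); rewrite xsectionE.
    by apply/seteqP; split => y /=; rewrite opprD opprK addrC => // -[].
  rewrite (_ : xsection _ _ = set0) ?measure0//; apply/seteqP; split => // y.
  by rewrite xsectionE /= => -[_ Bx]; move: nB; rewrite notin_setE.
rewrite muleC -e1 F1 -e2 F2; apply: eq_integral => y _ /=.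
pose A1 := [set v : E | A v /\ B (v + y)%R].
have mA1 : measurable A1.
  by apply: measurableI => //; apply: measurable_comp_setT => //; exact: measurable_shift_rV.
transitivity (mu (T @^-1` A1)); first by rewrite ysectionE.
rewrite -(muT_shift (- y)) // ysectionE; congr (mu _).
by apply/seteqP; split => x /=; rewrite /A1 /= subrK.
Qed.

End uniqueness.

Lemma measurable_enorm n : measurable_fun [set: 'rV[R]_n] (@enorm R n).
Proof.
apply: (measurableT_comp (f := @Num.sqrt R)).
  apply: continuous_measurable_fun; exact: sqrt_continuous.
by apply: measurable_sum => i; apply: measurable_funX; exact: (measurable_coord (T := R)).
Qed.

Lemma measurable_enorm_lt n (s : R) : measurable [set v : 'rV[R]_n | (enorm v < s)%R].
Proof.
rewrite (_ : [set _ | _] = @enorm R n @^-1` `]-oo, s[%classic); last first.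
  by apply/seteqP; split => v /=; rewrite in_itv.
exact: measurable_comp_setT (@measurable_enorm n) (measurable_itv _).
Qed.

Lemma lebesgue_rV_cube n (a b : R) : (a <= b)%R ->
  lebesgue_rV n [set v : 'rV[R]_n | forall i, `[a, b]%classic (v ord0 i)] = ((b - a) ^+ n)%:E.
Proof.
move=> ab; rewrite (lebesgue_rV_box (A := fun=> `[a, b]%classic))//.
under eq_bigr do rewrite lebesgue_measure_itv/= lte_fin.
rewrite (_ : (if (a < b)%R then _ else _) = (b - a)%:E); last first.
  by case: ltP => // ba; rewrite (_ : b = a) ?subrr//; apply/eqP; rewrite eq_le ba.
by rewrite prodEFin big_const cardT size_enum_ord iter_mulr_1.
Qed.

Lemma measurable_cube n (a b : R) :
  measurable [set v : 'rV[R]_n | forall i, `[a, b]%classic (v ord0 i)].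
Proof.
rewrite (_ : [set _ | _] = \bigcap_(i in [set: 'I_n])
  ((fun v : 'rV[R]_n => v ord0 i) @^-1` `[a, b]%classic)).
  apply: fin_bigcap_measurable => // i _.
  exact: measurable_comp_setT (measurable_coord (T := R) i) (measurable_itv _).
by apply/seteqP; split => v /= h i; [move=> _|]; exact: h.
Qed.

Lemma lebesgue_rV_ball_fin n (s : R) : (0 <= s)%R ->
  lebesgue_rV n [set v : 'rV[R]_n | (enorm v < s)%R] <= ((2 * s) ^+ n)%:E.
Proof.
move=> s0; have -> : (2 * s = s - (- s))%R by ring.
rewrite -lebesgue_rV_cube; last by lra.
apply: le_measure; rewrite ?inE; [exact: measurable_enorm_lt|exact: measurable_cube|].
move=> v /= vs i; rewrite in_itv/= -ler_norml.
exact: le_trans (coord_le_enorm _ _) (ltW vs).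
Qed.

Lemma lebesgue_rV_ball_gt0 n (s : R) : (0 < s)%R ->
  0 < lebesgue_rV n [set v : 'rV[R]_n | (enorm v < s)%R].
Proof.
move=> s0; have n1 : (0 < n%:R + 1 :> R)%R by rewrite ltr_wpDl.
apply: (@lt_le_trans _ _ (((s / (n%:R + 1) - 0) ^+ n)%:E)).
  by rewrite lte_fin exprn_gt0// subr0 divr_gt0.
rewrite -lebesgue_rV_cube; last by rewrite divr_ge0// ltW.
apply: le_measure; rewrite ?inE; [exact: measurable_cube|exact: measurable_enorm_lt|].
move=> v /= vs; rewrite (le_lt_trans (enorm_le_sum v))//.
apply: (@le_lt_trans _ _ (\sum_(i < n) (s / (n%:R + 1)))%R).
  apply: ler_sum => i _; have := vs i; rewrite in_itv/= => /andP[v0 v1].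
  by rewrite ger0_norm.
rewrite sumr_const card_ord (_ : _ *+ n = s * (n%:R / (n%:R + 1)))%R.
  by rewrite gtr_pMr// ltr_pdivrMr// mul1r ltrDl.
by rewrite -mulr_natr; ring.
Qed.

(** [lebesgue_rV_haar] for the identity, tested on the unit cube, of measure 1. *)
Lemma lebesgue_rVN n (A : set 'rV[R]_n) : measurable A ->
  lebesgue_rV n (-%R @^-1` A) = lebesgue_rV n A.
Proof.
move=> mA.
have h := @lebesgue_rV_haar n id (@measurable_id _ _ _) (fun c => ex_intro _ c (fun x => erefl)) A _ mA (@measurable_cube n 0 1).
by move: h; rewrite !preimage_id lebesgue_rV_cube// subr0 expr1n !mule1.
Qed.

(** The unit ball is its own preimage and has finite positive measure, so the proportionality factor
    is 1. *)
Lemma lebesgue_rV_isometry n (T : 'rV[R]_n -> 'rV[R]_n) (A : set 'rV[R]_n) :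
  measurable_fun setT T -> (forall c, exists c', forall x, T x + c = T (x + c'))%R ->
  (forall x, enorm (T x) = enorm x) -> measurable A ->
  lebesgue_rV n (T @^-1` A) = lebesgue_rV n A.
Proof.
move=> mT hT iT mA.
have := @lebesgue_rV_haar n T mT hT A _ mA (@measurable_enorm_lt n 1).
rewrite lebesgue_rVN// (_ : T @^-1` [set v | _] = [set v | (enorm v < 1)%R]); last first.
  by apply/seteqP; split => v /=; rewrite iT.
have b0 := @lebesgue_rV_ball_gt0 n 1 ltr01; have b1 := @lebesgue_rV_ball_fin n 1 ler01.
have bf : lebesgue_rV n [set v : 'rV[R]_n | (enorm v < 1)%R] \is a fin_num.
  by rewrite ge0_fin_numE// (le_lt_trans b1)// ltry.
rewrite -(fineK bf); set b := fine _.
have : (0 < b)%R by rewrite fine_gt0// b0 (le_lt_trans b1)// ltry.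
move=> b_gt0 h; apply/eqP; rewrite eq_le -(@lee_pmul2r _ b%:E)// h lexx/=.
by rewrite -(@lee_pmul2r _ b%:E)// h.
Qed.

Lemma measurable_affine n (a : 'rV[R]_n) (k : R) :
  measurable_fun setT (fun x : 'rV[R]_n => a - k *: x)%R.
Proof.
apply: measurable_fun_rV => i.
rewrite (_ : (fun _ => _) = (fun v : 'rV[R]_n => a ord0 i - k * v ord0 i)%R); last first.
  by apply/funext => v; rewrite !mxE.
apply: measurable_funB => //; apply: measurable_funM => //.
exact: (measurable_coord (T := R)).
Qed.

(** The factor is read off the unit cube, whose preimage is a box with edges [k^-1]. *)
Lemma lebesgue_rV_affine n (a : 'rV[R]_n) (k : R) (A : set 'rV[R]_n) : (0 < k)%R ->
  measurable A ->
  lebesgue_rV n ((fun x => a - k *: x)%R @^-1` A) = ((k ^- n)%:E * lebesgue_rV n A).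
Proof.
move=> k0 mA; have kn0 : k != 0%R by rewrite gt_eqF.
have hT (c : 'rV[R]_n) : exists c', forall x, (a - k *: x + c = a - k *: (x + c'))%R.
  exists (- (k^-1 *: c))%R => x; rewrite scalerDr scalerN scalerA mulfV// scale1r.
  by rewrite opprD opprK addrA.
have := lebesgue_rV_haar (measurable_affine a k) hT mA (@measurable_cube n 0 1).
rewrite lebesgue_rV_cube// subr0 expr1n mule1 => ->; rewrite lebesgue_rVN// muleC.
congr (_ * _).
have -> : (fun x : 'rV[R]_n => a - k *: x)%R @^-1` [set v | forall i, `[0%R, 1%R]%classic (v ord0 i)]
    = [set v : 'rV[R]_n | forall i, `[(a ord0 i - 1) / k, a ord0 i / k]%classic (v ord0 i)]%R.
  apply/seteqP; split => v /= h i; have := h i; rewrite !in_itv/= !mxE => /andP[h1 h2].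
    by rewrite ler_pdivrMr// ler_pdivlMr//; apply/andP; split; lra.
  by move: h1 h2; rewrite ler_pdivrMr// ler_pdivlMr// => h1 h2; apply/andP; split; lra.
rewrite (lebesgue_rV_box (A := fun i => `[(a ord0 i - 1) / k, a ord0 i / k]%classic%R))//.
under eq_bigr => i _.
  rewrite lebesgue_measure_itv/= lte_fin ltr_pM2r ?invr_gt0// ltrBlDr ltrDl ltr01.
  rewrite -EFinB (_ : _ - _ = k^-1)%R; last by rewrite mulrBl; ring.
  over.
by rewrite prodEFin big_const cardT size_enum_ord iter_mulr_1 exprVn.
Qed.

Lemma ge0_integral_rV_affine n (a : 'rV[R]_n) (k : R) (F : 'rV[R]_n -> \bar R) :
  (0 < k)%R -> measurable_fun setT F -> (forall x, 0 <= F x) ->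
  \int[lebesgue_rV n]_x F (a - k *: x)%R = (k ^- n)%:E * \int[lebesgue_rV n]_x F x.
Proof.
move=> k0 mF F0; have kn : (0 <= k ^- n)%R by rewrite invr_ge0 exprn_ge0// ltW.
rewrite -[LHS]/(\int[lebesgue_rV n]_(x in (fun x => a - k *: x)%R @^-1` setT)
  (F \o (fun x => a - k *: x)%R) x).
rewrite -(ge0_integral_pushforward (measurable_affine a k))//.
transitivity (\int[mscale (NngNum kn) (lebesgue_rV n)]_x F x); last first.
  by rewrite ge0_integral_mscale.
apply: eq_measure_integral => [|mf A mA _]; first exact: measurable_affine.
by rewrite /= /pushforward lebesgue_rV_affine.
Qed.

Lemma ge0_integral_rV_isometry n (T : 'rV[R]_n -> 'rV[R]_n) (F : 'rV[R]_n -> \bar R) :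
  measurable_fun setT T -> (forall c, exists c', forall x, T x + c = T (x + c'))%R ->
  (forall x, enorm (T x) = enorm x) ->
  measurable_fun setT F -> (forall x, 0 <= F x) ->
  \int[lebesgue_rV n]_x F (T x) = \int[lebesgue_rV n]_x F x.
Proof.
move=> mT hT iT mF F0.
rewrite -[LHS]/(\int[lebesgue_rV n]_(x in T @^-1` setT) (F \o T) x).
rewrite -(ge0_integral_pushforward mT)//.
apply: eq_measure_integral => A mA _.
by rewrite /= /pushforward lebesgue_rV_isometry.
Qed.

End lebesgue_rV_theory.

(** * Kernel moments *)

Section powR_lipschitz.
Context {R : realType}.

Lemma powR_lipschitz (p M x y : R) : 1 <= p -> 0 <= y -> y <= x -> x <= M ->
  x `^ p - y `^ p <= p * M `^ (p - 1) * (x - y).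
Proof.
move=> p1 y0 yx xM; have p0 : 0 <= p - 1 by lra.
have x0 : 0 <= x by exact: le_trans yx.
have M0 : 0 <= M by exact: le_trans xM.
have [<-|yn0] := eqVneq 0 y.
  have pn0 : p != 0 by apply: lt0r_neq0; lra.
  rewrite powR0// !subr0.
  have [->|xn0] := eqVneq x 0; first by rewrite powR0// mulr0.
  have -> : x `^ p = x * x `^ (p - 1).
    by rewrite -{2}(powRr1 x0) -powRD ?xn0 ?implybT//; congr (_ `^ _); ring.
  rewrite mulrC ler_wpM2r// -[leLHS]mul1r ler_pM ?powR_ge0//.
  by rewrite ge0_ler_powR// nnegrE.
have {}y0 : 0 < y by rewrite lt_neqAle yn0.
have [c cI ->] : exists2 c, c \in `[y, x]%R & x `^ p - y `^ p = p * c `^ (p - 1) * (x - y).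
  apply: (@MVT_segment R (fun c => c `^ p) (fun c => p * c `^ (p - 1)) y x yx) => [c|].
    by rewrite in_itv/= => /andP[yc _]; apply: is_derive1_powR; exact: lt_trans yc.
  apply: derivable_within_continuous => c; rewrite in_itv/= => /andP[yc _].
  have c0 : 0 < c by exact: lt_le_trans yc.
  exact: (@ex_derive _ _ _ _ _ _ _ (is_derive1_powR _ c0)).
move: cI; rewrite in_itv/= => /andP[yc cx].
have p00 : 0 <= p by lra.
rewrite ler_wpM2r ?subr_ge0// ler_wpM2l// ge0_ler_powR// ?nnegrE//.
  by rewrite (le_trans (ltW y0)).
exact: le_trans xM.
Qed.

End powR_lipschitz.

Section householder.
Context {R : realType} {n : nat}.
Local Notation E := 'rV[R]_n.

Lemma measurable_dot (q : E) : measurable_fun setT (fun z => dot q z).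
Proof.
apply: measurable_sum => i; apply: measurable_funM => //.
exact: (measurable_coord (T := R)).
Qed.

(** The reflection in the hyperplane orthogonal to [e - q] exchanges [e] and [q]; when they
    coincide, the identity serves. *)
Lemma householder (q e : E) : enorm q = 1 -> enorm e = 1 ->
  exists T : E -> E, [/\ measurable_fun setT T,
    forall c, exists c', forall x, T x + c = T (x + c'),
    forall x, enorm (T x) = enorm x & forall x, dot q (T x) = dot e x].
Proof.
move=> q1 e1; pose b := e - q.
have bb : dot b b = 2 - 2 * dot e q.
  by rewrite /b !dotE -!sqr_enorm q1 e1 (dotC q e); ring.
have qb : dot q b = - (dot b b / 2).
  by rewrite bb /b dotBr -sqr_enorm q1 (dotC q e); field.
pose T (z : E) := z - (2 * dot b z / dot b b) *: b.
have dotT u z : dot u (T z) = dot u z - 2 * dot b z / dot b b * dot u b.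
  by rewrite /T dotBr dotZr.
have Tadd x y : T (x + y) = T x + T y.
  by rewrite /T dotDr; apply/rowP => i; rewrite !mxE; ring.
have [b0|b0] := eqVneq (dot b b) 0.
  have Tid z : T z = z by rewrite /T b0 invr0 mulr0 scale0r subr0.
  have bE : b = 0 by apply: enorm_eq0; apply/eqP; rewrite -sqrf_eq0 sqr_enorm b0.
  exists id; split => // [c|x]; first by exists c.
  by move/eqP: bE; rewrite subr_eq0 => /eqP ->.
have TT x : T (T x) = x.
  rewrite {1}/T dotT /T; apply/rowP => i; rewrite !mxE.
  by field.
exists T; split.
- apply: measurable_fun_rV => i.
  rewrite (_ : (fun _ => _) = (fun z : E => z ord0 i - 2 / dot b b * b ord0 i * dot b z)); last first.
    by apply/funext => z; rewrite !mxE; ring.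
  apply: measurable_funB; first exact: (measurable_coord (T := R)).
  by apply: measurable_funM => //; exact: measurable_dot.
- by move=> c; exists (T c) => x; rewrite Tadd TT.
- move=> x; apply/eqP; rewrite -(@eqrXn2 _ 2)// ?enorm_ge0// !sqr_enorm.
  rewrite dotT (dotC (T x) x) (dotC (T x) b) !dotT (dotC x b); apply/eqP; field.
  exact: b0.
- move=> x; rewrite dotT qb /b dotBl -/b; field.
  exact: b0.
Qed.

End householder.

Section radial_kernel.
Context {R : realType} {d : nat}.
Variable eta : R -> R.
Hypothesis heta : radial_kernel (d := d) eta.

Lemma kernel_ge0 t : 0 <= t -> 0 <= eta t.
Proof. by have [h _ _ _ _] := heta; exact: h. Qed.

Lemma kernel_le s t : 0 <= s -> s <= t -> eta t <= eta s.
Proof. by have [_ h _ _ _] := heta; exact: h. Qed.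

Lemma kernel_gt1 t : 1 < t -> eta t = 0.
Proof. by have [_ _ _ [_ h] _] := heta; exact: h. Qed.

Lemma kernel0_gt0 : 0 < eta 0.
Proof. by have [_ _ _ [h _] _] := heta. Qed.

(** The derivative, completed at 0 by its limit, is continuous on [0, 2], hence bounded, and the
    mean value theorem applies there. The interval goes beyond 1 because the kernel is known to
    vanish only for t > 1. *)
Lemma kernel_lipschitz : exists2 L, 0 <= L &
  forall s t, 0 <= s -> 0 <= t -> `|eta s - eta t| <= L * `|s - t|.
Proof.
have [_ _ [dk ck c0] _ _] := heta; have lt02 : 0 < 2 :> R by [].
have d0 t : 0 < t -> derivable eta t 1 by exact: (dk 0%N).
have d1 t : 0 < t -> derivable (derive1 eta) t 1 by move=> /(dk 1%N); rewrite derive1n1.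
have /cvg_ex[l cl] := ck 1%N; rewrite derive1n1 in cl.
pose g t := if t == 0 then l else derive1 eta t.
have cg : {within `[0, 2], continuous g}.
  apply/(continuous_within_itvP _ lt02); split.
  - move=> t; rewrite in_itv/= => /andP[t0 t2].
    have ct : {for t, continuous (derive1 eta)}.
      by apply: differentiable_continuous; apply/derivable1_diffP; exact: d1.
    rewrite /continuous_at /g gt_eqF//; apply: cvg_trans ct; apply: near_eq_cvg.
    by near=> s; rewrite /g gt_eqF//; near: s; exact: lt_nbhsr.
  - rewrite /g eqxx; apply: cvg_trans cl; apply: near_eq_cvg; near=> s.
    by rewrite /g gt_eqF.
  - have t0 : 0 < 2 :> R by [].
    have ct : {for (2 : R), continuous (derive1 eta)}.
      by apply: differentiable_continuous; apply/derivable1_diffP; exact: d1.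
    rewrite /g gt_eqF//; apply: cvg_trans (cvg_at_left_filter ct); apply: near_eq_cvg.
    by near=> s; rewrite /g gt_eqF//; near: s; exact: nbhs_left_gt.
have [M [M0 hM]] : exists M, 0 <= M /\ forall t, 0 <= t <= 2 -> `|g t| <= M.
  have cng : {within `[0, 2], continuous (fun t => `|g t|)}.
    by move=> t; apply: continuous_comp; [exact: cg | exact: norm_continuous].
  have [c _ hc] := @EVT_max R (fun t => `|g t|) 0 2 (ltW lt02) cng.
  exists `|g c|; split => // t t02; apply: hc; by rewrite in_itv.
have lip01 s t : 0 <= s -> s <= t -> t <= 2 -> `|eta s - eta t| <= M * `|s - t|.
  move=> s0 st t2.
  have [c cst e] : exists2 c, c \in `[s, t]%R & eta t - eta s = g c * (t - s).
    apply: MVT_segment => // [c|].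
      rewrite in_itv/= => /andP[sc ct]; have c00 : 0 < c by exact: le_lt_trans sc.
      apply: DeriveDef; first exact: d0.
      by rewrite /g gt_eqF// derive1E.
    have ceta : {within `[0, 2], continuous eta}.
      apply/(continuous_within_itvP _ lt02); split => //.
      - move=> u; rewrite in_itv/= => /andP[u0 _].
        by apply: differentiable_continuous; apply/derivable1_diffP; exact: d0.
      - have cu : {for (2 : R), continuous eta}.
          by apply: differentiable_continuous; apply/derivable1_diffP; exact: d0.
        exact: cvg_at_left_filter cu.
    apply: continuous_subspaceW ceta => u /=; rewrite !in_itv/= => /andP[su ut].
    by apply/andP; split; lra.
  move: cst; rewrite in_itv/= => /andP[sc ct].
  rewrite distrC e normrM [`|s - t|]distrC ler_wpM2r// hM//.
  by apply/andP; split; lra.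
exists M => // s t; wlog st : s t / s <= t.
  move=> h s0 t0; have [st|/ltW st] := leP s t; first exact: h.
  by rewrite distrC [`|s - t|]distrC; exact: h.
move=> s0 t0; have [t2|t2] := leP t 2; first exact: lip01.
rewrite (kernel_gt1 (_ : 1 < t)); last by lra.
have [s1|s1] := leP s 2; last by rewrite (kernel_gt1 (_ : 1 < s)) ?subrr ?normr0 ?mulr_ge0//; lra.
have := lip01 s 2 s0 s1 (lexx _); rewrite (kernel_gt1 (_ : 1 < 2 :> R))//; last by lra.
move=> h; apply: (le_trans h); rewrite ler_wpM2l// ler0_norm ?subr_le0// ler0_norm ?subr_le0//; lra.
Unshelve. all: by end_near. Qed.

End radial_kernel.

Section kernel_moment.
Context {R : realType} {n : nat}.
Local Notation E := 'rV[R]_n.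
Variables (p : R) (eta : R -> R) (L : R).
Hypotheses (p1 : 1 <= p) (eta_ge0 : forall t, 0 <= t -> 0 <= eta t)
  (eta_le : forall s t, 0 <= s -> s <= t -> eta t <= eta s)
  (eta_gt1 : forall t, 1 < t -> eta t = 0) (eta0 : 0 < eta 0) (L0 : 0 <= L)
  (eta_lip : forall s t, 0 <= s -> 0 <= t -> `|eta s - eta t| <= L * `|s - t|).

Let p0 : 0 <= p. Proof. by apply: le_trans p1. Qed.

Let pn0 : p != 0. Proof. by apply: lt0r_neq0; apply: lt_le_trans p1. Qed.

Let eta_le0 t : 0 <= t -> eta t <= eta 0.
Proof. by move=> t0; apply: eta_le. Qed.

Lemma measurable_kernel_enorm : measurable_fun setT (fun z : E => eta (enorm z)).
Proof.
(* [eta] is monotone on [0, +oo[ only; composing with [Num.max t 0] makes it monotone on R, hence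
   measurable. *)
rewrite (_ : (fun _ => _) = (fun t => eta (Num.max t 0)) \o @enorm R n); last first.
  by apply/funext => z /=; rewrite max_l// enorm_ge0.
apply: measurableT_comp; last exact: measurable_enorm.
apply: nonincreasing_measurable => // s t st; apply: eta_le.
  by rewrite le_max lexx orbT.
by rewrite ge_max !le_max st lexx orbT.
Qed.

Definition kernel_moment (q z : E) : R := eta (enorm z) * Num.max (dot q z) 0 `^ p.

Lemma kernel_moment_ge0 q z : 0 <= kernel_moment q z.
Proof. by rewrite mulr_ge0 ?powR_ge0// eta_ge0// enorm_ge0. Qed.

Lemma measurable_kernel_moment q : measurable_fun setT (kernel_moment q).
Proof.
apply: measurable_funM; first exact: measurable_kernel_enorm.
apply: (measurableT_comp (measurable_powR p)).
by apply: measurable_maxr => //; exact: measurable_dot.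
Qed.

Lemma kernel_moment_le q z : kernel_moment q z <= eta 0 * enorm q `^ p.
Proof.
have z0 := enorm_ge0 z.
have [z1|z1] := leP (enorm z) 1; last first.
  by rewrite /kernel_moment eta_gt1// mul0r mulr_ge0 ?powR_ge0// (ltW eta0).
rewrite ler_pM ?powR_ge0 ?eta_ge0 ?eta_le0//.
rewrite ge0_ler_powR ?nnegrE ?enorm_ge0 ?le_max ?lexx ?orbT//.
rewrite ge_max enorm_ge0 andbT (le_trans (dot_le_enorm _ _))//.
by rewrite ler_piMr// enorm_ge0.
Qed.

Lemma kernel_moment_fin q : enorm q = 1 ->
  (\int[lebesgue_rV n]_z (kernel_moment q z)%:E \is a fin_num)%E.
Proof.
move=> q1; rewrite ge0_fin_numE; last by apply: integral_ge0 => z _; rewrite lee_fin kernel_moment_ge0.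
pose B := [set z : E | enorm z < 2].
apply: (@le_lt_trans _ _ (\int[lebesgue_rV n]_(z in B) (eta 0)%:E)%E).
  rewrite [leRHS]integral_mkcond; apply: ge0_le_integral_nomeas => z _.
    by rewrite lee_fin kernel_moment_ge0.
  rewrite patchE; case: ifPn => [_|]; rewrite ?lee_fin.
    by rewrite (le_trans (kernel_moment_le _ _))// q1 powR1 mulr1.
  rewrite notin_setE /= => /negP; rewrite -leNgt => z2.
  by rewrite /kernel_moment eta_gt1 ?mul0r//; lra.
rewrite integral_cst//; last exact: measurable_enorm_lt.
rewrite lte_mul_pinfty ?lee_fin ?(ltW eta0)//.
by rewrite (le_lt_trans (lebesgue_rV_ball_fin _ _))// ltry.
Qed.

(** Homogeneity of degree [p] in [q] reduces to a unit vector, which a reflection carries to [e]. *)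
Lemma integral_kernel_moment e q : enorm e = 1 ->
  (\int[lebesgue_rV n]_z (kernel_moment q z)%:E =
   (enorm q `^ p)%:E * \int[lebesgue_rV n]_z (kernel_moment e z)%:E)%E.
Proof.
move=> e1.
have [->|q0] := eqVneq q 0.
  rewrite enorm0 powR0// mul0e integral0_eq// => z _.
  by rewrite /kernel_moment dot0l maxxx powR0// mulr0.
have Q0 := enorm_gt0 q0.
pose q' := (enorm q)^-1 *: q.
have q'1 : enorm q' = 1 by rewrite enormZ gtr0_norm ?invr_gt0// mulVf// gt_eqF.
have qq' z : kernel_moment q z = enorm q `^ p * kernel_moment q' z.
  rewrite /kernel_moment mulrCA; congr (_ * _).
  rewrite -powRM ?enorm_ge0 ?le_max ?lexx ?orbT//; congr (_ `^ _).
  by rewrite maxr_pMr ?enorm_ge0// mulr0 -dotZl scalerA mulfV ?gt_eqF// scale1r.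
have [T [mT hT iT dT]] := householder q'1 e1.
have mk q1 : measurable_fun setT (fun z => (kernel_moment q1 z)%:E).
  by apply/measurable_EFinP; exact: measurable_kernel_moment.
under eq_integral do rewrite qq' EFinM.
have km z (_ : setT z) : (0 <= (kernel_moment q' z)%:E)%E by rewrite lee_fin kernel_moment_ge0.
rewrite (ge0_integralZl_EFin _ measurableT km (mk q') (powR_ge0 _ _)).
suff -> : (\int[lebesgue_rV n]_z (kernel_moment q' z)%:E =
  \int[lebesgue_rV n]_z (kernel_moment e z)%:E)%E by [].
rewrite -(ge0_integral_rV_isometry mT hT iT (mk q')); last first.
  by move=> z; rewrite lee_fin kernel_moment_ge0.
by apply: eq_integral => z _; rewrite /kernel_moment iT dT.
Qed.

(** On a small cube [b/2, b]^n the Lipschitz bound keeps [eta] above half of [eta 0], and the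
    coordinate is at least b/2. *)
Lemma kernel_moment_gt0 e i : enorm e = 1 -> (forall z, dot e z = z ord0 i) ->
  (0 < \int[lebesgue_rV n]_z (kernel_moment e z)%:E)%E.
Proof.
move=> e1 dot_e; have k0 := eta0; have hL := eta_lip.
pose s := eta 0 / 2 / (L + 1).
have L0' : 0 <= L := L0.
have L1 : 0 < L + 1 by lra.
have s0 : 0 < s by rewrite !divr_gt0.
pose b := s / n.+1%:R; have b0 : 0 < b by rewrite divr_gt0.
pose C := [set v : E | forall i, `[b / 2, b]%classic (v ord0 i)].
have mC : measurable C by exact: measurable_cube.
have hC : (((eta 0 / 2 * (b / 2) `^ p) * ((b - b / 2) ^+ n))%:E <=
    \int[lebesgue_rV n]_z (kernel_moment e z)%:E)%E.
  rewrite EFinM -lebesgue_rV_cube; last by lra.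
  rewrite -integral_cst// integral_mkcond; apply: ge0_le_integral_nomeas => z _.
    by apply: erestrict_ge0 => z' _; rewrite lee_fin mulr_ge0 ?powR_ge0// ltW// divr_gt0.
  rewrite patchE; case: ifPn => [/set_mem zC|_]; rewrite lee_fin ?kernel_moment_ge0//.
  rewrite /kernel_moment dot_e ler_pM ?powR_ge0//; first by rewrite divr_ge0// ltW.
    have zs : enorm z <= s.
      apply: (le_trans (enorm_le_sum z)).
      apply: (@le_trans _ _ (\sum_(i < n) b)).
        apply: ler_sum => j _; have := zC j; rewrite /= in_itv/= => /andP[z0 z1].
        by rewrite ger0_norm//; lra.
      rewrite sumr_const card_ord -[b *+ _]mulr_natr /b -mulrA ler_piMr// ?(ltW s0)//.
      by rewrite mulrC ler_pdivrMr// mul1r ler_nat.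
    have := hL 0 (enorm z) (lexx _) (enorm_ge0 _).
    rewrite sub0r normrN (ger0_norm (enorm_ge0 _)) => /(le_trans (ler_norm _)).
    have : L * enorm z <= (L + 1) * s.
      by apply: ler_pM => //; [exact: enorm_ge0|lra].
    have -> : (L + 1) * s = eta 0 / 2 by rewrite /s; field; rewrite gt_eqF.
    lra.
  have := zC i; rewrite /= in_itv/= => /andP[z0 _].
  rewrite ge0_ler_powR ?nnegrE ?le_max ?lexx ?orbT//; [by rewrite divr_ge0// ltW|by rewrite z0].
apply: lt_le_trans hC.
by rewrite lte_fin !mulr_gt0 ?powR_gt0 ?exprn_gt0 ?divr_gt0//; lra.
Qed.

(** Lets the centre and the slope be moved to points of a grid. The error carries the indicator of a
    ball, available because the kernel has bounded support: after rescaling its mean is then of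
    order [eps ^+ n], like that of the main term. *)
Lemma kernel_moment_perturb (Q : R) : 0 <= Q -> exists2 C, 0 <= C &
  forall (w w' q q' : E) (lam s : R), 0 <= lam -> lam <= 1 -> 0 <= s -> s <= 1 ->
    enorm (w - w') <= lam -> enorm (q - q') <= lam -> enorm q <= Q ->
    eta (enorm w) * Num.max (dot q w + s) 0 `^ p <=
    kernel_moment q' w' + C * (lam + s) * (enorm w' < 3)%R%:R.
Proof.
move=> Q0; have k0 := eta0; have hL := eta_lip.
pose M := Q + 1; have M0 : 0 <= M by rewrite /M; lra.
pose K := p * M `^ (p - 1).
have K0 : 0 <= K by rewrite mulr_ge0 ?powR_ge0//; lra.
pose C := eta 0 * K * (Q + 2) + L * M `^ p.
have C0 : 0 <= C by rewrite addr_ge0// !mulr_ge0 ?powR_ge0// ?(ltW k0)//; lra.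
exists C => // w w' q q' lam s lam0 lam1 s0 s1 ww qq qQ.
have ls : 0 <= C * (lam + s) by rewrite mulr_ge0// addr_ge0.
have km := kernel_moment_ge0 q' w'.
have [w1|w1] := leP (enorm w) 1; last first.
  by rewrite eta_gt1// mul0r addr_ge0// mulr_ge0.
have w'2 : enorm w' <= 2.
  by have := enorm_sub_triangle w' w 0; rewrite !subr0 enormB; lra.
have -> : enorm w' < 3 by lra.
rewrite mulr1 /kernel_moment.
set a := Num.max _ _; set b := Num.max _ 0.
have a0 : 0 <= a by rewrite le_max lexx orbT.
have b0 : 0 <= b by rewrite le_max lexx orbT.
have aM : a <= M.
  rewrite ge_max M0 andbT /M lerD// (le_trans (dot_le_enorm _ _))//.
  by rewrite (le_trans (ler_piMr _ w1))// enorm_ge0.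
have ab : a <= b + (Q + 2) * (lam + s).
  have h1 : dot q w <= dot q' w' + (Q + 2) * lam.
    have -> : dot q w = dot q' w' + dot q (w - w') + dot (q - q') w'.
      by rewrite dotBr dotBl; ring.
    have := dot_le_enorm q (w - w'); have := dot_le_enorm (q - q') w'.
    have : enorm q * enorm (w - w') <= Q * lam by rewrite ler_pM ?enorm_ge0.
    have : enorm (q - q') * enorm w' <= lam * 2 by rewrite ler_pM ?enorm_ge0.
    lra.
  have h2 : dot q' w' <= b by rewrite le_max lexx.
  have h3 : 0 <= (Q + 1) * s by rewrite mulr_ge0//; lra.
  have h4 : 0 <= (Q + 2) * (lam + s) by rewrite mulr_ge0 ?addr_ge0//; lra.
  by rewrite ge_max; apply/andP; split; lra.
have hp : a `^ p <= b `^ p + K * ((Q + 2) * (lam + s)).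
  have [ab'|ba] := leP a b.
    apply: (@le_trans _ _ (b `^ p)); first by rewrite ge0_ler_powR ?nnegrE.
    have Q2 : 0 <= Q + 2 by lra.
    have h4 : 0 <= lam + s by lra.
    by rewrite lerDl mulr_ge0// mulr_ge0.
  have := powR_lipschitz p1 b0 (ltW ba) aM; rewrite -/K.
  have : K * (a - b) <= K * ((Q + 2) * (lam + s)) by rewrite ler_wpM2l//; lra.
  lra.
have he : eta (enorm w) <= eta (enorm w') + L * lam.
  have := hL _ _ (enorm_ge0 w) (enorm_ge0 w') => /(le_trans (ler_norm _)).
  have : L * `|enorm w - enorm w'| <= L * lam.
    by rewrite ler_wpM2l// (le_trans (enorm_lip _ _)).
  lra.
have e0 := eta_ge0 (enorm_ge0 w'); have e1 := eta_le0 (enorm_ge0 w').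
have ap : a `^ p <= M `^ p by rewrite ge0_ler_powR// ?nnegrE//; lra.
have h5 : eta (enorm w) * a `^ p <= eta (enorm w') * a `^ p + L * lam * M `^ p.
  apply: (@le_trans _ _ ((eta (enorm w') + L * lam) * a `^ p)).
    by rewrite ler_wpM2r// powR_ge0.
  by rewrite mulrDl lerD2l ler_wpM2l// mulr_ge0.
have h6 : eta (enorm w') * a `^ p <=
    eta (enorm w') * b `^ p + eta 0 * (K * ((Q + 2) * (lam + s))).
  apply: (@le_trans _ _ (eta (enorm w') * (b `^ p + K * ((Q + 2) * (lam + s))))).
    by rewrite ler_wpM2l.
  have h4 : 0 <= lam + s by lra.
  have Q2 : 0 <= Q + 2 by lra.
  by rewrite mulrDr lerD2l ler_wpM2r// mulr_ge0// mulr_ge0.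
have h7 : 0 <= L * M `^ p * s by rewrite !mulr_ge0 ?powR_ge0.
rewrite (le_trans h5)//; move: h6; rewrite /C; lra.
Qed.

End kernel_moment.

(** * Concentration *)

Section finite_unions.
Local Open Scope ereal_scope.
Context dT (T : measurableType dT) (R : realType) (mu : {measure set T -> \bar R}).

Lemma le_measure_bigsetU (I : finType) (Q : pred I) (A : I -> set T) :
  (forall i, measurable (A i)) ->
  measurable (\big[setU/set0]_(i | Q i) A i) /\
  mu (\big[setU/set0]_(i | Q i) A i) <= \sum_(i | Q i) mu (A i).
Proof.
move=> mA; elim/big_rec2: _ => [|i y1 y2 _ [my1 hy]]; first by rewrite measure0.
split; first exact: measurableU.
by rewrite (le_trans (measureU2 _ _ _))// leeD2l.
Qed.

End finite_unions.

Section chernoff.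
Context {R : realType}.

Lemma expR_le_quadratic (t : R) : 0 <= t -> t <= 2^-1 -> expR t <= 1 + t + 2 * t ^+ 2.
Proof.
move=> t0 t1.
have h := expR_ge1Dx (- t).
have e0 : 0 < expR (- t) by exact: expR_gt0.
rewrite -[t in expR t]opprK expRN invf_ple ?posrE//; last by nra.
apply: le_trans h; rewrite -div1r ler_pdivrMr; nra.
Qed.

Context (d n : nat) (dT : measure_display) (T : measurableType dT) (P : probability T R)
  (x : 'I_n -> {RV P >-> 'rV[R]_d}).
Variables (N : nat) (kap : 'rV[R]_d -> 'I_N) (val pk : 'I_N -> R) (B mbar a : R).
Hypotheses (mkap : forall k, measurable (kap @^-1` [set k]))
  (indep : mutually_independent x)
  (pkE : forall i k, P (x i @^-1` (kap @^-1` [set k])) = (pk k)%:E)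
  (pk0 : forall k, 0 <= pk k) (pk1 : \sum_k pk k = 1)
  (val0 : forall k, 0 <= val k) (valB : forall k, val k <= B) (B0 : 0 < B)
  (mle : \sum_k pk k * val k <= mbar) (a0 : 0 < a) (am : a <= 2 * mbar).

(* Chernoff's bound, by expanding the probability over the finitely many values
   of the tuple [(kap (x 0), ..., kap (x n.-1))]. *)
Lemma quantized_chernoff :
  let m := \sum_k pk k * val k in
  let bad := [set w | n%:R * (m + a) < \sum_i val (kap (x i w))] in
  measurable bad /\
  (P bad <= (expR (- (n%:R * (a ^+ 2 / (8 * B * mbar)))))%:E)%E.
Proof.
move=> m bad; have a0' := a0; have B0' := B0; have am' := am.
have mbar0 : 0 < mbar by lra.
pose badf (f : {ffun 'I_n -> 'I_N}) := n%:R * (m + a) < \sum_i val (f i).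
pose A (f : {ffun 'I_n -> 'I_N}) :=
  \bigcap_(i in [set` [set: 'I_n]%SET]) (x i @^-1` (kap @^-1` [set f i])).
have mA f : measurable (A f).
  apply: fin_bigcap_measurable => // i _.
  by rewrite -[X in measurable X]setTI; apply: measurable_funPT.
have badE : bad = \big[setU/set0]_(f | badf f) A f.
  rewrite -bigcup_seq_cond; apply/seteqP; split => [w bw|w [f /= /andP[_]]].
    exists [ffun i => kap (x i w)] => /=; last by move=> i _; rewrite /= ffunE.
    rewrite mem_index_enum/= /badf; apply: (lt_le_trans bw).
    by rewrite le_eqVlt; apply/orP; left; apply/eqP/eq_bigr => i _; rewrite ffunE.
  rewrite /badf /bad /= => bf Af; apply: (lt_le_trans bf).
  rewrite le_eqVlt; apply/orP; left; apply/eqP/eq_bigr => i _.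
  by rewrite (Af i) //= inE.
have [mU PU] := le_measure_bigsetU P badf mA.
rewrite -badE in mU PU; split => //; apply: (le_trans PU).
have PA f : P (A f) = (\prod_i pk (f i))%:E.
  rewrite /A indep// -prodEFin; apply: eq_big => i; first by rewrite inE.
  by move=> _; rewrite pkE.
rewrite (eq_bigr (fun f : {ffun 'I_n -> 'I_N} => (\prod_i pk (f i))%:E)) => [|f _]; last exact: PA.
rewrite sumEFin lee_fin.
(* Minimises the exponent [2 * s ^+ 2 * B * mbar - s * a]; [a <= 2 * mbar] gives [s * B <= 2^-1],
   the range of [expR_le_quadratic]. *)
pose s := a / (4 * B * mbar).
have s0 : 0 < s by rewrite divr_gt0// !mulr_gt0.
apply: (@le_trans _ _ (\sum_(f : {ffun 'I_n -> 'I_N}) \prod_i (pk (f i) * expR (s * (val (f i) - (m + a)))))).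
  rewrite [leRHS](bigID badf)/= -[leLHS]addr0 lerD//; last first.
    by apply: sumr_ge0 => f _; apply: prodr_ge0 => i _; rewrite mulr_ge0// expR_ge0.
  apply: ler_sum => f; rewrite /badf => bf; rewrite big_split/= -expR_sum.
  rewrite ler_peMr//; first by apply: prodr_ge0.
  rewrite -[leLHS]expR0 ler_expR -mulr_sumr mulr_ge0 ?(ltW s0)//.
  by rewrite sumrB sumr_const card_ord -[_ *+ n]mulr_natl subr_ge0 ltW.
rewrite -(bigA_distr_bigA (fun (i : 'I_n) k => pk k * expR (s * (val k - (m + a))))).
rewrite prodr_const card_ord -mulrN expRM_natl.
apply: lerXn2r; rewrite ?nnegrE ?expR_ge0//.
  by apply: sumr_ge0 => k _; rewrite mulr_ge0// expR_ge0.
have sB : s * B <= 2^-1.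
  rewrite /s (_ : _ / _ * B = a / (4 * mbar)); last by field; rewrite !gt_eqF.
  by rewrite ler_pdivrMr ?mulr_gt0//; lra.
have m0 : 0 <= m by apply: sumr_ge0 => k _; rewrite mulr_ge0.
(* [val k ^ 2 <= B * val k] bounds the second moment by [B] times the mean. *)
have h1 : \sum_k pk k * expR (s * val k) <= 1 + s * m + 2 * s ^+ 2 * B * m.
  apply: (@le_trans _ _ (\sum_k (pk k + s * (pk k * val k) + 2 * s ^+ 2 * B * (pk k * val k)))).
    apply: ler_sum => k _.
    have sv : 0 <= s * val k by rewrite mulr_ge0// ltW.
    have svB : s * val k <= 2^-1 by apply: le_trans sB; rewrite ler_pM2l.
    rewrite (le_trans (ler_wpM2l (pk0 k) (expR_le_quadratic sv svB)))//.
    have : 2 * s ^+ 2 * pk k * (val k * val k) <= 2 * s ^+ 2 * pk k * (B * val k).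
      rewrite ler_wpM2l ?ler_wpM2r// mulr_ge0// mulr_ge0// sqr_ge0//.
    lra.
  by rewrite !big_split/= pk1 -!mulr_sumr.
have h2 : \sum_k pk k * expR (s * (val k - (m + a))) = expR (- (s * (m + a))) * \sum_k pk k * expR (s * val k).
  rewrite mulr_sumr; apply: eq_bigr => k _.
  by rewrite mulrBr expRD; ring.
rewrite h2.
apply: (@le_trans _ _ (expR (- (s * (m + a))) * expR (s * m + 2 * s ^+ 2 * B * m))).
  rewrite ler_wpM2l ?expR_ge0// (le_trans h1)//.
  by rewrite -addrA expR_ge1Dx.
rewrite -expRD ler_expR.
have h3 : 2 * s ^+ 2 * B * m <= 2 * s ^+ 2 * B * mbar.
  by rewrite ler_wpM2l// mulr_ge0 ?(ltW B0)// mulr_ge0// sqr_ge0.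
have -> : - (a ^+ 2 / (8 * B * mbar)) = 2 * s ^+ 2 * B * mbar - s * a.
  by rewrite /s; field; rewrite !gt_eqF.
lra.
Qed.

End chernoff.

Section concentration.
Context {R : realType} (d n : nat) (dT : measure_display) (T : measurableType dT)
  (P : probability T R) (x : 'I_n -> {RV P >-> 'rV[R]_d}).
Variables (Omega S : set 'rV[R]_d) (rho F : 'rV[R]_d -> R) (B tau : R).
Hypotheses (indep : mutually_independent x)
  (dens : forall i, has_density Omega rho (x i))
  (rho0 : forall z, Omega z -> 0 <= rho z)
  (mS : measurable S) (mF : measurable_fun setT F)
  (F0 : forall z, 0 <= F z) (FB : forall z, F z <= B) (B0 : 0 <= B) (tau0 : 0 < tau).

Let K := Num.truncn (B / tau).

(** The index 0 is reserved for points outside [S]. Inside, index k stands for values of [F] in [(k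
    - 1) tau, k tau[, rounded up by [val], so that [F] is overestimated by at most [tau]. *)
Let kap z : 'I_K.+2 := if z \in S then inord (Num.truncn (F z / tau)).+1 else ord0.

Let val (k : 'I_K.+2) : R := k%:R * tau.

Let tF z : (Num.truncn (F z / tau) <= K)%N.
Proof. by apply: le_truncn; rewrite ler_pM2r ?invr_gt0. Qed.

Let kapE z : S z -> kap z = (Num.truncn (F z / tau)).+1 :> nat.
Proof. by move=> Sz; rewrite /kap mem_set// inordK// !ltnS tF. Qed.

Let val_kap z : S z -> F z <= val (kap z) <= F z + tau.
Proof.
move=> Sz; rewrite /val kapE//.
have Ft : 0 <= F z / tau by rewrite divr_ge0// ltW.
have /andP[h1 h2] := truncn_itv Ft.
rewrite -ler_pdivrMr// (ltW h2)/= -natr1 mulrDl mul1r lerD2r -ler_pdivlMr//.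
Qed.

Let mkap k : measurable (kap @^-1` [set k]).
Proof.
have [->|k0] := eqVneq k ord0.
  rewrite (_ : _ @^-1` _ = ~` S); first exact: measurableC.
  apply/seteqP; split => z /=.
    by move=> kz Sz; have := kapE Sz; rewrite kz.
  by move=> nSz; rewrite /kap memNset.
rewrite (_ : _ @^-1` _ = S `&` F @^-1` `[(k.-1%:R * tau), k%:R * tau[%classic).
  by apply: measurableI => //; rewrite -[X in measurable X]setTI; exact: mF.
have kp : k.-1.+1 = k by rewrite prednK// lt0n; apply: contra k0 => /eqP h; apply/eqP/val_inj.
apply/seteqP; split => z /=; rewrite in_itv/=.
  move=> kz; have Sz : S z.
    by apply: contrapT => nSz; move/eqP: k0; apply; rewrite -kz /kap memNset.
  have e := kapE Sz; rewrite kz in e.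
  have Ft : 0 <= F z / tau by rewrite divr_ge0// ltW.
  have /andP[h1 h2] := truncn_itv Ft.
  by split => //; rewrite e/= -ler_pdivlMr// h1/= -ltr_pdivrMr.
move=> [Sz /andP[h1 h2]]; apply: val_inj => /=; rewrite kapE// -[RHS]kp; congr _.+1.
apply: truncn_def; rewrite kp.
by rewrite ler_pdivlMr// h1/= ltr_pdivrMr.
Qed.

Local Open Scope ereal_scope.

(** [m] is the mean of the rounded values. It is left abstract, with an estimate for every bound
    [rhop] of the density on [S], since it is used twice: with a global bound in the exponent, and
    with a local one in the final inequality. *)
Lemma concentration : exists m : R,
  (forall rhop : R, (0 <= rhop)%R -> (forall z, Omega z -> S z -> rho z <= rhop)%R ->
     m%:E <= rhop%:E * \int[lebesgue_rV d]_(z in S) (F z + tau)%:E) /\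
  forall mbar a : R, (m <= mbar)%R -> (0 < a)%R -> (a <= 2 * mbar)%R ->
    exists G : set T, [/\ measurable G,
      G `<=` [set w | (\sum_i F (x i w) * (x i w \in S)%:R <= n%:R * (m + a))%R] &
      P (~` G) <= (expR (- (n%:R * (a ^+ 2 / (8 * (B + 2 * tau) * mbar)))))%:E].
Proof.
(* The common law [pk] is read off the first sample, so the empty sample is apart. *)
case: n x indep dens => [|n'] x' indep' dens'.
  exists 0%R; split => [rhop rp _|mbar a mb a0 am].
    rewrite mule_ge0 ?lee_fin//; apply: integral_ge0 => z _.
    by rewrite lee_fin addr_ge0// ltW.
  exists setT; split => // [w _ /=|]; first by rewrite big_ord0 mul0r.
  by rewrite setCT measure0 lee_fin expR_ge0.
pose A k := kap @^-1` [set k].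
pose pk k := fine (P (x' ord0 @^-1` A k)).
have dE i k : P (x' i @^-1` A k) = \int[lebesgue_rV d]_(z in A k `&` Omega) (rho z)%:E.
  by rewrite -(dens' i)//; exact: mkap.
have mxA i k : measurable (x' i @^-1` A k).
  by rewrite -[X in measurable X]setTI; apply: measurable_funPT => //; exact: mkap.
have pkE i k : P (x' i @^-1` A k) = (pk k)%:E.
  by rewrite dE -(dE ord0) /pk fineK// fin_num_measure.
have pk0 k : (0 <= pk k)%R by rewrite fine_ge0.
have pk1 : (\sum_k pk k = 1)%R.
  apply: EFin_inj; rewrite -sumEFin.
  rewrite (eq_bigr (fun k => P (x' ord0 @^-1` A k))) => [|k _]; last by rewrite pkE.
  rewrite -measure_semi_additive_ord//; last 2 first.
  - apply/trivIsetP => i j _ _ ij; apply/seteqP; split => // w /= [].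
    by rewrite /A /= => -> /eqP; rewrite (negbTE ij).
  - by rewrite -bigcup_seq; apply: fin_bigcup_measurable.
  rewrite -(probability_setT P); congr (P _); apply/seteqP; split => // w _.
  rewrite -bigcup_seq; exists (kap (x' ord0 w)) => //=.
  by rewrite mem_index_enum.
exists (\sum_k pk k * val k)%R; split => [rhop rp hrho|mbar a mb a0 am].
  pose S' := \big[setU/set0]_(k <- [seq k <- index_enum 'I_K.+2 | k != ord0]) A k.
  have S'E : S' = S.
    rewrite /S' -bigcup_seq; apply/seteqP; split => z.
      move=> [k /=]; rewrite mem_filter => /andP[k0 _] kz.
      by apply: contrapT => nSz; move/eqP: k0; apply; rewrite -kz /kap memNset.
    move=> Sz; exists (kap z) => //=; rewrite mem_filter mem_index_enum andbT.
    by apply/eqP => h; have := kapE Sz; rewrite h.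
  have mFt : measurable_fun setT (fun z => (F z + tau)%:E).
    by apply/measurable_EFinP; apply: measurable_funD.
  rewrite -[X in _ * \int[_]_(z in X) _]S'E ge0_integral_bigsetU//; last 4 first.
  - by rewrite filter_uniq// index_enum_uniq.
  - apply/trivIsetP => i j _ _ ij; apply/seteqP; split => // w /= [].
    by rewrite /A /= => -> /eqP; rewrite (negbTE ij).
  - exact: measurable_funTS.
  - by move=> z _; rewrite lee_fin addr_ge0// ltW.
  rewrite big_filter ge0_sume_distrr; last first.
    by move=> k _; apply: integral_ge0 => z _; rewrite lee_fin addr_ge0// ltW.
  rewrite -sumEFin (bigD1 ord0)//= {1}/val mul0r mulr0 add0e.
  apply: lee_sum => k k0.
  have pkle : (pk k)%:E <= rhop%:E * lebesgue_rV d (A k).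
    rewrite -(pkE ord0) dE -integral_cst; last exact: mkap.
    rewrite [leLHS]integral_mkcond [leRHS]integral_mkcond.
    apply: ge0_le_integral_nomeas => z _.
      by apply: erestrict_ge0 => z' [_ Oz']; rewrite lee_fin rho0.
    rewrite !patchE; case: ifPn => [/set_mem [Az Oz]|_].
      rewrite mem_set// lee_fin hrho//.
      by apply: contrapT => nSz; move/eqP: k0; apply; rewrite -Az /kap memNset.
    by case: ifPn; rewrite // lee_fin.
  rewrite EFinM; apply: (@le_trans _ _ (rhop%:E * lebesgue_rV d (A k) * (val k)%:E)).
    by apply: lee_wpmul2r => //; rewrite lee_fin mulr_ge0// ltW.
  rewrite -muleA; apply: lee_wpmul2l; first by rewrite lee_fin.
  rewrite muleC -integral_cst; last exact: mkap.
  apply: ge0_le_integral_nomeas => z Az.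
    by rewrite lee_fin mulr_ge0// ltW.
  have Sz : S z.
    by apply: contrapT => nSz; move/eqP: k0; apply; rewrite -Az /kap memNset.
  have /andP[_] := val_kap Sz; rewrite lee_fin.
  by have -> : kap z = k by exact: Az.
have val0 k : (0 <= val k)%R by rewrite mulr_ge0// ltW.
have valB k : (val k <= B + 2 * tau)%R.
  have /andP[h _] : (K%:R <= B / tau < K.+1%:R)%R.
    by apply: truncn_itv; rewrite divr_ge0// ltW.
  apply: (@le_trans _ _ (K.+1%:R * tau)%R).
    by rewrite ler_pM2r// ler_nat -ltnS.
  by rewrite -natr1 mulrDl mul1r; move: h; rewrite ler_pdivlMr//; have := tau0; lra.
have B2 : (0 < B + 2 * tau)%R by have := tau0; have := B0; lra.
have [mbad Pbad] := @quantized_chernoff R d n'.+1 dT T P x' _ kap val pk _ mbar a mkap indep' pkE pk0 pk1 val0 valB B2 mb a0 am.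
eexists; split; [exact: measurableC mbad| |by rewrite setCK].
move=> w /= /negP; rewrite -leNgt; apply: le_trans; apply: ler_sum => i _.
case: (boolP (x' i w \in S)) => [/set_mem Sx|_]; last by rewrite mulr0.
by rewrite mulr1; have /andP[] := val_kap Sx.
Qed.

End concentration.

(** * Grids and the union bound *)

Section grid.
Context {R : realType} {n : nat}.

Lemma grid (r h : R) : 0 <= r -> 0 < h -> exists (M : nat) (u : {ffun 'I_n -> 'I_M} -> 'rV[R]_n),
  M%:R <= 2 * r * n.+1%:R / h + 1 /\
  forall v : 'rV[R]_n, (forall i, `|v ord0 i| <= r) -> exists f, enorm (v - u f) <= h.
Proof.
move=> r0 h0; pose k := h / n.+1%:R; have k0 : 0 < k by rewrite divr_gt0.
pose M := (Num.truncn (2 * r / k)).+1.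
exists M, (fun f : {ffun 'I_n -> 'I_M} => \row_i ((f i)%:R * k - r)); split.
  have /andP[h1 _] : (Num.truncn (2 * r / k))%:R <= 2 * r / k < M%:R.
    by apply: truncn_itv; rewrite divr_ge0 ?mulr_ge0// ltW.
  by rewrite /M -natr1 lerD2r (le_trans h1)// /k invf_div mulrA.
move=> v vr; pose t i := (v ord0 i + r) / k.
have t0 i : 0 <= t i.
  by rewrite divr_ge0 ?(ltW k0)//; have := vr i; rewrite ler_norml => /andP[]; lra.
have tM i : (Num.truncn (t i) < M)%N.
  rewrite ltnS; apply: le_truncn; rewrite ler_pM2r ?invr_gt0//.
  by have := vr i; rewrite ler_norml => /andP[]; lra.
exists [ffun i => Ordinal (tM i)].
apply: (le_trans (enorm_le_sum _)); apply: (@le_trans _ _ (\sum_(i < n) k)).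
  apply: ler_sum => i _; rewrite !mxE ffunE/=.
  have /andP[h1 h2] := truncn_itv (t0 i).
  have e : v ord0 i + r = t i * k by rewrite divfK// gt_eqF.
  have : (Num.truncn (t i))%:R * k <= t i * k by rewrite ler_pM2r.
  have : t i * k <= (Num.truncn (t i)).+1%:R * k by rewrite ler_pM2r// ltW.
  rewrite -natr1 mulrDl mul1r => h3 h4; rewrite ler_norml; apply/andP; split; lra.
rewrite sumr_const card_ord -[k *+ _]mulr_natr /k -mulrA ler_piMr ?(ltW h0)//.
by rewrite mulrC ler_pdivrMr// mul1r ler_nat.
Qed.

End grid.

Section kernel_average.
Context {R : realType} {n : nat}.
Local Notation E := 'rV[R]_n.
Variables (p : R) (eta : R -> R).
Hypotheses (eta_ge0 : forall t, 0 <= t -> 0 <= eta t)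
  (eta_le : forall s t, 0 <= s -> s <= t -> eta t <= eta s).

Lemma measurable_kernel_moment_affine (q a : E) (k : R) :
  measurable_fun setT (fun z : E => kernel_moment p eta q (a - k *: z)).
Proof.
exact: (measurableT_comp (measurable_kernel_moment _ eta_le _) (measurable_affine a k)).
Qed.

(** Change of variables w = (y - z) / eps; [6 ^+ n] bounds the volume of the ball of radius 3, to
    which the constant [c] is confined. *)
Lemma integral_kernel_average (q y : E) (eps c : R) : 0 < eps -> 0 <= c ->
  (\int[lebesgue_rV n]_(z in [set z : E | (enorm (y - z) < 3 * eps)%R])
     (kernel_moment p eta q (eps^-1 *: y - eps^-1 *: z) + c)%:E <=
   (eps ^+ n)%:E * (\int[lebesgue_rV n]_w (kernel_moment p eta q w)%:E + (c * 6 ^+ n)%:E))%E.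
Proof.
move=> e0 c0; have ei0 : 0 < eps^-1 by rewrite invr_gt0.
pose D := [set w : E | enorm w < 3].
have mD : measurable D by exact: measurable_enorm_lt.
have mk := measurable_kernel_moment p eta_le q.
have k0 := kernel_moment_ge0 p eta_ge0 q.
pose H (w : E) : \bar R := (kernel_moment p eta q w)%:E + (c * \1_D w)%:E.
have H0 w : (0 <= H w)%E.
  by apply: adde_ge0; rewrite lee_fin; [exact: k0|rewrite indicE mulr_ge0].
have mH : measurable_fun setT H.
  apply: emeasurable_funD; apply/measurable_EFinP => //.
  by apply: measurable_funM => //; exact: measurable_indic.
apply: (@le_trans _ _ (\int[lebesgue_rV n]_z H (eps^-1 *: y - eps^-1 *: z)%R)%E).
  rewrite integral_mkcond; apply: ge0_le_integral_nomeas => z _.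
    by apply: erestrict_ge0 => z' _; rewrite lee_fin addr_ge0.
  rewrite patchE; case: ifPn => [/set_mem /= zS|_]; last exact: H0.
  rewrite /H indicE mem_set ?mulr1//= /D /= -scalerBr enormZ gtr0_norm//.
  by rewrite mulrC ltr_pdivrMr.
rewrite ge0_integral_rV_affine// exprVn invrK lee_wpmul2l ?lee_fin ?exprn_ge0 ?(ltW e0)//.
rewrite /H ge0_integralD//; last 4 first.
- by move=> w _; rewrite lee_fin k0.
- exact/measurable_EFinP.
- by move=> w _; rewrite lee_fin mulr_ge0.
- by apply/measurable_EFinP; apply: measurable_funM => //; exact: measurable_indic.
rewrite leeD2l//.
under eq_integral do rewrite EFinM.
rewrite ge0_integralZl_EFin//; last by apply/measurable_EFinP; exact: measurable_indic.
rewrite integral_indic// setIT EFinM lee_wpmul2l ?lee_fin//.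
by have := @lebesgue_rV_ball_fin R n 3; rewrite -natrM; apply.
Qed.

End kernel_average.

Ltac nonneg := repeat first [assumption | done | by apply: ltW | exact: powR_ge0
  | exact: enorm_ge0 | exact: sqrtr_ge0 | apply: mulr_ge0 | apply: addr_ge0 | apply: exprn_ge0].

(* The union bound is over a grid of centres and slopes; the centres cover Omega
   at scale [eps * lam] and the slopes cover the ball of radius [Q] at scale [lam]. *)
Lemma uniform_concentration (R : realType) (n : nat) (p : R) (eta : R -> R)
    (L sigma Q diam rmax Lrho : R) (p1 : 1 <= p)
    (eta_ge0 : forall t, 0 <= t -> 0 <= eta t)
    (eta_le : forall s t, 0 <= s -> s <= t -> eta t <= eta s)
    (eta_gt1 : forall t, 1 < t -> eta t = 0) (eta0 : 0 < eta 0) (L0 : 0 <= L)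
    (eta_lip : forall s t, 0 <= s -> 0 <= t -> `|eta s - eta t| <= L * `|s - t|)
    (sigma0 : 0 <= sigma)
    (sigmaE : forall q : 'rV[R]_n, (\int[lebesgue_rV n]_z (kernel_moment p eta q z)%:E =
       (enorm q `^ p * sigma)%:E)%E) :
  0 <= Q -> 0 <= diam -> 0 <= rmax -> 0 <= Lrho ->
  exists C c1 C0 : R, [/\ 0 < C, 0 < c1, 0 < C0 &
  forall (Omega : set 'rV[R]_n) (rho : 'rV[R]_n -> R) (o : 'rV[R]_n),
    (forall z i, Omega z -> `|z ord0 i - o ord0 i| <= diam) ->
    (forall z, Omega z -> 0 <= rho z <= rmax) ->
    (forall y z, Omega y -> Omega z -> `|rho y - rho z| <= Lrho * enorm (y - z)) ->
  forall eps lam : R, 0 < eps -> eps <= 1 -> 0 < lam -> lam <= 1 ->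
  forall (m : nat) (dT : measure_display) (T : measurableType dT)
    (P : probability T R) (x : 'I_m -> {RV P >-> 'rV[R]_n}),
    (forall i w, Omega (x i w)) ->
    (forall i, has_density Omega rho (x i)) ->
    mutually_independent x ->
  exists G : set T, [/\ measurable G,
    G `<=` [set w | forall i (q : 'rV[R]_n), enorm q <= Q ->
      \sum_j eta (enorm (eps^-1 *: (x i w - x j w))) *
        Num.max (dot q (eps^-1 *: (x i w - x j w)) + Num.sqrt eps) 0 `^ p <=
      m%:R * eps ^+ n * (sigma * rho (x i w) * enorm q `^ p + C * (lam + Num.sqrt eps))] &
    (P (~` G) <= (C0 * ((eps ^+ n * lam ^+ 2)^-1) ^+ (2 * n) *
       expR (- (c1 * m%:R * eps ^+ n * lam ^+ 2)))%:E)%E]].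
Proof.
move=> Q0 diam0 rmax0 Lrho0.
have p0 : 0 <= p by apply: le_trans p1.
have [C1 C10 hC1] := kernel_moment_perturb (n := n) p1 eta_ge0 eta_le eta_gt1 eta0 L0 eta_lip Q0.
(* A grid slope within [lam <= 1] of the ball of radius [Q] has norm at most [Q1]; the other grid
   slopes are discarded by [Qb]. *)
pose Q1 := Q + 1; have Q10 : 0 <= Q1 by rewrite addr_ge0.
pose B := eta 0 * Q1 `^ p + 2 * C1.
have B0 : 0 <= B by nonneg.
pose K1 := p * Q1 `^ (p - 1).
have K10 : 0 <= K1 by nonneg.
pose C2 := (C1 + 1) * 6 ^+ n.
have C20 : 0 < C2 by rewrite mulr_gt0 ?exprn_gt0// ltr_wpDl.
pose C4 := rmax * (Q1 `^ p * sigma + 2 * C2) + 1.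
have C40 : 0 < C4.
  by rewrite ltr_wpDl//; nonneg.
(* Three errors: the variation of the density over distance [4 * eps], the shift of the slope
   together with the perturbation error, and the deviation [lam]. *)
pose C5 := 4 * Lrho * (Q1 `^ p * sigma + 2 * C2) + rmax * (K1 * sigma + C2) + 1.
have C50 : 0 < C5.
  by rewrite ltr_wpDl//; nonneg.
(* The exponent a^2 / (8 (B + 2 tau) mbar) at [a = lam * eps ^+ n], [mbar = C4 * eps ^+ n] and
   [tau = lam <= 1]: one factor [eps ^+ n] survives. *)
pose c1 := (8 * (B + 2) * C4)^-1.
have c10 : 0 < c1 by rewrite invr_gt0 !mulr_gt0// ltr_wpDl.
pose A := 2 * (diam + Q1) * n.+1%:R * n.+1%:R + 1.
have A1 : 1 <= A by rewrite lerDr; nonneg.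
have A0 : 0 < A by exact: lt_le_trans A1.
exists C5, c1, ((A ^+ 2) ^+ n); split => //; first by rewrite !exprn_gt0.
move=> Omega rho o Od rhob rhoL eps lam e0 e1 l0 l1 m dT T P x xO dens indep.
have en0 : 0 < eps ^+ n by rewrite exprn_gt0.
pose s := Num.sqrt eps.
have s0 : 0 <= s := sqrtr_ge0 _.
have s1 : s <= 1 by rewrite -sqrtr1 ler_wsqrtr.
have es : eps <= s.
  by rewrite -{1}(sqr_sqrtr (ltW e0)) -/s expr2 ler_piMr.
have [M1 [u1 [hM1 hu1]]] := @grid R n diam (eps * lam) diam0 (mulr_gt0 e0 l0).
have [M2 [u2 [hM2 hu2]]] := @grid R n Q lam Q0 l0.
pose I : finType := ({ffun 'I_n -> 'I_M1} * {ffun 'I_n -> 'I_M2})%type.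
pose Qb (k : I) := enorm (u2 k.2) <= Q1.
pose y (k : I) := o + u1 k.1.
pose F (k : I) z := kernel_moment p eta (u2 k.2) (eps^-1 *: y k - eps^-1 *: z) + C1 * (lam + s).
pose S (k : I) := [set z : 'rV[R]_n | enorm (y k - z) < 3 * eps].
have ls0 : 0 < lam + s by rewrite ltr_wpDr.
have mS k : measurable (S k).
  rewrite (_ : S k = (fun z => y k - 1 *: z) @^-1` [set v : 'rV[R]_n | enorm v < 3 * eps]).
    by apply: measurable_comp_setT; [exact: measurable_affine|exact: measurable_enorm_lt].
  by apply/seteqP; split => z /=; rewrite scale1r.
have mF k : measurable_fun setT (F k).
  by apply: measurable_funD => //; exact: measurable_kernel_moment_affine.
have F0 k z : 0 <= F k z.
  by rewrite addr_ge0 ?kernel_moment_ge0//; nonneg.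
have FB k z : Qb k -> F k z <= B.
  move=> Qk; rewrite lerD//.
    rewrite (le_trans (kernel_moment_le p1 eta_ge0 eta_le eta_gt1 eta0 _ _))//.
    by rewrite ler_pM2l// ge0_ler_powR// nnegrE// enorm_ge0.
  rewrite mulrC ler_wpM2r//; clear - l1 s1; lra.
have rho0 z : Omega z -> 0 <= rho z by move=> /rhob/andP[].
have average k : Qb k -> (\int[lebesgue_rV n]_(z in S k) (F k z + lam)%:E <=
    (eps ^+ n * (enorm (u2 k.2) `^ p * sigma + C2 * (lam + s)))%:E)%E.
  move=> Qk; have cc : 0 <= C1 * (lam + s) + lam by nonneg.
  have := integral_kernel_average p eta_ge0 eta_le (u2 k.2) (y k) e0 cc.
  rewrite sigmaE -EFinD -EFinM => h.
  apply: (@le_trans _ _ (\int[lebesgue_rV n]_(z in S k) (kernel_moment p eta (u2 k.2) (eps^-1 *: y k - eps^-1 *: z) + (C1 * (lam + s) + lam))%:E)%E).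
    apply: ge0_le_integral_nomeas => z _; rewrite lee_fin; last by rewrite addrA.
    by rewrite addr_ge0// ltW.
  apply: (le_trans h); rewrite lee_fin ler_pM2l// lerD2l /C2 mulrAC ler_wpM2r ?exprn_ge0//.
  by clear - s0; lra.
have good k : exists G : set T, measurable G /\ (Qb k -> 
    [/\ G `<=` [set w | forall i (q : 'rV[R]_n), enorm q <= Q -> enorm (q - u2 k.2) <= lam ->
         enorm (x i w - y k) <= eps * lam ->
      \sum_j eta (enorm (eps^-1 *: (x i w - x j w))) *
        Num.max (dot q (eps^-1 *: (x i w - x j w)) + s) 0 `^ p <=
      m%:R * eps ^+ n * (sigma * rho (x i w) * enorm q `^ p + C5 * (lam + s))] &
    (P (~` G) <= (expR (- (c1 * m%:R * eps ^+ n * lam ^+ 2)))%:E)%E]).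
  case: (boolP (Qb k)) => [Qk|_]; last by exists setT; split.
  have [mm [hmm hconc]] := concentration indep dens rho0 (mS k) (mF k) (F0 k) (fun z => FB k z Qk) B0 l0.
  have uQ : enorm (u2 k.2) `^ p <= Q1 `^ p.
    by rewrite ge0_ler_powR// nnegrE// enorm_ge0.
  have mle rp : 0 <= rp -> (forall z, Omega z -> S k z -> rho z <= rp) ->
      mm <= rp * (eps ^+ n * (enorm (u2 k.2) `^ p * sigma + C2 * (lam + s))).
    move=> rp0 hrp; rewrite -lee_fin (le_trans (hmm _ rp0 hrp))// EFinM.
    by rewrite lee_wpmul2l ?lee_fin// average.
  have mC4 : mm <= C4 * eps ^+ n.
    apply: (le_trans (mle rmax rmax0 _)) => [z Oz _|]; first by have /andP[] := rhob z Oz.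
    rewrite mulrCA mulrC ler_pM2r// /C4 ler_wpDr// ler_wpM2l// lerD//.
      by rewrite ler_wpM2r.
    by rewrite mulrC ler_pM2r//; clear - l1 s1; lra.
  have aC4 : lam * eps ^+ n <= 2 * (C4 * eps ^+ n).
    rewrite mulrA ler_pM2r//.
    have : 1 <= C4.
      by rewrite lerDr; nonneg.
    clear - l1; lra.
  have [G [mG GG PG]] := hconc _ _ mC4 (mulr_gt0 l0 en0) aC4.
  exists G; split => // _; split; last first.
    apply: (le_trans PG); rewrite lee_fin ler_expR lerN2.
    have -> : m%:R * ((lam * eps ^+ n) ^+ 2 / (8 * (B + 2 * lam) * (C4 * eps ^+ n))) =
       (8 * (B + 2 * lam) * C4)^-1 * m%:R * eps ^+ n * lam ^+ 2.
      field; rewrite !gt_eqF//.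
      by rewrite ltr_wpDl// mulr_gt0.
    rewrite ler_wpM2r ?sqr_ge0// ler_wpM2r ?(ltW en0)// ler_wpM2r//.
    rewrite /c1 lef_pV2 ?posrE; last 2 first.
    - by rewrite !mulr_gt0// ltr_wpDl.
    - by rewrite !mulr_gt0// ltr_wpDl// mulr_gt0.
    by rewrite ler_pM2r// ler_pM2l// lerD2l ler_piMr.
  move=> w /GG /= hw i q qQ qu xy.
  have hj j : eta (enorm (eps^-1 *: (x i w - x j w))) *
      Num.max (dot q (eps^-1 *: (x i w - x j w)) + s) 0 `^ p <=
      F k (x j w) * (x j w \in S k)%:R.
    have ww : enorm (eps^-1 *: (x i w - x j w) - eps^-1 *: (y k - x j w)) <= lam.
      rewrite -scalerBr opprB addrA subrK enormZ gtr0_norm ?invr_gt0//.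
      by rewrite mulrC ler_pdivrMr// mulrC.
    have := hC1 _ _ _ _ _ _ (ltW l0) l1 s0 s1 ww qu qQ.
    move=> /le_trans; apply.
    rewrite /F -scalerBr; case: (boolP (x j w \in S k)) => [/set_mem|].
      rewrite /S /= => h; rewrite mulr1 lerD2l.
      by rewrite ler_piMr ?mulr_ge0 ?(ltW ls0)//; case: ltP.
    rewrite notin_setE /S /= => /negP; rewrite -leNgt => h.
    have h3 : 3 <= enorm (eps^-1 *: (y k - x j w)).
      by rewrite enormZ gtr0_norm ?invr_gt0// mulrC ler_pdivlMr.
    rewrite /kernel_moment eta_gt1; last by clear - h3; lra.
    by rewrite mul0r add0r mulr0 ltNge h3 mulr0.
  apply: (le_trans (ler_sum _ (fun j _ => hj j))); apply: (le_trans hw).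
  rewrite -mulrA ler_wpM2l//.
  have r0 := rho0 _ (xO i w).
  pose rp := rho (x i w) + 4 * Lrho * eps.
  have rp0 : 0 <= rp by nonneg.
  (* Points of [S k] are within [3 * eps] of the grid centre, which is within [eps] of [x i w];
     hence the local bound [rp] of the density. *)
  have mr : mm <= rp * (eps ^+ n * (enorm (u2 k.2) `^ p * sigma + C2 * (lam + s))).
    apply: mle => // z Oz Sz.
    have zx : enorm (z - x i w) <= 4 * eps.
      have := enorm_sub_triangle z (y k) (x i w); rewrite (enormB z (y k)) (enormB (y k) (x i w)).
      move: Sz; rewrite /S /=.
      have : eps * lam <= eps by rewrite ler_piMr// ltW.
      clear - xy; lra.
    have := rhoL _ _ Oz (xO i w) => /(le_trans (ler_norm _)).
    have : Lrho * enorm (z - x i w) <= Lrho * (4 * eps) by rewrite ler_wpM2l.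
    by rewrite /rp; clear; lra.
  have up : enorm (u2 k.2) `^ p <= enorm q `^ p + K1 * lam.
    have u1' : enorm (u2 k.2) <= enorm q + lam.
      have := enorm_sub_triangle (u2 k.2) q 0; rewrite !subr0 (enormB _ q); clear - qu; lra.
    have [uq|qu'] := leP (enorm (u2 k.2)) (enorm q).
      rewrite ler_wpDr//; first by nonneg.
      by rewrite ge0_ler_powR// nnegrE enorm_ge0.
    have := powR_lipschitz p1 (enorm_ge0 q) (ltW qu') Qk; rewrite -/K1.
    have : K1 * (enorm (u2 k.2) - enorm q) <= K1 * lam by rewrite ler_wpM2l//; clear - u1'; lra.
    clear; lra.
  set U := enorm (u2 k.2) `^ p in uQ mr up *; set V := enorm q `^ p in up *.
  have rr : rho (x i w) <= rmax by have /andP[] := rhob _ (xO i w).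
  apply: (@le_trans _ _ (rp * (eps ^+ n * (U * sigma + C2 * (lam + s))) + lam * eps ^+ n)).
    by rewrite lerD2r.
  have -> : rp * (eps ^+ n * (U * sigma + C2 * (lam + s))) + lam * eps ^+ n =
    eps ^+ n * (rp * (U * sigma + C2 * (lam + s)) + lam) by ring.
  rewrite ler_pM2l// /rp mulrDl.
  have h1 : 4 * Lrho * eps * (U * sigma + C2 * (lam + s)) <=
      4 * Lrho * (Q1 `^ p * sigma + 2 * C2) * (lam + s).
    rewrite mulrAC; apply: ler_pM.
    - by nonneg.
    - exact: ltW.
    - rewrite ler_wpM2l ?mulr_ge0// lerD// ?ler_wpM2r// mulrC ler_pM2r//; clear - l1 s1; lra.
    - by clear - l0 es; lra.
  have h2 : rho (x i w) * (U * sigma + C2 * (lam + s)) <=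
      rho (x i w) * (V * sigma) + rmax * (K1 * sigma + C2) * (lam + s).
    apply: (@le_trans _ _ (rho (x i w) * (V * sigma) + rho (x i w) * ((K1 * sigma + C2) * (lam + s)))).
      rewrite -mulrDr ler_wpM2l//.
      have : U * sigma <= (V + K1 * lam) * sigma by rewrite ler_wpM2r.
      have : 0 <= K1 * sigma * s by nonneg.
      clear; lra.
    rewrite lerD2l mulrA ler_wpM2r ?(ltW ls0)// ler_wpM2r//.
    by nonneg.
  have -> : sigma * rho (x i w) * V = rho (x i w) * (V * sigma) by ring.
  move: h1 h2; rewrite /C5; clear - s0; lra.
have /choice[Gk hGk] := good.
pose G := ~` \big[setU/set0]_(k | Qb k) (~` Gk k).
have mGk k : measurable (~` Gk k) by apply: measurableC; exact: (hGk k).1.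
have [mU PU] := le_measure_bigsetU P Qb mGk.
exists G; split; first exact: measurableC.
- move=> w Gw /= i q qQ.
  have [f1 hf1] := hu1 (x i w - o) (ltac:(by move=> j; rewrite !mxE; exact: Od)).
  have [f2 hf2] := hu2 q (fun j => le_trans (coord_le_enorm q j) qQ).
  pose k : I := (f1, f2).
  have Qk : Qb k.
    have := enorm_sub_triangle (u2 f2) q 0; rewrite !subr0 (enormB _ q) /Qb /= /Q1; clear - qQ hf2 l1; lra.
  have [hk _] := (hGk k).2 Qk.
  apply: (hk w _ i q qQ hf2); last by rewrite /y opprD addrA.
  apply: contrapT => nG; apply: Gw.
  by rewrite -bigcup_seq_cond; exists k => //=; rewrite mem_index_enum.
rewrite /G setCK (le_trans PU)//.
apply: (@le_trans _ _ (\sum_(k | Qb k) (expR (- (c1 * m%:R * eps ^+ n * lam ^+ 2)))%:E)%E).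
  by apply: lee_sum => k Qk; have [_] := (hGk k).2 Qk.
rewrite sumEFin lee_fin sumr_const -[leLHS]mulr_natl ler_wpM2r ?expR_ge0//.
apply: (@le_trans _ _ (#|I|%:R)); first by rewrite ler_nat max_card.
rewrite card_prod !card_ffun !card_ord natrM !natrX.
have el0 : 0 < eps * lam by rewrite mulr_gt0.
have el1 : eps * lam <= 1 by rewrite mulr_ile1// ltW.
have MA (M : nat) (r h : R) : 0 <= r -> r <= diam + Q1 -> 0 < h -> h <= 1 ->
    M%:R <= 2 * r * n.+1%:R / h + 1 -> M%:R <= A / h.
  move=> r0 rr h0 h1 hM; rewrite (le_trans hM)// ler_pdivlMr// mulrDl divfK ?gt_eqF// mul1r.
  rewrite lerD// -[leLHS]mulr1 ler_pM ?mulr_ge0 ?ler1n//.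
  by rewrite ler_wpM2r// ler_wpM2l.
have h1 : M1%:R <= A / (eps * lam) by apply: (MA _ diam) => //; rewrite lerDl.
have h2 : M2%:R <= A / lam.
  by apply: (MA _ Q) => //; rewrite /Q1; have := diam0; clear; lra.
rewrite -exprMn.
apply: (@le_trans _ _ ((A / (eps * lam) * (A / lam)) ^+ n)).
  by rewrite lerXn2r// ?nnegrE ?mulr_ge0 ?invr_ge0 ?(ltW A0) ?(ltW el0) ?(ltW l0)// ler_pM.
have -> : A / (eps * lam) * (A / lam) = A ^+ 2 * (eps * lam ^+ 2)^-1.
  by field; rewrite !gt_eqF.
rewrite exprMn ler_pM2l ?exprn_gt0//.
(* The prefactor is brought to a power of [(eps ^+ n * lam ^+ 2)^-1], the form expected by
   [absorb_prefactor]. The inequality [eps ^+ n <= eps] requires [n > 0]. *)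
case: (posnP n) => [->|n0]; first by rewrite muln0 !expr0.
have b1 : (eps * lam ^+ 2)^-1 <= (eps ^+ n * lam ^+ 2)^-1.
  rewrite lef_pV2 ?posrE ?mulr_gt0 ?exprn_gt0// ler_pM2r ?exprn_gt0//.
  by rewrite -[leRHS]expr1 ler_wiXn2l// ltW.
apply: (@le_trans _ _ ((eps ^+ n * lam ^+ 2)^-1 ^+ n)).
  by rewrite lerXn2r// nnegrE invr_ge0 mulr_ge0 ?exprn_ge0 ?(ltW e0) ?(ltW l0)// ltW.
rewrite ler_weXn2l//; last by rewrite mul2n -addnn leq_addr.
rewrite invf_ge1 ?mulr_gt0 ?exprn_gt0// mulr_ile1 ?exprn_ge0 ?exprn_ile1// ltW//.
Qed.

(** * Path lengths *)

Section absorb.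
Context {R : realType}.

(* When [2 m exp (- c m b) < 1], the exponential [exp (c m b)] beats [m], hence
   [1 / b] as well, and any polynomial prefactor can be absorbed. *)
Lemma absorb_prefactor (C0 c1 : R) (k : nat) : 0 < C0 -> 0 < c1 ->
  exists2 c, 0 < c & forall (m : nat) (b : R), (0 < m)%N -> 0 < b -> b <= 1 ->
    2 * m%:R * expR (- (c * m%:R * b)) < 1 ->
    C0 * b^-1 ^+ k * expR (- (c1 * m%:R * b)) <= 2 * m%:R * expR (- (c * m%:R * b)).
Proof.
move=> C00 c10.
have [j hj] : exists j : nat, C0 <= 2 ^+ j.
  have := archi_boundP (ltW C00); set j := Num.bound _ => hj; exists j.
  by rewrite (le_trans (ltW hj))// -natrX ler_nat ltnW//; exact: ltn_expl.
(* Of the factors exp (c t), [j] pay for [C0], [k] for the powers of [b^-1], and one is left for the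
   right-hand side. *)
pose N : R := (j + k).+1%:R.
have N0 : 0 < N by [].
pose c := Num.min 1 (c1 / N).
have c0 : 0 < c by rewrite lt_min ltr01 divr_gt0.
have cN : c * N <= c1 by rewrite -ler_pdivlMr// ge_min lexx orbT.
exists c => // m b m0 b0 b1.
set t := m%:R * b; rewrite -!mulrA -/t => h.
have t0 : 0 < t by rewrite mulr_gt0// ltr0n.
have e0 : 0 < expR (c * t) by exact: expR_gt0.
have h1 : 2 * m%:R < expR (c * t).
  by move: h; rewrite expRN mulrA ltr_pdivrMr// mul1r.
have m1 : 1 <= m%:R :> R by rewrite ler1n.
have h2 : 2 <= expR (c * t) by lra.
(* [2 <= expR (c * t)] with [c <= 1], while exp (1/2) <= 2. It follows that 1 / b <= 2 m, used in
   [hb]. *)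
have t2 : 2^-1 <= t.
  rewrite leNgt; apply/negP => t2.
  have : expR (c * t) < expR (2^-1).
    rewrite ltr_expR; apply: le_lt_trans t2.
    by rewrite ler_piMl// ?(ltW t0)// ge_min lexx.
  have : expR (2^-1) <= 2 :> R.
    have := expR_ge1Dx (- 2^-1 : R); rewrite expRN => h3.
    have p0 : 0 < expR (2^-1) :> R by exact: expR_gt0.
    rewrite -[leLHS]invrK invf_ple ?posrE ?invr_gt0//; lra.
  lra.
have hb : b^-1 <= expR (c * t).
  apply: le_trans (ltW h1); rewrite -div1r ler_pdivrMr// -mulrA -/t; lra.
have b_0 : 0 <= b^-1 by rewrite invr_ge0 ltW.
apply: (@le_trans _ _ (expR (c * t) ^+ j * expR (c * t) ^+ k * expR (- (c1 * t)))).
  rewrite -!mulrA ler_pM ?(ltW C00) ?mulr_ge0 ?exprn_ge0 ?expR_ge0//.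
    by rewrite (le_trans hj)// lerXn2r ?nnegrE// ?(ltW e0).
  by rewrite ler_wpM2r ?expR_ge0// lerXn2r ?nnegrE// ltW.
apply: (@le_trans _ _ (expR (- (c * t)))); last first.
  by rewrite mulrA ler_peMl ?expR_ge0//; lra.
rewrite -exprD -expRM_natl -expRD ler_expR.
have : c * N * t <= c1 * t by rewrite ler_pM2r.
rewrite /N -natr1; lra.
Qed.

End absorb.

Section path_bounds.
Context {R : realType} {d : nat}.
Local Notation E := 'rV[R]_d.
Implicit Types (Omega Gamma : set E) (gam : R -> E).

Lemma ball_subset Omega Gamma (r : R) y z : open Omega -> Omega y -> Gamma y ->
  r <= setdist Gamma (boundary Omega) -> enorm (z - y) < r -> Omega z.
Proof.
move=> oO Oy Gy hr zy; apply: contrapT => nOz.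
have yr : enorm (y - y) < r by rewrite subrr enorm0 (le_lt_trans (enorm_ge0 _) zy).
have [b bb] := ball_meets_boundary oO Oy nOz yr zy.
apply/negP; rewrite -leNgt (le_trans hr)// enormB; apply: ge_inf.
  by exists 0 => _ [u _ [v _ <-]]; exact: enorm_ge0.
by exists y => //; exists b.
Qed.

Lemma C1_path_coord gam i : C1_path gam ->
  [/\ {within `[0, 1], continuous (fun t => gam t ord0 i)},
    forall t : R, t \in `]0, 1[ -> is_derive t 1 (fun t => gam t ord0 i) (derive1 gam t ord0 i),
    forall t : R, t \in `]0, 1[ -> {for t, continuous (fun t => derive1 gam t ord0 i)},
    cvg (derive1 gam t ord0 i @[t --> 0^'+]) &
    cvg (derive1 gam t ord0 i @[t --> 1^'-])].
Proof.
move=> [cg dg cdg c0 c1].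
have cc : continuous (fun v : E => v ord0 i) by exact: coord_continuous.
split.
- by move=> t; exact: (continuous_cvg _ (cc (gam t)) (cg t)).
- move=> t t01; have dt := dg t t01; apply: DeriveDef.
    by move/derivable_mxP : dt; exact.
  by rewrite derive1E derive_mx// mxE.
- by move=> t t01; exact: (continuous_cvg _ (cc (derive1 gam t)) (cdg t t01)).
- move/cvg_ex : c0 => [l hl]; apply/cvg_ex; exists (l ord0 i).
  exact: (continuous_cvg _ (cc l) hl).
- move/cvg_ex : c1 => [l hl]; apply/cvg_ex; exists (l ord0 i).
  exact: (continuous_cvg _ (cc l) hl).
Qed.

Lemma C1_path_speed_measurable gam : C1_path gam ->
  measurable_fun `[(0 : R), 1]%classic (fun t : R => enorm (derive1 gam t)).
Proof.
move=> hg.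
apply: (measurableT_comp (f := @Num.sqrt R)).
  by apply: continuous_measurable_fun; exact: sqrt_continuous.
apply: measurable_sum => i; apply: measurable_funX.
have [_ _ ci _ _] := C1_path_coord i hg.
have moo : measurable_fun `](0 : R), 1[%classic (fun t : R => derive1 gam t ord0 i).
  apply: open_continuous_measurable_fun; first exact: interval_open.
  by move=> t; rewrite inE => /ci.
apply/measurable_fun_itv_bndo_bndcP.
exact/measurable_fun_itv_obnd_cbndP.
Qed.

(** Fundamental theorem of calculus for one coordinate. At 0 and 1 the value of [derive1 gam]
    depends on the path outside [0, 1], so it is replaced there by its limit, which changes the
    integral by nothing. *)
Lemma path_length_ge gam i : C1_path gam ->
  (`|gam 0 ord0 i - gam 1 ord0 i|%:E <= path_length (fun=> 1%R) gam)%E.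
Proof.
move=> hg; have [cg dg cdg c0 c1] := C1_path_coord i hg.
pose F t := gam t ord0 i.
pose f t := if t <= 0 then lim (derive1 gam t ord0 i @[t --> 0^'+])
  else if 1 <= t then lim (derive1 gam t ord0 i @[t --> 1^'-]) else derive1 gam t ord0 i.
have fE t : t \in `]0, 1[ -> f t = derive1 gam t ord0 i.
  by rewrite in_itv/= => /andP[t0 t1]; rewrite /f leNgt t0/= leNgt t1.
have cf : {within `[0, 1], continuous f}.
  apply/(continuous_within_itvP _ ltr01); split.
  - move=> t t01; rewrite /continuous_at fE//; apply: cvg_trans (cdg t t01).
    apply: near_eq_cvg; near=> u; rewrite fE//.
    near: u; exact: (near_in_itvoo t01).
  - rewrite {2}/f lexx; apply: cvg_trans c0; apply: near_eq_cvg; near=> u.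
    by rewrite fE// in_itv/=; apply/andP; split; near: u; [exact: nbhs_right_gt|exact: nbhs_right_lt].
  - rewrite {2}/f lexx leNgt ltr01/=; apply: cvg_trans c1; apply: near_eq_cvg; near=> u.
    by rewrite fE// in_itv/=; apply/andP; split; near: u; [exact: nbhs_left_gt|exact: nbhs_left_lt].
have FTC : (\int[@lebesgue_measure R]_(t in `[0%R, 1%R]) (f t)%:E = (F 1)%:E - (F 0)%:E)%E.
  apply: continuous_FTC2 => //.
  - have /(continuous_within_itvP _ ltr01)[_ F0 F1] := cg.
    split; [|exact: F0|exact: F1].
    by move=> t t01; case: (dg t t01).
  - move=> t t01; rewrite fE// derive1E.
    by case: (dg t t01).
have mf : measurable_fun `[(0 : R), 1]%classic f by exact: subspace_continuous_measurable_fun.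
rewrite distrC -[`|_|%:E]/(`|(F 1)%:E - (F 0)%:E|)%E -FTC.
apply: (le_trans (le_abse_integral _ _ _)) => //; first exact/measurable_EFinP.
rewrite (_ : \int[_]_(t in _) _ = \int[@lebesgue_measure R]_(t in `]0%R, 1%R[) `|(f t)%:E|)%E; last first.
  rewrite -integral_itv_bndo_bndc; last first.
    apply: measurableT_comp => //; apply/measurable_EFinP; apply: measurable_funS mf => //.
    by move=> t /=; rewrite !in_itv/= => /andP[-> /ltW->].
  rewrite -integral_itv_obnd_cbnd//.
  apply: measurableT_comp => //; apply/measurable_EFinP; apply: measurable_funS mf => //.
  by move=> t /=; rewrite !in_itv/= => /andP[/ltW-> /ltW->].
rewrite /path_length integral_mkcond [leRHS]integral_mkcond.
apply: ge0_le_integral_nomeas => t _; first by apply: erestrict_ge0 => u _; exact: abse_ge0.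
rewrite !patchE; case: ifPn => [/set_mem /= t01|_].
  rewrite mem_set/=; last by move: t01; rewrite !in_itv/= => /andP[/ltW-> /ltW->].
  by rewrite lee_fin fE// mul1r coord_le_enorm.
by case: ifPn => // _; rewrite lee_fin mul1r enorm_ge0.
Unshelve. all: by end_near. Qed.

(** Encloses Omega in a box of size [diam], so that the number of grid points depends on the
    geodesic diameter only. *)
Lemma geodesic_diameter_coord Omega (diam : R) x y i : geodesic_diameter Omega = diam%:E ->
  Omega x -> Omega y -> `|x ord0 i - y ord0 i| <= diam.
Proof.
move=> hd Ox Oy; rewrite -lee_fin -hd.
apply: (@le_trans _ _ (geodist Omega (fun=> 1) x y)).
  by apply: le_ereal_inf_tmp => _ [gam [hg _ <- <-] <-]; exact: path_length_ge.
by apply: ereal_sup_ubound; exists x; [exact: subset_closure|exists y => //; exact: subset_closure].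
Qed.

(** The [+ 1] makes room for an actual path, since the infimum defining the distance need not be
    attained. *)
Lemma geodist_set_le Omega Gamma (g : E -> R) (diam M : R) x :
  geodesic_diameter Omega = diam%:E -> 0 <= M ->
  (forall z, closure Omega z -> 0 <= g z <= M) -> Omega x ->
  Gamma `<=` Omega -> Gamma !=set0 ->
  (geodist_set Omega g x Gamma <= (M * (diam + 1))%:E)%E.
Proof.
move=> hd M0 gM Ox GO [y Gy].
apply: (@le_trans _ _ (geodist Omega g x y)); first by apply: ereal_inf_lbound; exists y.
have : (geodist Omega (fun=> 1%R) x y < (diam + 1)%:E)%E.
  apply: (@le_lt_trans _ _ diam%:E); last by rewrite lte_fin ltrDl.
  rewrite -hd; apply: ereal_sup_ubound; exists x; first exact: subset_closure.
  by exists y => //; apply: subset_closure; exact: GO.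
move=> /ereal_inf_lt[_ [gam [hg cg g0 g1] <-] hl].
apply: (@le_trans _ _ (path_length g gam)); first by apply: ereal_inf_lbound; exists gam.
apply: (@le_trans _ _ (M%:E * path_length (fun=> 1%R) gam)%E); last first.
  by rewrite EFinM lee_wpmul2l ?lee_fin// ltW.
rewrite /path_length -ge0_integralZl_EFin//; last first.
- by apply/measurable_EFinP; apply: measurable_funM => //; exact: C1_path_speed_measurable.
- by move=> t _; rewrite lee_fin mul1r enorm_ge0.
apply: ge0_le_integral_nomeas => t /= t01; have /andP[h1 h2] := gM _ (cg t t01).
  by rewrite lee_fin mulr_ge0// enorm_ge0.
by rewrite -EFinM lee_fin mul1r ler_wpM2r// enorm_ge0.
Qed.

End path_bounds.

(** * Slopes of the sup-convolution *)

Section weight.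
Context {R : realType}.

Lemma weightE (p a b : R) : 0 < p -> 0 < a -> 0 < b ->
  a `^ (- p^-1) * b `^ p^-1 = (b / a) `^ p^-1.
Proof.
move=> p0 a0 b0; rewrite powRN powRM ?invr_ge0 ?ltW// mulrC; congr (_ * _).
by rewrite -[in RHS]powR_inv1 ?ltW// -powRrM mulN1r powRN.
Qed.

(** The [+ 1] makes the base at least 1, so that the exponent [p^-1 <= 1] can be raised to 1. *)
Lemma weight_le (p a b amin bmax : R) : 1 <= p -> 0 < amin -> amin <= a -> 0 < b -> b <= bmax ->
  a `^ (- p^-1) * b `^ p^-1 <= bmax / amin + 1.
Proof.
move=> p1 am0 ha b0 hb; have p0 : 0 < p by apply: lt_le_trans p1.
have a0 : 0 < a by apply: lt_le_trans ha.
have bm0 : 0 < bmax by apply: lt_le_trans hb.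
have q0 : 0 < bmax / amin by rewrite divr_gt0.
rewrite weightE//; apply: (@le_trans _ _ ((bmax / amin + 1) `^ p^-1)).
  apply: ge0_ler_powR; rewrite ?nnegrE ?invr_ge0 ?divr_ge0 ?(ltW p0) ?(ltW a0) ?(ltW b0)//.
    by rewrite addr_ge0// ltW.
  rewrite (@le_trans _ _ (bmax / amin)) ?lerDl// ler_pM ?invr_ge0 ?(ltW b0) ?(ltW a0)//.
  by rewrite lef_pV2 ?posrE.
rewrite -[leRHS]powRr1; last by rewrite addr_ge0// ltW.
by apply: ler_powR; [rewrite lerDr ltW|rewrite invf_le1].
Qed.

End weight.

(* The bound of [sup_conv_semiconvex] is used twice: with the global bound on the
   weight it gives [|x - y| = O(s)], and then the weight may be frozen at [x]. *)
Lemma slope_bound (R : realType) (d : nat) (p r K rho_min f_min f_max L_rho L_f : R) :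
  1 <= p -> 0 < r -> 0 <= K -> 0 < rho_min -> 0 < f_min -> 0 <= f_max -> 0 <= L_rho -> 0 <= L_f ->
  exists a s0 : R, [/\ 0 <= a, 0 < s0, s0 <= 1 &
  forall (Omega : set 'rV[R]_d) (rho f : 'rV[R]_d -> R),
    (forall z, Omega z -> rho_min <= rho z) ->
    (forall z, Omega z -> f_min <= f z <= f_max) ->
    elipschitz L_rho Omega rho -> elipschitz L_f Omega f ->
  forall s x y, 0 < s -> s <= s0 -> Omega x ->
    enorm (x - y) ^+ 2 <= 2 * s * K ->
    (forall M tau, 0 < tau -> 0 <= M ->
      (forall z, Omega z -> enorm (z - y) < tau -> rho z `^ (- p^-1) * f z `^ p^-1 <= M) ->
      enorm (x - y) * (1 - 2 * enorm (x - y) / r) <= s * M * (1 + 2 * enorm (x - y) / r)) ->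
    enorm (s^-1 *: (y - x)) <= 3 * (f_max / rho_min + 1) /\
    rho x * enorm (s^-1 *: (y - x)) `^ p <= f x * (1 + a * s)].
Proof.
move=> p1 r0 K0 rm0 fm0 fM0 Lr0 Lf0; have p0 : 0 < p by apply: lt_le_trans p1.
pose G0 := f_max / rho_min + 1.
have G00 : 0 < G0 by rewrite ltr_wpDl// divr_ge0// ltW.
(* With [tau = s], a point z within [s] of y satisfies |z - x| <= s + 3 G0 s. *)
pose A := 3 * G0 + 1; have A0 : 0 < A by rewrite ltr_wpDl// mulr_ge0// ltW.
have quot (u v : R) : 0 <= u -> 0 < v -> exists2 w, 0 <= w & w * v = u.
  by move=> u0 v0; exists (u / v); [rewrite divr_ge0// ltW | rewrite divfK// lt0r_neq0].
have [a1 a10 a1E] := quot (L_f * A) f_min (mulr_ge0 Lf0 (ltW A0)) fm0.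
have [a2 a20 a2E] := quot (L_rho * A) rho_min (mulr_ge0 Lr0 (ltW A0)) rm0.
have [a0 a00 a0E] := quot (6 * G0) r (mulr_ge0 (ler0n _ 6) (ltW G00)) r0.
have [a3 a30 a3E] : exists2 a3, 0 <= a3 & a3 = (1 + a1) * (1 + 2 * a2).
  by eexists; last reflexivity; apply: mulr_ge0; apply: addr_ge0 => //; exact: mulr_ge0.
have [a5 a50 a5E] : exists2 a5, 0 <= a5 & a5 = p * 3 `^ (p - 1) * (4 * a0).
  by eexists; last reflexivity; rewrite !mulr_ge0 ?powR_ge0// ltW.
pose s1 := r ^+ 2 / (32 * (K + 1)).
(* [s <= s1] gives |x - y| <= r / 4, hence a tilt [k <= 2^-1]; [s <= s2] will give
   [a2 * s <= 2^-1]. *)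
have s10 : 0 < s1 by rewrite divr_gt0 ?exprn_gt0 ?mulr_gt0 ?ltr_wpDl.
pose s2 := (2 * (a2 + 1))^-1.
have s20 : 0 < s2 by rewrite invr_gt0 ?mulr_gt0 ?ltr_wpDl.
pose s0 := Num.min 1 (Num.min s1 s2).
exists ((1 + a3) * (1 + a5)), s0; split.
- by apply: mulr_ge0; exact: addr_ge0.
- by rewrite !lt_min ltr01 s10 s20.
- by rewrite ge_min lexx.
move=> Omega rho f hrho hf Lrho Lf s x y sp ss0 Ox hl hM.
have ss1 : s <= s1 by rewrite (le_trans ss0)// !ge_min lexx orbT.
have ss2 : s <= s2 by rewrite (le_trans ss0)// !ge_min lexx !orbT.
have s1' : s <= 1 by rewrite (le_trans ss0)// !ge_min lexx.
have rho0 z : Omega z -> 0 < rho z by move=> /hrho; exact: lt_le_trans.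
have f0 z : Omega z -> 0 < f z by move=> /hf/andP[+ _]; exact: lt_le_trans.
set q := s^-1 *: (y - x); set l := enorm (x - y) in hl hM *.
have l0 : 0 <= l by exact: enorm_ge0.
have qE : enorm q = l / s.
  by rewrite enormZ gtr0_norm ?invr_gt0// mulrC (enormB y x).
have lr : l <= r / 4.
  have : l ^+ 2 <= (r / 4) ^+ 2.
    apply: (le_trans hl); apply: (@le_trans _ _ (2 * s1 * (K + 1))).
      by rewrite ler_pM ?mulr_ge0 ?lerDl// ?(ltW sp)// ler_pM2l.
    have K1 : K + 1 != 0 by apply: lt0r_neq0; rewrite ltr_wpDl.
    rewrite le_eqVlt; apply/orP; left; apply/eqP; rewrite /s1; field.
    by rewrite K1.
  by rewrite ler_sqr ?nnegrE ?divr_ge0 ?(ltW r0).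
pose k := 2 * l / r.
have k0 : 0 <= k by rewrite divr_ge0 ?mulr_ge0// ltW.
have k2 : k <= 2^-1 by rewrite ler_pdivrMr//; clear - lr; lra.
have rewk : 2 * l / r = k by [].
rewrite rewk in hM; clearbody k.
have sl : l <= 3 * G0 * s.
  have h : l * (1 - k) <= s * G0 * (1 + k).
    apply: (hM G0 1 ltr01 (ltW G00)) => z Oz _.
    by have /andP[_ fz] := hf z Oz; exact: weight_le (hrho _ Oz) (f0 _ Oz) fz.
  have h1 : l * 2^-1 <= l * (1 - k) by rewrite ler_wpM2l//; clear - k2; lra.
  have h2 : s * G0 * (1 + k) <= s * G0 * (3 / 2) by rewrite ler_wpM2l ?mulr_ge0 ?(ltW G00) ?(ltW sp)//; clear - k2; lra.
  clear - h h1 h2; lra.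
have kS : 4 * k <= 4 * a0 * s.
  rewrite -mulrA ler_pM2l// -rewk ler_pdivrMr// mulrAC a0E; clear - sl; lra.
have qG : enorm q <= 3 * G0 by rewrite qE ler_pdivrMr.
split=> //.
pose F := f x / rho x * (1 + a3 * s).
have F0 : 0 <= F by rewrite mulr_ge0 ?divr_ge0 ?addr_ge0 ?mulr_ge0 ?(ltW (f0 _ Ox)) ?(ltW (rho0 _ Ox)) ?(ltW sp).
(* (1 + k) / (1 - k) <= 1 + 4 k for 0 <= k <= 1/2. *)
have hq : enorm q <= F `^ p^-1 * (1 + 4 * k).
  have h : l * (1 - k) <= s * F `^ p^-1 * (1 + k).
    apply: (hM (F `^ p^-1) s sp (powR_ge0 _ _)) => z Oz zy.
    rewrite weightE ?rho0 ?f0//.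
    have zx : enorm (z - x) <= A * s.
      have -> : z - x = (z - y) - (x - y) by rewrite opprB addrA subrK.
      rewrite (le_trans (enormD _ _))// enormN /A mulrDl mul1r addrC lerD// ltW//.
    apply: ge0_ler_powR; rewrite ?nnegrE ?invr_ge0 ?divr_ge0 ?(ltW p0) ?(ltW (f0 _ Oz)) ?(ltW (rho0 _ Oz))//.
    have fz : f z <= f x * (1 + a1 * s).
      have := Lf _ _ Oz Ox; rewrite ler_norml => /andP[_ h].
      have h1 : L_f * enorm (z - x) <= L_f * (A * s) by rewrite ler_wpM2l.
      have /andP[fx _] := hf _ Ox.
      have h2 : L_f * A * s <= f x * (a1 * s).
        have -> : L_f * A * s = f_min * (a1 * s) by rewrite mulrA [f_min * _]mulrC a1E.
        by rewrite ler_wpM2r// mulr_ge0// ltW.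
      clear - h h1 h2; lra.
    have rz : rho x * (1 - a2 * s) <= rho z.
      have := Lrho _ _ Oz Ox; rewrite ler_norml => /andP[h _].
      have h1 : L_rho * enorm (z - x) <= L_rho * (A * s) by rewrite ler_wpM2l.
      have h2 : L_rho * A * s <= rho x * (a2 * s).
        have -> : L_rho * A * s = rho_min * (a2 * s) by rewrite mulrA [rho_min * _]mulrC a2E.
        by rewrite ler_wpM2r ?hrho// mulr_ge0// ltW.
      clear - h h1 h2; lra.
    have a2s : a2 * s <= 2^-1.
      apply: (@le_trans _ _ ((a2 + 1) * s2)).
        by rewrite ler_pM ?lerDl// ltW.
      rewrite /s2 invfM mulrCA mulfV ?mulr1//; apply: lt0r_neq0; rewrite ltr_wpDl//.
    have a2s0 : 0 <= a2 * s by rewrite mulr_ge0// ltW.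
    rewrite ler_pdivrMr ?rho0//; apply: (le_trans fz).
    have -> : F * rho z = f x * ((1 + a3 * s) * (rho z / rho x)).
      by rewrite /F; field; exact: lt0r_neq0 (rho0 _ Ox).
    rewrite ler_pM2l ?f0//.
    apply: (@le_trans _ _ ((1 + a3 * s) * (1 - a2 * s))); last first.
      rewrite ler_pM2l ?ler_pdivlMr ?rho0 1?mulrC// ltr_pwDl// mulr_ge0// ltW//.
    have h3 : (1 + a1 * s) * (1 + 2 * (a2 * s)) <= 1 + a3 * s.
      have : 0 <= a1 * a2 * s * (1 - s) by rewrite !mulr_ge0 ?subr_ge0// ltW.
      by rewrite a3E; clear - sp; lra.
    apply: le_trans (_ : (1 + a1 * s) * (1 + 2 * (a2 * s)) * (1 - a2 * s) <= _); last first.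
      by rewrite ler_wpM2r//; clear - a2s; lra.
    rewrite -mulrA ler_peMr ?addr_ge0 ?mulr_ge0 ?(ltW sp)//; clear - a2s a2s0; nra.
  rewrite qE ler_pdivrMr//.
  have k1 : 0 < 1 - k by clear - k2; lra.
  rewrite -(ler_pM2r k1); apply: (le_trans h).
  have -> : F `^ p^-1 * (1 + 4 * k) * s * (1 - k) = s * F `^ p^-1 * ((1 + 4 * k) * (1 - k)) by ring.
  by rewrite ler_wpM2l ?mulr_ge0 ?powR_ge0 ?(ltW sp)//; clear - k0 k2; nra.
have hp : enorm q `^ p <= F * (1 + a5 * s).
  apply: (@le_trans _ _ ((F `^ p^-1 * (1 + 4 * k)) `^ p)).
    by apply: ge0_ler_powR; rewrite ?nnegrE ?enorm_ge0 ?mulr_ge0 ?powR_ge0 ?addr_ge0 ?mulr_ge0 ?(ltW p0).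
  rewrite powRM ?powR_ge0 ?addr_ge0 ?mulr_ge0// -powRrM mulVf ?lt0r_neq0// powRr1//.
  rewrite ler_wpM2l//.
  have : (1 + 4 * k) `^ p - 1 `^ p <= p * 3 `^ (p - 1) * (1 + 4 * k - 1).
    by apply: powR_lipschitz => //; clear - k0 k2; lra.
  rewrite powR1.
  have : p * 3 `^ (p - 1) * (4 * k) <= p * 3 `^ (p - 1) * (4 * a0 * s).
    by rewrite ler_wpM2l// mulr_ge0 ?powR_ge0// ltW.
  rewrite a5E; clear; lra.
apply: (@le_trans _ _ (rho x * (F * (1 + a5 * s)))).
  by rewrite ler_pM2l ?rho0.
have -> : rho x * (F * (1 + a5 * s)) = f x * ((1 + a3 * s) * (1 + a5 * s)).
  by rewrite /F; field; exact: lt0r_neq0 (rho0 _ Ox).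
rewrite ler_pM2l ?f0//.
have : 0 <= a3 * a5 * s * (1 - s) by rewrite !mulr_ge0 ?subr_ge0// ltW.
clear - sp; lra.
Qed.

(** * Comparison on the graph *)

Section comparison.
Context {R : realType} {d : nat}.
Local Notation E := 'rV[R]_d.+1.
Variables (p : R) (eta : R -> R) (n : nat) (eps : R) (x : 'I_n -> E).
Hypotheses (p1 : 1 <= p) (eta_ge0 : forall t, 0 <= t -> 0 <= eta t) (eps0 : 0 < eps).
Hypothesis sigma0 : 0 < sigma_const (d := d) p eta.

Let le_maxr0 (a : R) : 0 <= Num.max a 0. Proof. by rewrite le_max lexx orbT. Qed.

Lemma kernel_scaled_ge0 t : 0 <= t -> 0 <= kernel_scaled (d := d) eta eps t.
Proof.
move=> t0; rewrite mulr_ge0 ?eta_ge0 ?divr_ge0 ?(ltW eps0)//.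
by rewrite invr_ge0 exprn_ge0// ltW.
Qed.

(** The operator sums over the set of vertices, where coinciding samples count once, while
    concentration concerns sums over indices. [undup] mediates: restoring repetitions can only
    increase the sum. *)
Lemma graph_op_seq (u : E -> R) z : graph_op p eta n eps (range x) u z =
  (n%:R * sigma_const (d := d) p eta * eps `^ p)^-1 *
  \sum_(y <- undup [seq x j | j <- enum 'I_n])
     kernel_scaled (d := d) eta eps (enorm (z - y)) * Num.max (u z - u y) 0 `^ p.
Proof.
rewrite /graph_op; congr (_ * _).
rewrite [RHS]fsbig_seq ?undup_uniq//.
suff -> : range x = [set` undup [seq x j | j <- enum 'I_n]] by [].
apply/seteqP; split => [_ [j _ <-]|y] /=.
  by rewrite mem_undup map_f// mem_enum.
by rewrite mem_undup => /mapP[j _ ->]; exists j.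
Qed.

Let p0 : 0 <= p. Proof. exact: le_trans p1. Qed.

Let normalization_ge0 : 0 <= (n%:R * sigma_const (d := d) p eta * eps `^ p)^-1.
Proof. by rewrite invr_ge0 !mulr_ge0 ?powR_ge0// ltW. Qed.

Lemma graph_op_mono (u v : E -> R) z : (forall j, u z - u (x j) <= v z - v (x j)) ->
  graph_op p eta n eps (range x) u z <= graph_op p eta n eps (range x) v z.
Proof.
move=> uv; rewrite !graph_op_seq ler_wpM2l//.
rewrite big_seq [leRHS]big_seq; apply: ler_sum => y.
rewrite mem_undup => /mapP[j _ ->].
rewrite ler_wpM2l ?kernel_scaled_ge0 ?enorm_ge0//.
by apply: (ge0_ler_powR p0); rewrite ?nnegrE ?le_maxr0//; exact: le_max2.
Qed.

Lemma graph_op_scale (b : R) (v : E -> R) z : 0 <= b ->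
  graph_op p eta n eps (range x) (fun y => b * v y) z =
  b `^ p * graph_op p eta n eps (range x) v z.
Proof.
move=> b0; rewrite !graph_op_seq mulrCA; congr (_ * _).
rewrite mulr_sumr; apply: eq_bigr => y _; rewrite mulrCA; congr (_ * _).
by rewrite -powRM ?le_max ?lexx ?orbT// maxr_pMr// mulr0 mulrBr.
Qed.

Lemma sum_undup_le (s : seq E) (F : E -> R) : (forall y, 0 <= F y) ->
  \sum_(y <- undup s) F y <= \sum_(y <- s) F y.
Proof.
move=> F0; elim: s => [|a s IH]; first by rewrite big_nil.
rewrite /= big_cons; case: ifP => _; last by rewrite big_cons lerD2l.
by rewrite (le_trans IH)// lerDr.
Qed.

(* Multiplying [v] by [b < 1] makes it a strict subsolution, so that [b v - u] can
   attain its maximum over the vertices only on Gamma. *)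
Lemma graph_comparison (Gamma : set E) (f u v : E -> R) (a K : R) :
  (0 < n)%N -> 0 < a ->
  (forall i, 0 < f (x i)) -> (forall i, 0 <= v (x i) <= K) ->
  (forall i, graph_op p eta n eps (range x) v (x i) < f (x i) * (1 + a)) ->
  p_eikonal_solution p eta n eps (range x) Gamma f u ->
  exists2 k, Gamma (x k) & forall i, v (x i) - u (x i) <= v (x k) + a * K.
Proof.
move=> n0 a0 f0 v0 vsub [usol uG].
pose b := (1 + a)^-1.
have b0 : 0 < b by rewrite invr_gt0 ltr_wpDr// ltW.
have ba : b * (1 + a) = 1 by rewrite mulVf// lt0r_neq0// ltr_wpDr// ltW.
have b1 : b <= 1 by rewrite invf_le1 ?lerDl ?ltr_wpDr// ltW.
pose i0 := Ordinal n0.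
pose F i := b * v (x i) - u (x i).
pose k := [arg max_(i > i0) F i]%O.
have hk i : F i <= F k.
  by rewrite /k; case: arg_maxP => // j _; apply.
have Gk : Gamma (x k).
  apply: contrapT => nG.
  have ek : graph_op p eta n eps (range x) u (x k) = f (x k).
    by apply: usol; split => //; exists k.
  (* At a maximiser of [b v - u], all differences of [u] are at most [b] times those of [v]; with
     b^p <= b and b (1 + a) = 1 this yields f < f at [x k]. *)
  have : graph_op p eta n eps (range x) u (x k) <= b `^ p * graph_op p eta n eps (range x) v (x k).
    rewrite -graph_op_scale ?(ltW b0)//; apply: graph_op_mono => j.
    by have := hk j; rewrite /F; lra.
  apply/negP; rewrite -ltNge ek.
  apply: (@lt_le_trans _ _ (b `^ p * (f (x k) * (1 + a)))).
    by rewrite ltr_pM2l ?powR_gt0.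
  apply: (@le_trans _ _ (b * (f (x k) * (1 + a)))).
    rewrite ler_wpM2r//; first by rewrite mulr_ge0 ?(ltW (f0 _))// addr_ge0// ltW.
    by apply: ge1r_powR; rewrite ?b0.
  by rewrite mulrCA ba mulr1.
exists k => // i.
have := hk i; rewrite /F (uG _ Gk).
have /andP[vi0 viK] := v0 i; have /andP[vk0 vkK] := v0 k.
have h1 : b * v (x k) <= v (x k) by rewrite ler_piMl.
have h2 : (1 - b) * v (x i) <= a * K.
  have h3 : 1 - b <= a.
    have -> : 1 - b = b * a by lra.
    by rewrite ler_piMl// ltW.
  by rewrite ler_pM// subr_ge0.
lra.
Qed.

(** The function enters the sum only through the slope [q], which is what allows a probabilistic
    bound uniform in [q] to be applied to a function built from the sample. *)
Lemma graph_op_bound (v : E -> R) i (q : E) (B : R) :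
  (forall t, 1 < t -> eta t = 0) ->
  (forall j, eps^-1 * enorm (x i - x j) <= 1 ->
    v (x i) - v (x j) <= eps * (dot q (eps^-1 *: (x i - x j)) + Num.sqrt eps)) ->
  \sum_j eta (enorm (eps^-1 *: (x i - x j))) *
    Num.max (dot q (eps^-1 *: (x i - x j)) + Num.sqrt eps) 0 `^ p <=
    n%:R * eps ^+ d.+1 * (sigma_const (d := d) p eta * B) ->
  graph_op p eta n eps (range x) v (x i) <= B.
Proof.
move=> eta_gt1 vq hsum; rewrite graph_op_seq.
have n0 : 0 < n%:R :> R by rewrite ltr0n (leq_ltn_trans _ (ltn_ord i)).
have ep0 : 0 < eps `^ p by rewrite powR_gt0.
have en0 : 0 < eps ^+ d.+1 by rewrite exprn_gt0.
have Z0 : 0 < n%:R * sigma_const (d := d) p eta * eps `^ p by rewrite !mulr_gt0.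
rewrite mulrC ler_pdivrMr//.
apply: le_trans (sum_undup_le _ _) _ => [y|].
  by rewrite mulr_ge0 ?powR_ge0 ?kernel_scaled_ge0 ?enorm_ge0.
rewrite big_map big_enum/=.
have -> : B * (n%:R * sigma_const (d := d) p eta * eps `^ p) =
  eps `^ p * eps ^- d.+1 * (n%:R * eps ^+ d.+1 * (sigma_const (d := d) p eta * B)).
  by field; exact: lt0r_neq0.
rewrite -(ler_pM2l (mulr_gt0 ep0 (_ : 0 < eps ^- d.+1))) ?invr_gt0// in hsum.
apply: le_trans hsum.
rewrite mulr_sumr; apply: ler_sum => j _.
have eE : enorm (eps^-1 *: (x i - x j)) = enorm (x i - x j) / eps.
  by rewrite enormZ gtr0_norm ?invr_gt0// mulrC.
rewrite /kernel_scaled eE.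
have [h|h] := leP (eps^-1 * enorm (x i - x j)) 1; last first.
  by rewrite eta_gt1 ?mulr0 ?mul0r ?mulr0// mulrC.
have e0 : 0 <= eta (enorm (x i - x j) / eps) by rewrite eta_ge0// divr_ge0 ?enorm_ge0// ltW.
rewrite -!mulrA [leRHS]mulrCA ler_pM2l ?invr_gt0// [leRHS]mulrCA ler_wpM2l//.
rewrite -powRM ?(ltW eps0) ?le_max ?lexx ?orbT// maxr_pMr ?(ltW eps0)// mulr0.
by apply: (ge0_ler_powR p0); rewrite ?nnegrE ?le_maxr0//; apply: le_max2 => //; exact: vq.
Qed.

End comparison.

(** * The lower bound *)

Section sigma.
Context {R : realType} {d : nat}.
Local Notation E := 'rV[R]_d.+1.
Variables (p : R) (eta : R -> R).
Hypotheses (p1 : 1 <= p) (heta : radial_kernel (d := d) eta).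

Let e : E := delta_mx ord0 ord0.

Let dot_e z : dot e z = z ord0 ord0.
Proof.
rewrite /dot (bigD1 ord0)//= big1 ?addr0 => [|i i0]; first by rewrite mxE !eqxx mul1r.
by rewrite mxE (negPf i0) andbF mul0r.
Qed.

Let enorm_e : enorm e = 1.
Proof.
have : enorm e ^+ 2 = 1 by rewrite sqr_enorm dot_e mxE !eqxx.
by move/eqP; rewrite sqrf_eq1 => /orP[/eqP//|/eqP h]; have := enorm_ge0 e; rewrite h; lra.
Qed.

Let moment_e : (\int[lebesgue_rV d.+1]_z (kernel_moment p eta e z)%:E =
  (sigma_const (d := d) p eta)%:E)%E.
Proof.
rewrite /sigma_const.
have -> : (fun z : E => (eta (enorm z) * Num.max (z ord0 ord0) 0 `^ p)%:E) =
    (fun z => (kernel_moment p eta e z)%:E).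
  by apply/funext => z; rewrite /kernel_moment dot_e.
rewrite fineK//.
apply: kernel_moment_fin enorm_e => //.
- exact: kernel_ge0 heta.
- exact: kernel_le heta.
- exact: kernel_gt1 heta.
- exact: kernel0_gt0 heta.
Qed.

Lemma sigma_const_gt0 : 0 < sigma_const (d := d) p eta.
Proof.
have [L L0 eta_lip] := kernel_lipschitz heta.
rewrite -lte_fin -moment_e.
exact: (kernel_moment_gt0 (i := ord0) p1 (kernel_ge0 heta) (kernel0_gt0 heta) L0 eta_lip enorm_e dot_e).
Qed.

Lemma integral_kernel_moment_sigma (q : E) :
  (\int[lebesgue_rV d.+1]_z (kernel_moment p eta q z)%:E =
   (enorm q `^ p * sigma_const (d := d) p eta)%:E)%E.
Proof.
rewrite (integral_kernel_moment p1 (kernel_ge0 heta) (kernel_le heta) q enorm_e).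
by rewrite moment_e EFinM.
Qed.

End sigma.

Section sup_conv_on_target.
Context {R : realType} {d : nat}.
Local Notation E := 'rV[R]_d.+1.

(* Near Gamma, [D] grows at most like [G0 |x - y|], and
   [G0 l - l^2 / (2 s) <= G0^2 s / 2]. *)
Lemma sup_conv_on_target (Omega Gamma : set E) (g : E -> R) (K G0 r s : R) x :
  open Omega -> Gamma `<=` Omega -> r <= setdist Gamma (boundary Omega) ->
  (forall z, Omega z -> 0 <= g z <= G0) -> 0 <= K -> 0 < r -> 0 < s -> 2 * s * K <= r ^+ 2 ->
  Gamma x -> sup_conv Omega (chain_dist Omega Gamma g K) s x <= G0 ^+ 2 * s.
Proof.
move=> oO GO hr hg K0 r0 s0 sK Gx; have Ox := GO _ Gx.
have g0 z : Omega z -> 0 <= g z by move=> /hg/andP[].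
have s20 : 0 < 2 * s by rewrite mulr_gt0.
apply: sup_conv_le; first by exists x.
move=> y Oy; rewrite /penalized enormB.
have l0 : 0 <= enorm (y - x) := enorm_ge0 _.
have [h|h] := ltP (enorm (y - x)) r.
  have Dy : chain_dist Omega Gamma g K y <= G0 * enorm (y - x).
    have : chain_dist Omega Gamma g K y <= G0 * enorm (x - y) + chain_dist Omega Gamma g K x.
      apply: chain_dist_step => // t t01.
      have Oz : Omega (y + t *: (x - y)).
        apply: (ball_subset oO Ox Gx hr); apply: le_lt_trans h.
        have -> : y + t *: (x - y) - x = (1 - t) *: (y - x).
          by rewrite scalerBl scale1r -[x - y]opprB scalerN addrAC.
        have /andP[t0 t1] := t01.
        rewrite enormZ ger0_norm; last lra.
        by rewrite ler_piMl//; lra.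
      by split=> //; have /andP[] := hg _ Oz.
    rewrite [enorm (x - y)]enormB; have := chain_dist0 (Omega := Omega) g0 K0 Gx; lra.
  move: Dy l0; set l := enorm (y - x) => Dy l0.
  have : G0 * l - G0 ^+ 2 * s <= l ^+ 2 / (2 * s).
    by rewrite ler_pdivlMr//; have := sqr_ge0 (l - G0 * s); have := sqr_ge0 (G0 * s); lra.
  lra.
set l := enorm (y - x) in l0 h *.
have Dy := @chain_dist_le _ _ Omega Gamma g K y g0 K0.
have : K <= l ^+ 2 / (2 * s).
  rewrite ler_pdivlMr// mulrC (le_trans sK)//.
  by rewrite ler_sqr ?nnegrE// ltW.
have : 0 <= G0 ^+ 2 * s by rewrite mulr_ge0 ?sqr_ge0// ltW.
lra.
Qed.

End sup_conv_on_target.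

(** The deterministic half of the proof, for one fixed sample whose averages satisfy the bound;
    Gamma and [u] may therefore depend on the sample in any way. *)
Lemma graph_distance_bound (R : realType) (d : nat) (p : R) (eta : R -> R)
    (diam r rho_min f_min f_max L_rho L_f C1 : R) :
  1 <= p -> radial_kernel (d := d) eta -> 0 < r -> 0 <= diam -> 0 < rho_min ->
  0 < f_min -> 0 <= f_max -> 0 <= L_rho -> 0 <= L_f -> 0 <= C1 ->
  exists C s0 : R, [/\ 0 < C, 0 < s0, s0 <= 1 &
  forall (Omega : set 'rV[R]_d.+1) (rho f : 'rV[R]_d.+1 -> R),
    open Omega -> bounded_set Omega -> C11_boundary Omega ->
    reach (boundary Omega) = r%:E -> geodesic_diameter Omega = diam%:E ->
    (forall z, closure Omega z -> rho_min <= rho z) -> elipschitz L_rho (closure Omega) rho ->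
    (forall z, closure Omega z -> f_min <= f z <= f_max) -> elipschitz L_f (closure Omega) f ->
  forall eps lam : R, 0 < eps -> Num.sqrt eps <= s0 -> 0 < lam ->
  forall (n : nat) (x : 'I_n -> 'rV[R]_d.+1), (forall i, Omega (x i)) ->
    (forall i (q : 'rV[R]_d.+1), enorm q <= 3 * (f_max / rho_min + 1) ->
      \sum_j eta (enorm (eps^-1 *: (x i - x j))) *
        Num.max (dot q (eps^-1 *: (x i - x j)) + Num.sqrt eps) 0 `^ p <=
      n%:R * eps ^+ d.+1 * (sigma_const (d := d) p eta * rho (x i) * enorm q `^ p +
        C1 * (lam + Num.sqrt eps))) ->
  forall (Gamma : set 'rV[R]_d.+1) (u : 'rV[R]_d.+1 -> R),
    Gamma `<=` range x -> Gamma !=set0 -> r <= setdist Gamma (boundary Omega) ->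
    p_eikonal_solution p eta n eps (range x) Gamma f u ->
  forall i, (geodist_set Omega (fun z => (rho z `^ (- p^-1) * f z `^ p^-1)%R) (x i) Gamma <=
    (u (x i) + C * (Num.sqrt eps + lam))%:E)%E].
Proof.
move=> p1 heta r0 diam0 rm0 fm0 fM0 Lr0 Lf0 C10.
have p0 : 0 < p by apply: lt_le_trans p1.
have sig0 := sigma_const_gt0 p1 heta.
have [G0 G0E] : exists G0, G0 = f_max / rho_min + 1 by eexists.
have G00 : 0 < G0 by rewrite G0E ltr_wpDl// divr_ge0// ltW.
rewrite -G0E.
have [K K0 KE] : exists2 K, 0 <= K & K = G0 * (diam + 1).
  by eexists; last reflexivity; rewrite mulr_ge0 ?addr_ge0// ltW.
have [a [s1 [a0 s10 s11 slope]]] := @slope_bound R d.+1 _ _ _ _ _ _ _ _ p1 r0 K0 rm0 fm0 fM0 Lr0 Lf0.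
(* [b] turns the additive error [C1] into a relative one, as f >= f_min; the [+ 1] in [al] makes the
   subsolution strict. *)
have [b b0 bE] : exists2 b, 0 <= b & b * (sigma_const (d := d) p eta * f_min) = C1.
  exists (C1 / (sigma_const (d := d) p eta * f_min)).
    by rewrite divr_ge0// mulr_ge0// ltW.
  by rewrite divfK// lt0r_neq0// mulr_gt0.
have [al al0 alE] : exists2 al, 0 < al & al = a + b + 1.
  by eexists; last reflexivity; rewrite ltr_wpDl ?addr_ge0.
(* Ensures 2 s K <= r^2: maximisers for a point of Gamma that leave the ball of radius r then gain
   nothing. *)
pose s2 := r ^+ 2 / (2 * (K + 1)).
have K1 : 0 < 2 * (K + 1) by rewrite mulr_gt0// ltr_wpDl.
have s20 : 0 < s2 by rewrite divr_gt0 ?exprn_gt0.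
exists (G0 ^+ 2 + al * K), (Num.min s1 s2); split.
- by rewrite ltr_pwDl ?exprn_gt0// mulr_ge0// ltW.
- by rewrite lt_min s10.
- by rewrite ge_min s11.
move=> Omega rho f oO bO hC11 hreach hdiam hrho Lrho hf Lf eps lam eps0 se lam0 n x xO hsum.
move=> Gamma u GX Gn0 hr usol i.
pose g z := rho z `^ (- p^-1) * f z `^ p^-1; rewrite -/g.
pose s := Num.sqrt eps; rewrite -/s.
have s0 : 0 < s by rewrite sqrtr_gt0.
have ss1 : s <= s1 by rewrite (le_trans se)// ge_min lexx.
have ss2 : s <= s2 by rewrite (le_trans se)// ge_min lexx orbT.
have epsE : eps = s ^+ 2 by rewrite sqr_sqrtr// ltW.
have cO : Omega `<=` closure Omega by exact: subset_closure.
have GO : Gamma `<=` Omega by move=> _ /GX[k _ <-].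
have hg z : closure Omega z -> 0 <= g z <= G0.
  move=> cz; rewrite mulr_ge0 ?powR_ge0//=.
  have /andP[f1 f2] := hf _ cz.
  by rewrite G0E weight_le ?hrho//; exact: lt_le_trans f1.
have hgO z : Omega z -> 0 <= g z <= G0 by move=> /cO/hg.
have g0 z : Omega z -> 0 <= g z by move=> /hgO/andP[].
pose D := chain_dist Omega Gamma g K.
have D0 z : Omega z -> 0 <= D z by move=> _; exact: chain_dist_ge0.
have DK z : Omega z -> D z <= K by move=> _; exact: chain_dist_le.
pose v := sup_conv Omega D s.
have geoD : (geodist_set Omega g (x i) Gamma <= (D (x i))%:E)%E.
  apply: geodist_chain_dist => //; rewrite KE.
  by apply: geodist_set_le => //; exact: ltW.
apply: (le_trans geoD); rewrite lee_fin.
have Dv : D (x i) <= v (x i) by apply: (sup_conv_ge DK).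
have n0 : (0 < n)%N by exact: leq_ltn_trans (ltn_ord i).
pose th := s + lam; have th0 : 0 < th by rewrite addr_gt0.
have f0 j : 0 < f (x j) by have /andP[+ _] := hf _ (cO _ (xO j)); exact: lt_le_trans.
have cptO : compact (closure Omega).
  apply: bounded_closed_compact; first exact: closure_bounded.
  exact: closed_closure.
have Dstep := chain_dist_step Gamma g0 K0.
have normal y := boundary_normal oO bO hC11 r0 hreach (y := y).
have v0K j : 0 <= v (x j) <= K.
  rewrite (le_trans (D0 _ (xO j)) (sup_conv_ge DK s0 (xO j)))/=.
  by apply: sup_conv_le => [|y Oy]; [exists (x j)|exact: (penalized_le DK)].
have vsub j : graph_op p eta n eps (range x) v (x j) < f (x j) * (1 + al * th).
  have [y [cy semi hl hM]] := sup_conv_semiconvex oO cptO r0 D0 DK Dstep normal s0 (xO j).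
  have [qG hq] : enorm (s^-1 *: (y - x j)) <= 3 * G0 /\
      rho (x j) * enorm (s^-1 *: (y - x j)) `^ p <= f (x j) * (1 + a * s).
    rewrite G0E; apply: (slope Omega rho f) => //.
    - by move=> z /cO/hrho.
    - by move=> z /cO/hf.
    - by move=> z w Oz Ow; apply: Lrho; exact: cO.
    - by move=> z w Oz Ow; apply: Lf; exact: cO.
  set q := s^-1 *: (y - x j) in semi qG hq.
  apply: (@le_lt_trans _ _ (rho (x j) * enorm q `^ p + b * f_min * th)).
    apply: (@graph_op_bound _ _ p eta n eps x p1 _ _ _ v j q) => //.
    - exact: kernel_ge0 heta.
    - exact: kernel_gt1 heta.
    - move=> k hk.
      have w1 : enorm (x j - x k) <= s ^+ 2.
        by move: hk; rewrite ler_pdivrMl// mulr1 epsE.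
      apply: (le_trans (semi (x k))).
      (* The semiconvexity error is at most s^4 / (2 s), which is below eps s = s^3. *)
      rewrite mulrDr -dotZr scalerA mulfV ?lt0r_neq0// scale1r lerD2l.
      rewrite ler_pdivrMr ?mulr_gt0// -/s epsE.
      apply: (@le_trans _ _ ((s ^+ 2) ^+ 2)).
        by rewrite ler_sqr ?nnegrE ?enorm_ge0 ?sqr_ge0.
      have : 0 <= (s ^+ 2) ^+ 2 by exact: sqr_ge0.
      clear; lra.
    - have := hsum j q qG; rewrite -/s => h; apply: (le_trans h).
      rewrite ler_pM2l ?mulr_gt0 ?ltr0n ?exprn_gt0// le_eqVlt; apply/orP; left; apply/eqP.
      by rewrite /th -bE; ring.
  have h1 : f (x j) * (a * s) <= f (x j) * (a * th).
    by rewrite ler_pM2l// ler_wpM2l// lerDl ltW.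
  have h2 : b * f_min * th <= f (x j) * (b * th).
    have /andP[fj _] := hf _ (cO _ (xO j)).
    rewrite [b * _]mulrC -mulrA ler_wpM2r// mulr_ge0// ltW//.
  have h3 : 0 < f (x j) * th by rewrite mulr_gt0.
  rewrite alE; clear - hq h1 h2 h3; lra.
have a1 : 0 < al * th by rewrite mulr_gt0.
have [k Gk hk] := graph_comparison p1 (kernel_ge0 heta) eps0 sig0 n0 a1 f0 v0K vsub usol.
have vk : v (x k) <= G0 ^+ 2 * s.
  apply: (sup_conv_on_target (r := r)) => //.
  apply: (@le_trans _ _ (s2 * (2 * (K + 1)))).
    rewrite -mulrA mulrCA ler_pM ?mulr_ge0 ?(ltW s0)// ler_pM2l// lerDl//.
  by rewrite /s2 divfK// lt0r_neq0.
have := hk i.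
have h4 : 0 <= G0 ^+ 2 * lam by rewrite mulr_ge0 ?sqr_ge0// ltW.
rewrite /th; clear - Dv vk h4; lra.
Qed.

(** Gamma may depend on the outcome in any way, so the set of outcomes where the estimate holds may
    fail to be measurable; a measurable subset of large probability is exhibited. *)
Theorem theorem4p1 (R : realType) (d : nat) (p : R) (eta : R -> R)
    (diam r rho_min rho_max L_rho f_min f_max L_f : R)
    (hp : 1 <= p) (heta : radial_kernel (d := d) eta) (hr : 0 < r)
    (hrho_min : 0 < rho_min) (hf_min : 0 < f_min) :
  exists C c eps0 : R, [/\ 0 < C, 0 < c, 0 < eps0 &
  forall (Omega : set 'rV[R]_d.+1) (rho f : 'rV[R]_d.+1 -> R),
    open Omega -> bounded_set Omega -> connected Omega ->
    C11_boundary Omega ->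
    reach (boundary Omega) = r%:E ->
    geodesic_diameter Omega = diam%:E ->
    (forall x, closure Omega x -> rho_min <= rho x <= rho_max) ->
    elipschitz L_rho (closure Omega) rho ->
    (forall x, closure Omega x -> f_min <= f x <= f_max) ->
    elipschitz L_f (closure Omega) f ->
  forall (eps : R), 0 < eps -> eps <= eps0 ->
  forall (lambda : R), 0 < lambda -> lambda <= 1 ->
  forall (n : nat) (dT : measure_display) (T : measurableType dT)
    (P : probability T R) (x : 'I_n -> {RV P >-> 'rV[R]_d.+1}),
    (forall i w, Omega (x i w)) ->
    (forall i, has_density Omega rho (x i)) ->
    mutually_independent x ->
  forall Gamma : T -> set 'rV[R]_d.+1,
  let X := fun w => range (fun i => x i w) in
  let g := fun z => rho z `^ (- p^-1) * f z `^ p^-1 in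
  exists G : set T,
  [/\ measurable G,
      G `<=` [set w |
        Gamma w `<=` X w -> Gamma w !=set0 ->
        r <= setdist (Gamma w) (boundary Omega) ->
        forall u : 'rV[R]_d.+1 -> R,
        p_eikonal_solution p eta n eps (X w) (Gamma w) f u ->
        (\big[maxe/-oo]_(i < n)
           (geodist_set Omega g (x i w) (Gamma w) - (u (x i w))%:E)
         <= (C * (Num.sqrt eps + lambda))%:E)%E] &
      ((1 - 2 * n%:R * expR (- (c * n%:R * eps ^+ d.+1 * lambda ^+ 2)))%:E
         <= P G)%E]].
Proof.
have [L L0 eta_lip] := kernel_lipschitz heta.
have sig0 := sigma_const_gt0 hp heta.
(* The constants are fixed before any domain is given, when the signs of [f_max], [diam] and the
   Lipschitz constants are still unknown; hence absolute values. *)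
have Q0 : 0 <= 3 * (`|f_max| / rho_min + 1).
  by rewrite mulr_ge0 ?addr_ge0 ?divr_ge0// ltW.
have [C1 [c1 [C0 [C10 c10 C00 unif]]]] := uniform_concentration hp (kernel_ge0 heta)
  (kernel_le heta) (kernel_gt1 heta) (kernel0_gt0 heta) L0 eta_lip (ltW sig0)
  (integral_kernel_moment_sigma hp heta)
  Q0 (normr_ge0 diam) (normr_ge0 rho_max) (normr_ge0 L_rho).
have [C [s0 [CC0 s00 s01 bound]]] := graph_distance_bound hp heta hr
  (normr_ge0 diam) hrho_min hf_min (normr_ge0 f_max) (normr_ge0 L_rho) (normr_ge0 L_f) (ltW C10).
have [c c0 absorb] := absorb_prefactor (2 * d.+1) C00 c10.
exists C, c, (s0 ^+ 2); split; rewrite ?exprn_gt0//.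
move=> Omega rho f oO bO cO hC11 hreach hdiam hrho Lrho hf Lf eps e0 es lam l0 l1 n dT T P x xO dens indep.
move=> Gamma X g.
have se : Num.sqrt eps <= s0 by rewrite -[leRHS]ger0_norm ?(ltW s00)// -sqrtr_sqr ler_wsqrtr.
have e1 : eps <= 1 by rewrite (le_trans es)// exprn_ile1// ltW.
have [n0|n0] := posnP n.
  exists setT; split => // [w _ _ _ _ u _|]; last first.
    rewrite probability_setT lee_fin lerBlDr lerDl !mulr_ge0 ?expR_ge0//.
  by subst n; rewrite big_ord0 leNye.
(* If the claimed probability is at most 0, the empty event will do; otherwise the polynomial
   prefactor can be absorbed. *)
have [big|small] := leP 1 (2 * n%:R * expR (- (c * n%:R * eps ^+ d.+1 * lam ^+ 2))).
  exists set0; split => //.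
  by rewrite measure0 lee_fin subr_le0.
(* An outcome provides a point of Omega, used as the origin of the grid and to see that [diam] is
   nonnegative. *)
have [w0 _] : [set: T] !=set0.
  apply/set0P/eqP => T0; have := probability_setT P; rewrite T0 measure0 => /eqP.
  by rewrite eq_sym onee_eq0.
have Oo := xO (Ordinal n0) w0; set o := x (Ordinal n0) w0 in Oo.
have diamE : `|diam| = diam.
  rewrite ger0_norm//; apply: le_trans (geodesic_diameter_coord ord0 hdiam Oo Oo).
  exact: normr_ge0.
have cl : Omega `<=` closure Omega := @subset_closure _ _.
have [] := unif Omega rho o _ _ _ eps lam e0 e1 l0 l1 n dT T P x xO dens indep.
- by move=> z i Oz; rewrite diamE; exact: geodesic_diameter_coord hdiam Oz Oo.
- move=> z /cl/hrho/andP[h1 h2]; rewrite (le_trans (ltW hrho_min))//=.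
  by rewrite (le_trans h2)// ler_norm.
- move=> y z /cl Oy /cl Oz; rewrite (le_trans (Lrho _ _ Oy Oz))//.
  by rewrite ler_wpM2r ?enorm_ge0// ler_norm.
move=> G [mG GE PG]; exists G; split => //.
  move=> w Gw GX Gn0 hrG u usol; apply: bigmax_le; first by rewrite leNye.
  move=> i _; rewrite leeBlDr// -EFinD addrC.
  apply: (bound Omega rho f _ _ _ _ _ _ _ _ _ eps lam _ _ _ n (fun j => x j w)) => //.
  - by rewrite diamE.
  - by move=> z /hrho/andP[].
  - by move=> y z Oy Oz; rewrite (le_trans (Lrho _ _ Oy Oz))// ler_wpM2r ?enorm_ge0// ler_norm.
  - by move=> z /hf/andP[-> h]/=; rewrite (le_trans h)// ler_norm.
  - by move=> y z Oy Oz; rewrite (le_trans (Lf _ _ Oy Oz))// ler_wpM2r ?enorm_ge0// ler_norm.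
  - exact: GE.
rewrite -[G]setCK probability_setC; last exact: measurableC.
rewrite EFinB leeB// (le_trans PG)// lee_fin.
rewrite -[c1 * n%:R * _ * _]mulrA -[c * n%:R * _ * _]mulrA; apply: absorb => //.
- by rewrite mulr_gt0 ?exprn_gt0.
- by rewrite mulr_ile1 ?exprn_ge0 ?exprn_ile1 ?(ltW e0) ?(ltW l0).
- by rewrite mulrA.
Qed.
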